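(* Let $\boldsymbol\mu\in\mathcal{PM}_+(\mathbb T^2)$. Then the set of all polynomials (in $z_1,z_2$) is dense in $\mathcal D^2(\boldsymbol\mu)$.
   Context: $\mathcal M_+(\mathbb T)$ is the set of finite positive Borel measures on the unit circle $\mathbb T$ (parametrized by $t\in[0,2\pi)$); $\mathcal{PM}_+(\mathbb T^2)$ is the set of measures $\boldsymbol\mu=\mu_1\times\mu_2$ on $\mathbb T^2$ with $\mu_1,\mu_2\in\mathcal M_+(\mathbb T)$. For $\nu\in\mathcal M_+(\mathbb T)$, $P_\nu(z)=\frac1{2\pi}\int_0^{2\pi}\frac{1-|z|^2}{|e^{it}-z|^2}\,d\nu(t)$, $z\in\mathbb D$. $dA$ is normalized area measure on $\mathbb D$. For $f$ holomorphic on $\mathbb D^2$ put $D^{(2)}_{\boldsymbol\mu,1}(f)=\lim_{r\to1^-}\frac1{2\pi}\int_{\mathbb D}\int_0^{2\pi}|\partial_1f(z_1,re^{it})|^2P_{\mu_1}(z_1)\,dt\,dA(z_1)$, $D^{(2)}_{\boldsymbol\mu,2}(f)=\lim_{r\to1^-}\frac1{2\pi}\int_{\mathbb D}\int_0^{2\pi}|\partial_2f(re^{it},z_2)|^2P_{\mu_2}(z_2)\,dt\,dA(z_2)$, $D^{(2)}_{\boldsymbol\mu,3}(f)=\int_{\mathbb D}\int_{\mathbb D}|\partial_1\partial_2f(z_1,z_2)|^2P_{\mu_1}(z_1)P_{\mu_2}(z_2)\,dA(z_1)dA(z_2)$, and $D^{(2)}_{\boldsymbol\mu}(f)=\sum_{j=1}^3D^{(2)}_{\boldsymbol\mu,j}(f)$.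 For non-zero $\boldsymbol\mu$, $\mathcal D^2(\boldsymbol\mu)$ is the set of holomorphic $f$ on $\mathbb D^2$ with $D^{(2)}_{\boldsymbol\mu}(f)<\infty$ (such $f$ lie in the Hardy space $H^2(\mathbb D^2)$); for $\boldsymbol\mu=0$, $\mathcal D^2(\boldsymbol\mu)=H^2(\mathbb D^2)$. Density is with respect to the norm given by $\|f\|_{\boldsymbol\mu}^2=\|f\|^2_{H^2(\mathbb D^2)}+D^{(2)}_{\boldsymbol\mu}(f)$. *)

(* Defs.v *)
From HB Require Import structures.
From mathcomp Require Export all_boot all_order all_algebra.
From mathcomp Require Export complex.
From mathcomp Require Export all_classical all_reals all_analysis.

Set Implicit Arguments.
Unset Strict Implicit.
Unset Printing Implicit Defensive.

Import Order.TTheory GRing.Theory Num.Theory.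
Import numFieldNormedType.Exports.

Local Open Scope classical_set_scope.
Local Open Scope complex_scope.
Local Open Scope ring_scope.
Local Open Scope ereal_scope.

(* The library norm on R[i] takes its values in R[i]; Normc.normc is the
   modulus as an element of R. *)
Notation modulus := Normc.normc.

Section bidisc.
Variable R : realType.
Local Notation C := (R[i]^o)%type.
Local Notation leb := (@lebesgue_measure R).

Definition unit_disc : set C := [set z | (modulus z < 1)%R].

Definition bidisc : set (C * C) := unit_disc `*` unit_disc.

Definition expi (t : R) : C := cos t +i* sin t.

Definition arc : set R := `[0%R, (2 * pi)%R[%classic.

(* C is R[i] as a normed space over R[i], so this is complex Frechet
   differentiability of f : C^2 -> C. *)
Definition holomorphic2 (f : C * C -> C) : Prop :=
  forall z, bidisc z -> differentiable f z.

Definition partial1 (f : C * C -> C) : C * C -> C :=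
  fun z => 'D_((1, 0)%R : C * C) f z.

Definition partial2 (f : C * C -> C) : C * C -> C :=
  fun z => 'D_((0, 1)%R : C * C) f z.

Definition circle_int (F : C -> \bar R) (r : R) : \bar R :=
  ((2 * pi)^-1)%:E * \int[leb]_(t in arc) F (r%:C * expi t)%R.

Definition area_int (F : C -> \bar R) : \bar R :=
  (pi^-1)%:E *
  \int[leb \x leb]_(p in [set p : R * R | (p.1 ^+ 2 + p.2 ^+ 2 < 1)%R])
    F (p.1 +i* p.2).

(* A Borel measure on the circle is encoded as a Borel measure on R
   concentrated on [0, 2 pi[, through t |-> expi t. *)
Definition on_circle (nu : set R -> \bar R) : Prop := nu (~` arc) = 0.

Local Notation fmeas := {finite_measure set (measurableTypeR R) -> \bar R}.

Definition poisson (nu : fmeas) (z : C) : R :=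
  ((2 * pi)^-1 * \int[nu]_(t in arc)
     ((1 - modulus z ^+ 2) / modulus (expi t - z) ^+ 2))%R.

Definition hardy_normsq (f : C * C -> C) : \bar R :=
  ereal_sup [set circle_int (fun z1 => circle_int (fun z2 =>
               (modulus (f (z1, z2)) ^+ 2)%:E) r) r
            | r in [set r : R | (0 <= r < 1)%R]].

Definition hardy2 : set (C * C -> C) :=
  [set f | holomorphic2 f /\ hardy_normsq f < +oo].

Definition dirichlet1 (mu1 : fmeas) (f : C * C -> C) : \bar R :=
  lim (area_int (fun z1 => circle_int (fun z2 =>
         (modulus (partial1 f (z1, z2)) ^+ 2 * poisson mu1 z1)%:E) r)
       @[r --> (1%R : R)^'-]).

Definition dirichlet2 (mu2 : fmeas) (f : C * C -> C) : \bar R :=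
  lim (area_int (fun z2 => circle_int (fun z1 =>
         (modulus (partial2 f (z1, z2)) ^+ 2 * poisson mu2 z2)%:E) r)
       @[r --> (1%R : R)^'-]).

Definition dirichlet3 (mu1 mu2 : fmeas) (f : C * C -> C) : \bar R :=
  area_int (fun z1 => area_int (fun z2 =>
    (modulus (partial1 (partial2 f) (z1, z2)) ^+ 2
     * poisson mu1 z1 * poisson mu2 z2)%:E)).

Definition zero_product (mu1 mu2 : fmeas) : Prop :=
  forall A, measurable A -> (mu1 \x mu2) A = 0.

(* The three integrals depend on the factors.  The zero measure is always read
   as 0 x 0, so that they vanish, even when it is presented as mu1 x mu2 with
   only one zero factor. *)
Definition dirichlet (mu1 mu2 : fmeas) (f : C * C -> C) : \bar R :=
  if `[< zero_product mu1 mu2 >] then 0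
  else dirichlet1 mu1 f + dirichlet2 mu2 f + dirichlet3 mu1 mu2 f.

Definition dirichlet_space (mu1 mu2 : fmeas) : set (C * C -> C) :=
  if `[< zero_product mu1 mu2 >] then hardy2
  else [set f | holomorphic2 f /\ dirichlet mu1 mu2 f < +oo].

Definition dirichlet_norm (mu1 mu2 : fmeas) (f : C * C -> C) : \bar R :=
  sqrte (hardy_normsq f + dirichlet mu1 mu2 f).

Definition polynomial_functions : set (C * C -> C) :=
  [set f | exists p : {poly {poly C}}, f = fun z => (p.[(z.1)%:P].[z.2])%R].

(* A is a dense subset of X for the distance N (f - g). *)
Definition dense_subset (N : (C * C -> C) -> \bar R)
    (A X : set (C * C -> C)) : Prop :=
  A `<=` X /\
  forall f, X f -> forall e : R, (0 < e)%R ->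
    exists2 g, A g & N (f \- g)%R < e%:E.

End bidisc.

(* Main.v *)
(* Holomorphic functions on the bidisc are locally uniform limits of polynomials
   together with their partial derivatives (Goursat, Cauchy and Taylor in each
   variable).  For mu <> 0 the norm of f is bounded by the energy
     |f(0,0)|^2 + int |d1 f(.,0)|^2 P_mu1 + int |d2 f(0,.)|^2 P_mu2 + D_3(f),
   which is finite on D^2(mu): D_1 and D_2 are suprema of monotone slice means,
   and a one-variable Littlewood-Paley estimate (Parseval for polynomials, together
   with P_nu >= c (1 - |z|^2)) bounds Hardy norms by weighted area integrals.
   The key point is that dilation almost contracts the weighted integrals,
     int |g(a z)|^2 P_nu <= (1/a) int |g|^2 P_nu,
   by Poisson-Jensen and harmonicity of the Poisson kernel.  So for the
   derivatives a d1 f(a .,0), a d2 f(0,a .) and a^2 d1 d2 f(a .,a .) of the dilations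
   f_a = f(a .,a .) the norms do not exceed the limiting ones, and pointwise
   convergence upgrades to norm convergence (Fatou and the parallelogram law).
   Finally f_a is uniformly approximated, with derivatives, by polynomials.
   For mu = 0 the same argument runs on the torus means of |f|^2. *)
Require Import Defs.
From HB Require Import structures.
From mathcomp Require Import ring lra measurable_realfun.

Set Implicit Arguments.
Unset Strict Implicit.
Unset Printing Implicit Defensive.

Import Order.TTheory GRing.Theory Num.Theory.
Import numFieldNormedType.Exports.

Local Open Scope classical_set_scope.
Local Open Scope complex_scope.
Local Open Scope ring_scope.
Local Notation Re := complex.Re.
Local Notation Im := complex.Im.

(** * Complex exponentials and contour integrals *)

Section complex_basics.
Variable R : realType.
Local Notation C := (R[i]^o)%type.
Implicit Types (x y z w : C) (r s t : R).

(** The obstacle is that the norm is not given by integrals with fixed weights: its Hardy part and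
    the first two Dirichlet integrals are suprema over circles of radius r, and Fatou's lemma at
    each r gives nothing uniform in r. The energy keeps only the slice means of radius 0, where the
    other variable sits at its centre. It is a point value plus three integrals against fixed finite
    weights, so norm convergence can be tested there; bounding the suprema back by the energy is
    what the Littlewood-Paley estimate is for. That estimate needs mass on both circles, which a
    non-zero product provides. The cost 1/a of dilating one variable is harmless because each
    differentiation of the dilated function brings a factor a: after squaring, a^2 / a = a in the
    first-order terms and a^4 / a^2 = a^2 in the mixed one, both at most 1. Holomorphy enters the
    estimates only as [poly_lim2], local uniform approximability by polynomials. Measurability, the
    symmetry of mixed derivatives and the Littlewood-Paley inequality are obtained on polynomials
    and carried over to the limit. *)

Lemma modulus_ge0 z : 0 <= modulus z.
Proof. by case: z => a b; rewrite /= sqrtr_ge0. Qed.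

Lemma modulusE z : `|z| = (modulus z)%:C.
Proof. by []. Qed.

Lemma modulusM z w : modulus (z * w) = modulus z * modulus w.
Proof. exact: Normc.normcM. Qed.

Lemma modulusV z : modulus z^-1 = (modulus z)^-1.
Proof. exact: Normc.normcV. Qed.

Lemma modulusD z w : modulus (z + w) <= modulus z + modulus w.
Proof. exact: le_normcD. Qed.

Lemma modulusN z : modulus (- z) = modulus z.
Proof. exact: normcN. Qed.

Lemma modulusB z w : modulus (z - w) = modulus (w - z).
Proof. by rewrite -modulusN opprB. Qed.

Lemma modulusX z n : modulus (z ^+ n) = modulus z ^+ n.
Proof.
elim: n => [|n IH]; first by rewrite !expr0 Normc.normc1.
by rewrite !exprS modulusM IH.
Qed.

Lemma modulusC r : modulus r%:C = `|r|.
Proof. by rewrite /= expr0n addr0 sqrtr_sqr. Qed.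

Lemma modulus_gt0 z : z != 0 -> 0 < modulus z.
Proof.
move=> z0; rewrite lt_neqAle modulus_ge0 andbT eq_sym.
by apply/negP => /eqP /Normc.eq0_normc /eqP; rewrite (negPf z0).
Qed.

Lemma modulus_le0 z : modulus z <= 0 -> z = 0.
Proof.
move=> z0; apply: Normc.eq0_normc; apply/le_anti; rewrite z0; exact: modulus_ge0.
Qed.

Lemma modulus_sqr z : modulus z ^+ 2 = Re z ^+ 2 + Im z ^+ 2.
Proof.
case: z => a b /=; rewrite sqr_sqrtr // addr_ge0 // sqr_ge0 //.
Qed.

Lemma Re_le_modulus z : `|Re z| <= modulus z.
Proof.
rewrite -(ler_pXn2r (n:=2)) ?nnegrE ?modulus_ge0 // modulus_sqr real_normK ?num_real //.
by rewrite lerDl sqr_ge0.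
Qed.

Lemma Im_le_modulus z : `|Im z| <= modulus z.
Proof.
rewrite -(ler_pXn2r (n:=2)) ?nnegrE ?modulus_ge0 // modulus_sqr real_normK ?num_real //.
by rewrite lerDr sqr_ge0.
Qed.

Lemma modulus_le_ReIm z : modulus z <= `|Re z| + `|Im z|.
Proof.
rewrite -(ler_pXn2r (n:=2)) ?nnegrE ?modulus_ge0 ?addr_ge0 // modulus_sqr.
rewrite sqrrD !real_normK ?num_real // -addrA lerD2l lerDr.
by rewrite mulrn_wge0 // mulr_ge0.
Qed.

Lemma modulusB_ge z w : modulus z - modulus w <= modulus (z - w).
Proof. by rewrite lerBlDr; apply: le_trans (modulusD _ _); rewrite subrK. Qed.

Lemma expiD s t : expi (s + t) = expi s * expi t.
Proof. by rewrite /expi sinD cosD; simpc; rewrite [sin s * cos t + _]addrC. Qed.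

Lemma modulus_expi t : modulus (expi t) = 1.
Proof. by rewrite /expi /= cos2Dsin2 sqrtr1. Qed.

Lemma expi_neq0 t : expi t != 0.
Proof.
by apply/eqP => e; move: (modulus_expi t); rewrite e Normc.normc0 => /esym/eqP; rewrite oner_eq0.
Qed.

Lemma expi_2pi t : expi (t + 2 * pi) = expi t.
Proof.
by rewrite /expi [2 * pi](_ : _ = pi *+ 2) ?mulr_natl // cosD2pi sinD2pi.
Qed.

Lemma expi0 : expi 0 = 1 :> C.
Proof. by rewrite /expi cos0 sin0. Qed.

Lemma conjc_expi t : (expi t)^*%C = expi (- t).
Proof. by rewrite /expi cosN sinN. Qed.

Lemma expiN t : expi (- t) = (expi t)^-1 :> C.
Proof.
by apply: (mulfI (expi_neq0 t)); rewrite -expiD subrr expi0 divff // expi_neq0.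
Qed.

Lemma modulus_rexpi r t : modulus (r%:C * expi t) = `|r|.
Proof. by rewrite modulusM modulus_expi mulr1 modulusC. Qed.

(** A positive element of [R[i]] has zero imaginary part, so radii in [R] are enough to describe
    convergence for the [R[i]]-valued norm. *)
Lemma ccvgP (T : Type) (F : set_system T) (FF : Filter F) (f : T -> C) (l : C) :
  f @ F --> l <-> forall e : R, 0 < e -> \forall x \near F, modulus (f x - l) < e.
Proof.
split=> [/cvgrPdist_lt h e e0|h].
  have := h e%:C; rewrite ltcR => /(_ e0); apply: filterS => x.
  by rewrite distrC modulusE ltcR.
apply/cvgrPdist_lt => e.
rewrite ltcE /= => /andP[/eqP e0 /h]; apply: filterS => x.
by rewrite distrC modulusE ltcE /= e0 eqxx.
Qed.

Lemma nbhs_discP z (P : C -> Prop) :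
  nbhs z P <-> exists2 e : R, 0 < e & forall w, modulus (w - z) < e -> P w.
Proof.
split=> [/nbhs_ballP[e e0 h]|[e e0 h]].
  move: e0; rewrite /= ltcE /= => /andP[/eqP ei e0].
  exists (Re e) => // w wz; apply: h; rewrite /ball /= distrC modulusE.
  by rewrite ltcE /= ei eqxx.
apply/nbhs_ballP; exists e%:C; first by rewrite /= ltcR.
by move=> w; rewrite /ball /= distrC modulusE ltcR => /h.
Qed.

Lemma continuous_ReIm (T : topologicalType) (f : T -> C) (a : T) :
  f x @[x --> a] --> f a <->
  Re (f x) @[x --> a] --> Re (f a) /\ Im (f x) @[x --> a] --> Im (f a).
Proof.
split=> [/ccvgP h|[/cvgrPdist_lt h1 /cvgrPdist_lt h2]].
  split; apply/cvgrPdist_lt => e /h; apply: filterS => x; apply: le_lt_trans.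
    rewrite distrC; have -> : Re (f x) - Re (f a) = Re (f x - f a) by case: (f x); case: (f a).
    exact: Re_le_modulus.
  rewrite distrC; have -> : Im (f x) - Im (f a) = Im (f x - f a) by case: (f x); case: (f a).
  exact: Im_le_modulus.
apply/ccvgP => e e0; have e20 : 0 < e / 2 by rewrite divr_gt0.
near=> x; apply: le_lt_trans (modulus_le_ReIm _) _.
have -> : Im (f x - f a) = Im (f x) - Im (f a) by case: (f x); case: (f a).
have -> : Re (f x - f a) = Re (f x) - Re (f a) by case: (f x); case: (f a).
rewrite [e]splitr ltrD // distrC; near: x; [exact: h1|exact: h2].
Unshelve. all: by end_near. Qed.

Lemma continuous_realC : continuous (fun r : R => r%:C : C).
Proof. by move=> r; apply/continuous_ReIm; split; [exact: cvg_id|exact: cvg_cst]. Qed.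

Lemma continuous_expi : continuous (@expi R).
Proof.
by move=> t; apply/continuous_ReIm; split; [exact: continuous_cos|exact: continuous_sin].
Qed.

Lemma continuous_modulus : continuous (fun z : C => modulus z).
Proof.
move=> z; apply/(cvgrPdist_lt (F := nbhs z)) => e e0.
apply/nbhs_discP; exists e => // w h.
apply: le_lt_trans h; rewrite ler_norml; have := modulusB_ge z w; have := modulusB_ge w z.
by rewrite (modulusB z w); lra.
Qed.

End complex_basics.

(** * Goursat's bisection argument for additive functions of a rectangle *)

Section bisection.
Variable R : realType.
Local Notation C := (R[i]^o)%type.

Variables (E : R -> R -> R -> R -> C) (a b c d : R).
Hypotheses (ab : a <= b) (cd : c <= d).
Hypothesis Ex : forall x0 x1 x2 y0 y1, a <= x0 -> x0 <= x1 -> x1 <= x2 -> x2 <= b ->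
  c <= y0 -> y0 <= y1 -> y1 <= d -> E x0 x2 y0 y1 = E x0 x1 y0 y1 + E x1 x2 y0 y1.
Hypothesis Ey : forall x0 x1 y0 y1 y2, a <= x0 -> x0 <= x1 -> x1 <= b ->
  c <= y0 -> y0 <= y1 -> y1 <= y2 -> y2 <= d -> E x0 x1 y0 y2 = E x0 x1 y0 y1 + E x0 x1 y1 y2.
Hypothesis El : forall p q, a <= p <= b -> c <= q <= d -> forall e, 0 < e ->
  exists2 r, 0 < r & forall x0 x1 y0 y1, a <= x0 <= p -> p <= x1 <= b ->
    c <= y0 <= q -> q <= y1 <= d -> x1 - x0 < r -> y1 - y0 < r ->
    modulus (E x0 x1 y0 y1) <= e * ((x1 - x0) + (y1 - y0)) ^+ 2.

(** The rectangle of generation [n] with lower left corner (x, y) is too large for the local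
    estimate: [E] exceeds [k] times its squared half-perimeter. *)
Let bad k x y n := k * ((b - a) / 2 ^+ n + (d - c) / 2 ^+ n) ^+ 2 <
  modulus (E x (x + (b - a) / 2 ^+ n) y (y + (d - c) / 2 ^+ n)).

(** The last quarter is taken untested. If the other three are not bad it must be, since four times
    the squared half-perimeter of a quarter is that of the whole. *)
Let quarter k (n : nat) (p : R * R) : R * R :=
  let l := (b - a) / 2 ^+ n.+1 in let h := (d - c) / 2 ^+ n.+1 in
  if bad k p.1 p.2 n.+1 then p
  else if bad k (p.1 + l) p.2 n.+1 then (p.1 + l, p.2)
  else if bad k p.1 (p.2 + h) n.+1 then (p.1, p.2 + h)
  else (p.1 + l, p.2 + h).

Let corner k := fix corner n := if n is n'.+1 then quarter k n' (corner n') else (a, c).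

Let inK p n := [/\ a <= p.1, p.1 + (b - a) / 2 ^+ n <= b, c <= p.2 &
  p.2 + (d - c) / 2 ^+ n <= d].

Let half (l : R) n : l / 2 ^+ n = l / 2 ^+ n.+1 + l / 2 ^+ n.+1.
Proof. by rewrite exprS; field; rewrite expf_neq0. Qed.

Let w_ge0 (l : R) n : 0 <= l -> 0 <= l / 2 ^+ n.
Proof. by move=> l0; rewrite divr_ge0 // exprn_ge0. Qed.

Let quarterP k n p : inK p n -> bad k p.1 p.2 n ->
  [/\ inK (quarter k n p) n.+1, bad k (quarter k n p).1 (quarter k n p).2 n.+1,
      p.1 <= (quarter k n p).1 & p.2 <= (quarter k n p).2].
Proof.
case: p => x y; rewrite /inK /= => -[ax xb cy yd] B.
have l0 : 0 <= (b - a) / 2 ^+ n.+1 by apply: w_ge0; rewrite subr_ge0.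
have h0 : 0 <= (d - c) / 2 ^+ n.+1 by apply: w_ge0; rewrite subr_ge0.
have lE := half (b - a) n; have hE := half (d - c) n.
rewrite lE in xb; rewrite hE in yd.
rewrite /quarter /=.
set l := (b - a) / 2 ^+ n.+1 in lE l0 xb *; set h := (d - c) / 2 ^+ n.+1 in hE h0 yd *.
have xl : x + l <= b by apply: le_trans xb; rewrite lerD2l lerDl.
have yh : y + h <= d by apply: le_trans yd; rewrite lerD2l lerDl.
have [ax2 cy2] : a <= x + l /\ c <= y + h by rewrite !ler_wpDr.
have [xx yy] : x <= x + l /\ y <= y + h by rewrite !lerDl.
rewrite !addrA in xb yd.
case: ifPn => [B1|N1]; first by split.
case: ifPn => [B2|N2] /=; first by split.
case: ifPn => [B3|N3] /=; first by split.
split => //.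
move: B N1 N2 N3; rewrite /bad -/l -/h lE hE -!leNgt => B N1 N2 N3; rewrite ltNge; apply/negP => N4.
have : E x (x + (l + l)) y (y + (h + h)) =
    E x (x + l) y (y + h) + E (x + l) (x + l + l) y (y + h) +
    (E x (x + l) (y + h) (y + h + h) + E (x + l) (x + l + l) (y + h) (y + h + h)).
  have ll : x + l <= x + l + l by rewrite lerDl.
  have hh : y + h <= y + h + h by rewrite lerDl.
  rewrite -(Ex ax xx ll xb cy yy yh) -(Ex ax xx ll xb cy2 hh yd) [x + _]addrA [y + (h + h)]addrA.
  exact: (Ey ax (le_trans xx ll) xb cy yy hh yd).
move=> eE; move: B; rewrite eE ltNge => /negP; apply.
apply: le_trans (modulusD _ _) _; apply: le_trans (lerD (modulusD _ _) (modulusD _ _)) _.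
apply: le_trans (lerD (lerD N1 N2) (lerD N3 N4)) _.
by rewrite le_eqVlt; apply/orP; left; apply/eqP; ring.
Qed.

Let cornerP k n : bad k a c 0 ->
  inK (corner k n) n /\ bad k (corner k n).1 (corner k n).2 n.
Proof.
move=> B; elim: n => [|n [I1 B1]]; last by have [] := quarterP I1 B1.
by split=> //=; rewrite /inK /= expr0 divr1; split; lra.
Qed.

Let corner_le k n m : bad k a c 0 -> (n <= m)%N ->
  (corner k n).1 <= (corner k m).1 /\ (corner k n).2 <= (corner k m).2.
Proof.
move=> B /subnKC <-; elim: (m - n)%N => [|j [i1 i2]]; first by rewrite addn0.
rewrite addnS /=; have [I1 B1] := cornerP (n + j) B; have [_ _ j1 j2] := quarterP I1 B1.
by split; [exact: le_trans i1 j1|exact: le_trans i2 j2].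
Qed.

(** Lower left corners increase and upper right corners decrease along the nested rectangles. Hence
    the suprema of the corner coordinates lie in every rectangle, which locates the common point. *)
Let corner_ub k n m : bad k a c 0 ->
  (corner k n).1 <= (corner k m).1 + (b - a) / 2 ^+ m /\
  (corner k n).2 <= (corner k m).2 + (d - c) / 2 ^+ m.
Proof.
move=> B; have [nm|/ltnW mn] := leqP n m.
  have [h1 h2] := corner_le B nm.
  by split; [apply: (le_trans h1)|apply: (le_trans h2)]; rewrite lerDl w_ge0 // subr_ge0.
move: mn => /subnKC <-; move: (n - m)%N => {n}.
have : forall j, (corner k (m + j)).1 + (b - a) / 2 ^+ (m + j) <= (corner k m).1 + (b - a) / 2 ^+ m /\
  (corner k (m + j)).2 + (d - c) / 2 ^+ (m + j) <= (corner k m).2 + (d - c) / 2 ^+ m.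
  elim=> [|j [i1 i2]]; first by rewrite addn0.
  rewrite addnS /=; move: i1 i2; rewrite (half (b - a) (m + j)) (half (d - c) (m + j)).
  have l0 : 0 <= (b - a) / 2 ^+ (m + j).+1 by apply: w_ge0; rewrite subr_ge0.
  have h0 : 0 <= (d - c) / 2 ^+ (m + j).+1 by apply: w_ge0; rewrite subr_ge0.
  rewrite /quarter /=; move: l0 h0.
  generalize ((b - a) / 2 ^+ (m + j).+1) ((d - c) / 2 ^+ (m + j).+1) => l h l0 h0.
  by case: ifP => _; last case: ifP => _; last case: ifP => _; move=> /= i1 i2; split; lra.
move=> H j; have [h1 h2] := H j.
have l0 : 0 <= (b - a) / 2 ^+ (m + j) by apply: w_ge0; rewrite subr_ge0.
have h0 : 0 <= (d - c) / 2 ^+ (m + j) by apply: w_ge0; rewrite subr_ge0.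
by split; lra.
Qed.

(** If [E] did not vanish, a suitable [k] would make the whole rectangle bad, hence a nested
    sequence of bad rectangles. They shrink to a point, where the local hypothesis [El] with
    constant [k] contradicts badness. *)
Lemma bisection_eq0 : E a b c d = 0.
Proof.
apply/eqP/negPn/negP => /modulus_gt0; set m0 := modulus _ => m0_gt0.
(* The summand 1 makes [k * S ^+ 2 < m0] strict and keeps the quotient meaningful for a degenerate
   rectangle. *)
pose S := (b - a) + (d - c); pose k := m0 / (S ^+ 2 + 1).
have S1 : 0 < S ^+ 2 + 1 by have := sqr_ge0 S; lra.
have k0 : 0 < k by rewrite divr_gt0.
have B : bad k a c 0.
  rewrite /bad expr0 !divr1 -/S ![_ + (_ - _)]addrC !subrK -/m0.
  by rewrite /k mulrAC ltr_pdivrMr // ltr_pM2l // ltrDl.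
pose sx := [set (corner k n).1 | n in setT]; pose sy := [set (corner k n).2 | n in setT].
have ubx n : ubound sx ((corner k n).1 + (b - a) / 2 ^+ n).
  by move=> _ [m _ <-]; have [] := corner_ub m n B.
have uby n : ubound sy ((corner k n).2 + (d - c) / 2 ^+ n).
  by move=> _ [m _ <-]; have [] := corner_ub m n B.
have hsx : has_sup sx by split; [exists (corner k 0).1; exists 0%N|eexists; exact: (ubx 0%N)].
have hsy : has_sup sy by split; [exists (corner k 0).2; exists 0%N|eexists; exact: (uby 0%N)].
have px n : (corner k n).1 <= sup sx <= (corner k n).1 + (b - a) / 2 ^+ n.
  apply/andP; split; first by apply: ub_le_sup; [case: hsx|exists n].
  by apply: ge_sup; [case: hsx|exact: ubx].
have py n : (corner k n).2 <= sup sy <= (corner k n).2 + (d - c) / 2 ^+ n.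
  apply/andP; split; first by apply: ub_le_sup; [case: hsy|exists n].
  by apply: ge_sup; [case: hsy|exact: uby].
have [I0 _] := cornerP 0 B.
have pxK : a <= sup sx <= b by have := px 0%N; rewrite /= expr0 divr1; lra.
have pyK : c <= sup sy <= d by have := py 0%N; rewrite /= expr0 divr1; lra.
have [r r0 H] := El pxK pyK k0.
have [n nP] : exists n, (b - a) / 2 ^+ n < r /\ (d - c) / 2 ^+ n < r.
  have [n Hn] : exists n : nat, S / r < 2 ^+ n.
    exists (Num.truncn (S / r)).+1; apply: lt_trans (truncnS_gt _) _.
    by rewrite -natrX ltr_nat ltn_expl.
  move: Hn; rewrite ltr_pdivrMr // => Hn; exists n.
  have p0 : 0 < 2 ^+ n :> R by rewrite exprn_gt0.
  by rewrite !ltr_pdivrMr // ![r * _]mulrC; rewrite /S in Hn; split; lra.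
have [[i1 i2 i3 i4]] := cornerP n B; rewrite /bad.
have := px n; have := py n; case: nP; set l := (b - a) / _ in i2 *; set h := (d - c) / _ in i4 *.
case: (corner k n) i1 i2 i3 i4 => x y /= i1 i2 i3 i4 lr hr /andP[y1 y2] /andP[x1 x2].
rewrite ltNge => /negP; apply.
have eS (u v : R) : u + v - u = v by rewrite addrAC subrr add0r.
have := H x (x + l) y (y + h); rewrite !eS; apply => //; first by rewrite i1.
- by rewrite x2.
- by rewrite i3.
- by rewrite y2.
Qed.

End bisection.

(** * Integrals of complex-valued functions over segments *)

Section complex_integral.
Variable R : realType.
Local Notation C := (R[i]^o)%type.
Local Notation leb := (@lebesgue_measure R).
Implicit Types (F G : R -> C) (a b c r t : R).

Definition cint a b F : C :=
  (\int[leb]_(t in `[a, b]) Re (F t)) +i* (\int[leb]_(t in `[a, b]) Im (F t)).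

Lemma Re_cont F : continuous F -> continuous (fun t => Re (F t)).
Proof. by move=> cF t; have /continuous_ReIm[] := cF t. Qed.

Lemma Im_cont F : continuous F -> continuous (fun t => Im (F t)).
Proof. by move=> cF t; have /continuous_ReIm[] := cF t. Qed.

Lemma continuous_integrable (f : R -> R) a b : continuous f ->
  leb.-integrable `[a, b] (EFin \o f).
Proof.
move=> cf; apply: continuous_compact_integrable; first exact: segment_compact.
exact: continuous_subspaceT.
Qed.

Lemma eq_cint a b F G : (forall t, a <= t <= b -> F t = G t) -> cint a b F = cint a b G.
Proof.
move=> FG; rewrite /cint; congr (_ +i* _); apply: eq_Rintegral => t;
  rewrite inE /= in_itv /= => /FG -> //.
Qed.

Lemma continuousD_C (T : topologicalType) (F G : T -> C) :
  continuous F -> continuous G -> continuous (fun x => F x + G x).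
Proof. by move=> cF cG x; apply: cvgD; [exact: cF|exact: cG]. Qed.

Lemma continuousM_C (T : topologicalType) (F G : T -> C) :
  continuous F -> continuous G -> continuous (fun x => F x * G x).
Proof. by move=> cF cG x; apply: cvgM; [exact: cF|exact: cG]. Qed.

Lemma continuousN_C (T : topologicalType) (F : T -> C) :
  continuous F -> continuous (fun x => - F x).
Proof. by move=> cF x; apply: cvgN; exact: cF. Qed.

Lemma continuousV_C (T : topologicalType) (F : T -> C) :
  (forall x, F x != 0) -> continuous F -> continuous (fun x => (F x)^-1).
Proof. by move=> F0 cF x; apply: cvgV => //; exact: cF. Qed.

Lemma cintD a b F G : continuous F -> continuous G ->
  cint a b (fun t => F t + G t) = cint a b F + cint a b G.
Proof.
move=> cF cG; rewrite /cint; simpc; rewrite -!RintegralD //;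
  try exact: continuous_integrable (Re_cont _);
  try exact: continuous_integrable (Im_cont _).
by congr (_ +i* _); apply: eq_Rintegral => t _; case: (F t) (G t) => [? ?] [].
Qed.

Lemma cintZ a b (k : C) F : continuous F -> cint a b (fun t => k * F t) = k * cint a b F.
Proof.
move=> cF; case: k => u v; rewrite /cint; simpc.
have iR := continuous_integrable a b (Re_cont cF).
have iI := continuous_integrable a b (Im_cont cF).
rewrite -!RintegralZl // -RintegralB // -?RintegralD //;
  try (by apply: continuous_integrable => t; apply: cvgM; [exact: cvg_cst|exact: Re_cont]);
  try (by apply: continuous_integrable => t; apply: cvgM; [exact: cvg_cst|exact: Im_cont]).
by congr (_ +i* _); apply: eq_Rintegral => t _; case: (F t).
Qed.

Lemma cintN a b F : continuous F -> cint a b (fun t => - F t) = - cint a b F.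
Proof.
by move=> cF; rewrite -mulN1r -cintZ //; apply: eq_cint => t _; rewrite mulN1r.
Qed.

Lemma cintB a b F G : continuous F -> continuous G ->
  cint a b (fun t => F t - G t) = cint a b F - cint a b G.
Proof. by move=> cF cG; rewrite (cintD a b cF (continuousN_C cG)) (cintN a b cG). Qed.

Lemma Rintegral_le_bound (f : R -> R) a b M : continuous f -> a <= b ->
  (forall t, a <= t <= b -> `|f t| <= M) -> `|\int[leb]_(t in `[a, b]) f t| <= M * (b - a).
Proof.
move=> cf ab fM; apply: le_trans (le_normr_Rintegral _ _) _ => //.
  exact: continuous_integrable.
apply: (@le_trans _ _ (\int[leb]_(t in `[a, b]) M)).
  apply: le_Rintegral.
  - by [].
  - by apply: continuous_integrable => t; apply: cvg_norm; exact: cf.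
  - by apply: continuous_integrable => t; exact: cvg_cst.
  - by move=> t /=; rewrite in_itv /=; exact: fM.
rewrite Rintegral_cst //= lebesgue_measure_itv /= lte_fin.
by move: ab; rewrite le_eqVlt => /predU1P[->|->]; rewrite ?ltxx ?subrr ?mulr0.
Qed.

(* The factor 2 comes from bounding real and imaginary parts separately. *)
Lemma modulus_cint a b F M : continuous F -> a <= b ->
  (forall t, a <= t <= b -> modulus (F t) <= M) -> modulus (cint a b F) <= 2 * M * (b - a).
Proof.
move=> cF ab FM; apply: le_trans (modulus_le_ReIm _) _; rewrite -mulrA mulr_natl mulr2n.
apply: lerD; apply: Rintegral_le_bound => //; try exact: Re_cont; try exact: Im_cont.
- by move=> t /FM; apply: le_trans; exact: Re_le_modulus.
- by move=> t /FM; apply: le_trans; exact: Im_le_modulus.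
Qed.

Lemma Rintegral_split (f : R -> R) a b c : continuous f -> a <= b -> b <= c ->
  \int[leb]_(t in `[a, c]) f t = \int[leb]_(t in `[a, b]) f t + \int[leb]_(t in `[b, c]) f t.
Proof.
move=> cf ab bc; have := @Rintegral_itvB _ f (BLeft a) (BRight c) b.
move=> /(_ (continuous_integrable _ _ cf)); rewrite !bnd_simp => /(_ ab bc) /eqP.
rewrite subr_eq addrC => /eqP ->; congr (_ + _).
rewrite Rintegral_itv_obnd_cbnd //.
by apply: integrableS (continuous_integrable b c cf) => //; exact: subset_itv_oc_cc.
Qed.

Lemma cint_split a b c F : continuous F -> a <= b -> b <= c ->
  cint a c F = cint a b F + cint b c F.
Proof.
move=> cF ab bc; rewrite /cint; simpc.
by rewrite -!Rintegral_split //; [exact: Im_cont|exact: Re_cont].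
Qed.

Lemma Rintegral_FTC (f g : R -> R) a b : a <= b -> continuous f ->
  (forall t, is_derive t 1 g (f t)) -> \int[leb]_(t in `[a, b]) f t = g b - g a.
Proof.
rewrite le_eqVlt => /predU1P[->|ab] cf dg; first by rewrite set_itv1 Rintegral_set1 subrr.
have dgc t : {for t, continuous g}.
  by apply: differentiable_continuous; apply/derivable1_diffP; case: (dg t).
rewrite /Rintegral (@continuous_FTC2 _ f g) //.
- exact: continuous_subspaceT.
- split; first by move=> t _; case: (dg t).
  + exact/cvg_at_right_filter/dgc.
  + exact/cvg_at_left_filter/dgc.
- by move=> t _; rewrite derive1E; case: (dg t).
Qed.

Definition is_cderive (f : R -> C) (t : R) (d : C) :=
  is_derive t 1 (fun t => Re (f t)) (Re d) /\ is_derive t 1 (fun t => Im (f t)) (Im d).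

Lemma cint_FTC a b F G : a <= b -> continuous F -> (forall t, is_cderive G t (F t)) ->
  cint a b F = G b - G a.
Proof.
move=> ab cF dG; rewrite /cint.
rewrite (Rintegral_FTC ab (Re_cont cF) (fun t => (dG t).1)).
rewrite (Rintegral_FTC ab (Im_cont cF) (fun t => (dG t).2)).
by case: (G b) (G a) => [? ?] [].
Qed.

End complex_integral.

(** * Complex derivatives and Cauchy theory in one variable *)

Section complex_derivative.
Variable R : realType.
Local Notation C := (R[i]^o)%type.
Implicit Types (G H : C -> C) (z w d : C).

(* Stated with the real-valued modulus, so that unification never has to
   compare the canonical structures of R[i] and R[i]^o. *)
Definition clim (T : Type) (F : set_system T) (f : T -> C) (l : C) : Prop :=
  forall e : R, 0 < e -> \forall x \near F, modulus (f x - l) < e.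

Section limits.
Context {T : Type} {F : set_system T} {FF : Filter F}.
Implicit Types (f g : T -> C) (a b : C).

Lemma climP f a : clim F f a <-> f @ F --> a.
Proof. by split=> [/ccvgP|/ccvgP]. Qed.

Lemma clim_cst a : clim F (fun=> a) a.
Proof. by apply/climP; exact: cvg_cst. Qed.

Lemma climD f g a b : clim F f a -> clim F g b -> clim F (fun x => f x + g x) (a + b).
Proof. by move=> /climP h /climP k; apply/climP; exact: (cvgD h k). Qed.

Lemma climM f g a b : clim F f a -> clim F g b -> clim F (fun x => f x * g x) (a * b).
Proof. by move=> /climP h /climP k; apply/climP; exact: (cvgM h k). Qed.

Lemma climN f a : clim F f a -> clim F (fun x => - f x) (- a).
Proof. by move=> /climP h; apply/climP; exact: (cvgN h). Qed.

Lemma climB f g a b : clim F f a -> clim F g b -> clim F (fun x => f x - g x) (a - b).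
Proof. by move=> h k; exact: climD (climN k). Qed.

Lemma climV f a : a != 0 -> clim F f a -> clim F (fun x => (f x)^-1) a^-1.
Proof. by move=> a0 /climP h; apply/climP; exact: (cvgV a0 h). Qed.

End limits.

Definition slope G z d w : C := if w == z then d else (G w - G z) / (w - z).

(* A sealed name for [nbhs z], on which filter instances are found. *)
Definition at_ z : set_system C := nbhs z.

#[global] Instance at_filter z : ProperFilter (at_ z).
Proof. exact: nbhs_pfilter. Qed.

Lemma at_P z (P : C -> Prop) :
  at_ z P <-> exists2 e : R, 0 < e & forall w, modulus (w - z) < e -> P w.
Proof. exact: nbhs_discP. Qed.

(** Caratheodory's form of differentiability: the difference quotient, completed by [d] at [z], is
    continuous there. The rules of calculus become algebraic identities between slopes. *)
Definition has_cderiv G z d := clim (at_ z) (slope G z d) d.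

Lemma clim_id z : clim (at_ z) id z.
Proof. by move=> e e0; apply/at_P; exists e. Qed.

Lemma slopeE G z d w : G w - G z = slope G z d w * (w - z).
Proof.
by rewrite /slope; case: eqP => [->|/eqP wz]; rewrite ?subrr ?mulr0 // divfK // subr_eq0.
Qed.

(** For [w] different from [z] the factor [phi] is the difference quotient itself. To differentiate,
    it then suffices to exhibit a factorisation whose limit is known. *)
Lemma has_cderiv_intro G z d (phi : C -> C) : clim (at_ z) phi d ->
  (\forall w \near at_ z, G w - G z = phi w * (w - z)) -> has_cderiv G z d.
Proof.
move=> cp GE e e0; near=> w; rewrite /slope; case: eqP => [_|/eqP wz].
  by rewrite subrr Normc.normc0.
rewrite (_ : _ / _ = phi w); first by near: w; exact: cp.
apply: (mulIf (x := w - z)); first by rewrite subr_eq0.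
by rewrite divfK ?subr_eq0 //; near: w.
Unshelve. all: by end_near. Qed.

Lemma has_cderiv_eps G z d : has_cderiv G z d -> forall e : R, 0 < e ->
  exists2 r : R, 0 < r & forall w, modulus (w - z) < r ->
    modulus (G w - G z - d * (w - z)) <= e * modulus (w - z).
Proof.
move=> h e e0; have /at_P[r r0 H] := h _ e0; exists r => // w /H we.
by rewrite (slopeE G z d) -mulrBl modulusM ler_wpM2r ?modulus_ge0 // ltW.
Qed.

Lemma has_cderiv_continuous G z d : has_cderiv G z d -> clim (at_ z) G (G z).
Proof.
move=> h; have -> : G = fun w => G z + slope G z d w * (w - z).
  by apply/funext => w; rewrite -slopeE addrC subrK.
rewrite [X in clim _ _ X](_ : _ = G z + d * (z - z)); last first.
  by rewrite subrr !mulr0 addr0.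
apply: climD; first exact: clim_cst.
apply: climM => //; apply: climB; [exact: clim_id|exact: clim_cst].
Qed.

Lemma has_cderiv_cst (k : C) z : has_cderiv (fun=> k) z 0.
Proof.
apply: (has_cderiv_intro (phi := fun=> 0)); first exact: clim_cst.
by near=> w; rewrite subrr mul0r.
Unshelve. all: by end_near. Qed.

Lemma has_cderiv_id z : has_cderiv id z 1.
Proof.
apply: (has_cderiv_intro (phi := fun=> 1)); first exact: clim_cst.
by near=> w; rewrite mul1r.
Unshelve. all: by end_near. Qed.

Lemma has_cderivD G H z d d' : has_cderiv G z d -> has_cderiv H z d' ->
  has_cderiv (fun w => G w + H w) z (d + d').
Proof.
move=> hG hH; apply: (has_cderiv_intro (phi := fun w => slope G z d w + slope H z d' w)).
  exact: climD.
by near=> w; rewrite mulrDl -!slopeE; ring.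
Unshelve. all: by end_near. Qed.

Lemma has_cderivM G H z d d' : has_cderiv G z d -> has_cderiv H z d' ->
  has_cderiv (fun w => G w * H w) z (d * H z + G z * d').
Proof.
move=> hG hH.
apply: (has_cderiv_intro (phi := fun w => slope G z d w * H w + G z * slope H z d' w)).
  apply: climD; apply: climM => //; [exact: has_cderiv_continuous hH|exact: clim_cst].
near=> w; transitivity (slope G z d w * (w - z) * H w + G z * (slope H z d' w * (w - z))).
  by rewrite -!slopeE; ring.
by ring.
Unshelve. all: by end_near. Qed.

Lemma has_cderivN G z d : has_cderiv G z d -> has_cderiv (fun w => - G w) z (- d).
Proof.
move=> hG; apply: (has_cderiv_intro (phi := fun w => - slope G z d w)); first exact: climN.
by near=> w; rewrite mulNr -slopeE; ring.
Unshelve. all: by end_near. Qed.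

Lemma has_cderivB G H z d d' : has_cderiv G z d -> has_cderiv H z d' ->
  has_cderiv (fun w => G w - H w) z (d - d').
Proof. by move=> hG hH; exact: has_cderivD (has_cderivN hH). Qed.

Lemma has_cderivV G z d : G z != 0 -> has_cderiv G z d ->
  has_cderiv (fun w => (G w)^-1) z (- d / G z ^+ 2).
Proof.
move=> Gz hG; have cG := has_cderiv_continuous hG.
have G0 : \forall w \near at_ z, G w != 0.
  have := cG _ (modulus_gt0 Gz); apply: filterS => w h.
  by apply/eqP => Gw; move: h; rewrite Gw sub0r modulusN ltxx.
apply: (has_cderiv_intro (phi := fun w => - slope G z d w * ((G w)^-1 * (G z)^-1))).
  rewrite expr2 invfM; apply: climM; first exact: climN.
  by apply: climM; [exact: climV|exact: clim_cst].
near=> w; have Gw : G w != 0 by near: w.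
by rewrite mulrAC mulNr -slopeE; field; rewrite Gw Gz.
Unshelve. all: by end_near. Qed.

Lemma has_cderiv_scale G (a z d : C) : has_cderiv G (a * z) d ->
  has_cderiv (fun w => G (a * w)) z (a * d).
Proof.
move=> hG; apply: (has_cderiv_intro (phi := fun w => a * slope G (a * z) d (a * w))); last first.
  by near=> w; rewrite (slopeE G (a * z) d) -mulrBr; ring.
apply: climM; first exact: clim_cst.
move=> e /hG /at_P[r r0 H]; apply/at_P.
exists (r / (modulus a + 1)); first by rewrite divr_gt0 // ltr_wpDl // modulus_ge0.
have a1 : 0 < modulus a + 1 by rewrite ltr_wpDl // modulus_ge0.
move=> w; rewrite ltr_pdivlMr // => wr; apply: H; rewrite -mulrBr modulusM.
apply: le_lt_trans wr; rewrite mulrC ler_wpM2l ?modulus_ge0 //; lra.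
Unshelve. all: by end_near. Qed.

Lemma has_cderiv_uniq G z d d' : has_cderiv G z d -> has_cderiv G z d' -> d = d'.
Proof.
move=> h h'; apply/eqP; rewrite -subr_eq0; apply/eqP/modulus_le0; apply/ler_addgt0Pl => e e0.
rewrite addr0; have e2 : 0 < e / 2 by rewrite divr_gt0.
have [r r0 H] := has_cderiv_eps h e2; have [r' r'0 H'] := has_cderiv_eps h' e2.
pose s := Num.min r r' / 2; have s0 : 0 < s by rewrite divr_gt0 // lt_min r0.
have wz : z + s%:C - z = s%:C by rewrite addrAC subrr add0r.
have := H (z + s%:C); have := H' (z + s%:C); rewrite wz modulusC gtr0_norm //.
have sm : s < Num.min r r' by rewrite /s; have m0 : 0 < Num.min r r' by [rewrite lt_min r0]; lra.
move: sm; rewrite lt_min => /andP[sr sr'] /(_ sr') h1 /(_ sr) h2.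
have : modulus ((d - d') * s%:C) <= e * s.
  rewrite (_ : _ * _ = (G (z + s%:C) - G z - d' * s%:C) - (G (z + s%:C) - G z - d * s%:C)); last by ring.
  by apply: le_trans (modulusD _ _) _; rewrite modulusN [e]splitr mulrDl lerD.
by rewrite modulusM modulusC gtr0_norm // ler_pM2r.
Qed.

End complex_derivative.

(** * Means over the circle and their dependence on parameters *)

Section circle_mean.
Variable R : realType.
Local Notation C := (R[i]^o)%type.
Local Notation leb := (@lebesgue_measure R).
Implicit Types (F G : R -> C) (r s t M : R).

Definition avg F : C := ((2 * pi)^-1)%:C * cint 0 (2 * pi) F.

Lemma twopi_gt0 : 0 < 2 * pi :> R.
Proof. by rewrite mulr_gt0 // pi_gt0. Qed.

Lemma avgD F G : continuous F -> continuous G -> avg (fun t => F t + G t) = avg F + avg G.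
Proof. by move=> cF cG; rewrite /avg cintD // mulrDr. Qed.

Lemma avgB F G : continuous F -> continuous G -> avg (fun t => F t - G t) = avg F - avg G.
Proof. by move=> cF cG; rewrite /avg cintB // mulrBr. Qed.

Lemma avgZ (k : C) F : continuous F -> avg (fun t => k * F t) = k * avg F.
Proof. by move=> cF; rewrite /avg cintZ // mulrCA. Qed.

Lemma eq_avg F G : F =1 G -> avg F = avg G.
Proof. by move=> /funext ->. Qed.

Lemma cint_cst (a b : R) (k : C) : a <= b -> cint a b (fun=> k) = (b - a)%:C * k.
Proof.
move=> ab; rewrite /cint !Rintegral_cst //= lebesgue_measure_itv /= lte_fin.
have -> : fine (if a < b then (b%:E + (- a)%:E)%E else 0) = b - a.
  by move: ab; rewrite le_eqVlt => /predU1P[->|->]; rewrite ?ltxx ?subrr.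
by case: k => u v; simpc; rewrite ![_ * (b - a)]mulrC.
Qed.

Lemma avg_cst (k : C) : avg (fun=> k) = k.
Proof.
rewrite /avg cint_cst ?(ltW twopi_gt0) // subr0 mulrA -rmorphM /= mulVf ?gt_eqF ?twopi_gt0 //.
by rewrite mul1r.
Qed.

Lemma modulus_avg F M : continuous F -> (forall t, modulus (F t) <= M) -> modulus (avg F) <= 2 * M.
Proof.
move=> cF FM; rewrite /avg modulusM modulusC ger0_norm ?invr_ge0 ?(ltW twopi_gt0) //.
have := modulus_cint cF (ltW twopi_gt0) (fun t _ => FM t); rewrite subr0.
by rewrite ler_pdivrMl ?twopi_gt0 // [leRHS]mulrC.
Qed.

(** Dominated convergence: near [x0] the integrand is bounded by a constant, by compactness of
    [[x0 - 1, x0 + 1]] times [[a, b]]. *)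
Lemma continuous_param_Rintegral (h : R * R -> R) (a b : R) : continuous h ->
  continuous (fun x => \int[leb]_(t in `[a, b]) h (x, t)).
Proof.
move=> ch x0.
have [M hM] : exists M, forall x t, x0 - 1 <= x <= x0 + 1 -> a <= t <= b -> `|h (x, t)| <= M.
  have cK : compact (h @` (`[x0 - 1, x0 + 1]%classic `*` `[a, b]%classic)).
    apply: continuous_compact; first exact: continuous_subspaceT.
    by apply: compact_setX; exact: segment_compact.
  have [M [_ /(_ (M + 1))]] := compact_bounded cK; rewrite ltrDl ltr01 => /(_ isT) hM.
  exists (M + 1) => x t hx ht; apply: hM; exists (x, t) => //; split; rewrite /= in_itv //.
have sx x : continuous (fun t => h (x, t)).
  move=> t; apply: (cvg_comp (fun t => (x, t)) h) (ch (x, t)).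
   exact: (cvg_pair (cvg_cst x) cvg_id).
have := @continuity_under_integral R _ _ leb (fun x t => h (x, t)) `[a, b]%classic _ (x0 - 1) (x0 + 1).
move=> /(_ (measurable_itv _) _ _ (fun=> M)); apply.
- by move=> x _; exact: continuous_integrable.
- apply: aeW => t _ x _.
  apply: (cvg_comp (fun x => (x, t)) h) (ch (x, t)); exact: (cvg_pair cvg_id (cvg_cst t)).
- by apply: continuous_integrable => t; exact: cvg_cst.
- move=> x; rewrite /= in_itv /= => /andP[x1 x2]; apply: aeW => t; rewrite /= in_itv /= => ht.
  by apply: hM => //; rewrite !ltW.
- by rewrite inE /= in_itv /=; lra.
Qed.

Lemma continuous_param_avg (H : R * R -> C) : continuous H ->
  continuous (fun x => avg (fun t => H (x, t))).
Proof.
move=> cH; apply: continuousM_C; first by move=> x; exact: cvg_cst.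
move=> x; apply/continuous_ReIm; split.
  apply: (@continuous_param_Rintegral (fun p => Re (H p))) => p; by have /continuous_ReIm[] := cH p.
apply: (@continuous_param_Rintegral (fun p => Im (H p))) => p; by have /continuous_ReIm[] := cH p.
Qed.

End circle_mean.

(** * Cauchy's theorem on an annulus, by Goursat's method in polar coordinates *)

Section goursat.
Variable R : realType.
Local Notation C := (R[i]^o)%type.
Local Notation "'ii'" := (0 +i* 1 : C).
Implicit Types (z w d : C) (r s t : R).

Lemma continuous_comp_clim (T : topologicalType) (f : T -> C) (G : C -> C) :
  continuous f -> (forall x, clim (at_ (f x)) G (G (f x))) -> continuous (fun x => G (f x)).
Proof.
move=> cf cG x; apply/ccvgP => e e0; have /at_P[r r0 H] := cG x _ e0.
by have /ccvgP/(_ _ r0) := cf x; apply: filterS => y /H.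
Qed.

Lemma cont_comp (T U V : topologicalType) (f : T -> U) (g : U -> V) :
  continuous f -> continuous g -> continuous (fun x => g (f x)).
Proof. by move=> cf cg x; exact: (continuous_comp (cf x) (cg (f x))). Qed.

Lemma cont_cst (T : topologicalType) (k : C) : continuous (fun _ : T => k).
Proof. by move=> x; exact: cvg_cst. Qed.

Lemma cont_sec1 (T : topologicalType) (f : R * R -> T) t :
  continuous f -> continuous (fun r => f (r, t)).
Proof.
move=> cf; apply: (@cont_comp _ _ _ (fun r => (r, t)) f) => // r.
exact: (cvg_pair cvg_id (cvg_cst t)).
Qed.

Lemma cont_sec2 (T : topologicalType) (f : R * R -> T) r :
  continuous f -> continuous (fun t => f (r, t)).
Proof.
move=> cf; apply: (@cont_comp _ _ _ (fun t => (r, t)) f) => // t.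
exact: (cvg_pair (cvg_cst r) cvg_id).
Qed.

Lemma is_cderive_expi (k t : R) :
  is_cderive (fun t => expi (k * t)) t (ii * k%:C * expi (k * t) : C).
Proof.
have dk : is_derive t 1 (fun t => k * t) k by apply: is_derive_eq; rewrite /GRing.scale /=; ring.
split.
  rewrite (_ : Re _ = - (k * sin (k * t))); last by rewrite /expi; simpc; rewrite /=; ring.
  by apply: (is_derive_eq (is_derive1_comp (is_derive_cos _) dk)); ring.
rewrite (_ : Im _ = k * cos (k * t)); last by rewrite /expi; simpc; rewrite /=; ring.
by apply: (is_derive_eq (is_derive1_comp (is_derive_sin _) dk)); ring.
Qed.

Lemma continuous_expiM k : continuous (fun t => expi (k * t) : C).
Proof.
apply: (@cont_comp _ _ _ (fun t => k * t) (@expi R)); last exact: continuous_expi.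
by move=> t; apply: cvgM; [exact: cvg_cst|exact: cvg_id].
Qed.

Lemma cint_expi (k a b : R) : a <= b ->
  cint a b (fun t => ii * k%:C * expi (k * t)) = expi (k * b) - expi (k * a) :> C.
Proof.
move=> ab; apply: (cint_FTC (G := fun t => expi (k * t))) => // [|t].
  by apply: continuousM_C; [exact: cont_cst|exact: continuous_expiM].
exact: is_cderive_expi.
Qed.

Lemma cint_id (a b : R) : a <= b -> cint a b (fun t => t%:C) = ((b ^+ 2 - a ^+ 2) / 2)%:C :> C.
Proof.
move=> ab; rewrite (cint_FTC (G := fun t => (t ^+ 2 / 2)%:C)) //.
- by rewrite -rmorphB /= -mulrBl.
- exact: continuous_realC.
- move=> t; split => /=; first by apply: is_derive_eq; rewrite /GRing.scale /=; field.
  exact: is_derive_cst.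
Qed.

Lemma modulus_expiB s t : modulus (expi s - expi t) <= 2 * `|s - t|.
Proof.
wlog st : s t / t <= s.
  move=> h; have [/h//|/ltW/h] := leP t s.
  by rewrite modulusB distrC.
have := cint_expi 1 st; rewrite !mul1r => <-; rewrite ger0_norm ?subr_ge0 //.
have := @modulus_cint R t s (fun u => ii * 1%:C * expi (1 * u)) 1.
rewrite mulr1; apply => // [|u _].
  by apply: continuousM_C; [exact: cont_cst|exact: continuous_expiM].
by rewrite !modulusM modulus_expi mulr1 modulusC normr1 mulr1 /= expr0n expr1n add0r sqrtr1.
Qed.

Variables (G : C -> C) (r1 r2 : R).
Hypotheses (r1_ge0 : 0 <= r1) (r12 : r1 <= r2).
Hypothesis hG : forall z, r1 <= modulus z <= r2 -> exists d, has_cderiv G z d.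

(** Clamping the radius to [[r1, r2]] makes [G] of the polar point continuous on the whole plane of
    parameters, as the integration lemmas require, without changing it on the annulus. *)
Let cl r := Num.max r1 (Num.min r r2).

Let cl_itv r : r1 <= cl r <= r2.
Proof. by rewrite /cl le_max lexx /= ge_max r12 /= ge_min lexx orbT. Qed.

Let clE r : r1 <= r <= r2 -> cl r = r.
Proof. by move=> /andP[h1 h2]; rewrite /cl (min_idPl h2) (max_idPr h1). Qed.

Let continuous_cl : continuous cl.
Proof.
move=> r; apply: (@continuous_max _ _ (cst r1) (fun r => Num.min r r2)); first exact: cvg_cst.
by apply: (@continuous_min _ _ id (cst r2)); [exact: cvg_id|exact: cvg_cst].
Qed.

Let zz (p : R * R) : C := (cl p.1)%:C * expi p.2.

Let modulus_zz p : modulus (zz p) = cl p.1.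
Proof.
rewrite modulus_rexpi ger0_norm //; have /andP[h _] := cl_itv p.1; exact: le_trans h.
Qed.

Let continuous_zz : continuous zz.
Proof.
apply: continuousM_C.
  apply: (@cont_comp _ _ _ (fun p : R * R => cl p.1) (fun r => r%:C : C)); last exact: continuous_realC.
  by apply: (@cont_comp _ _ _ (fst : R * R -> R) cl) => // p; exact: cvg_fst.
apply: (@cont_comp _ _ _ (snd : R * R -> R) (@expi R)); last exact: continuous_expi.
by move=> p; exact: cvg_snd.
Qed.

Let continuous_G : continuous (fun p => G (zz p)).
Proof.
apply: continuous_comp_clim => // p.
have [|d] := @hG (zz p); first by rewrite modulus_zz.
by move/has_cderiv_continuous.
Qed.

(** Since dz = e^(it) dr + i r e^(it) dt, [P] and [Q] are the coefficients of G dz along a ray and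
    along a circle. *)
Let P t r := G (zz (r, t)) * expi t.
Let Q r t := ii * (G (zz (r, t)) * zz (r, t)).

Let continuous_P t : continuous (P t).
Proof. by apply: continuousM_C; [exact: cont_sec1 continuous_G|exact: cont_cst]. Qed.

Let continuous_Q r : continuous (Q r).
Proof.
apply: continuousM_C; first exact: cont_cst.
by apply: continuousM_C; [exact: cont_sec2 continuous_G|exact: cont_sec2 continuous_zz].
Qed.

(** The integral of G dz around the polar rectangle with radii in [[x0, x1]] and angles in
    [[y0, y1]]. *)
Let E x0 x1 y0 y1 : C :=
  cint x0 x1 (P y0) + cint y0 y1 (Q x1) - cint x0 x1 (P y1) - cint y0 y1 (Q x0).

Let E_split1 x0 x1 x2 y0 y1 : x0 <= x1 -> x1 <= x2 -> E x0 x2 y0 y1 = E x0 x1 y0 y1 + E x1 x2 y0 y1.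
Proof.
have H (p p' q q' u u' v : C) :
  p + p' + q - (u + u') - v = p + q' - u - v + (p' + q - u' - q') by ring.
by move=> h1 h2; rewrite /E !(cint_split (@continuous_P _) h1 h2); exact: H.
Qed.

Let E_split2 x0 x1 y0 y1 y2 : y0 <= y1 -> y1 <= y2 -> E x0 x1 y0 y2 = E x0 x1 y0 y1 + E x0 x1 y1 y2.
Proof.
have H (p p' q q' u v v' : C) :
  p + (q + q') - u - (v + v') = p + q - p' - v + (p' + q' - u - v') by ring.
by move=> h1 h2; rewrite /E !(cint_split (@continuous_Q _) h1 h2); exact: H.
Qed.

(** The contour integral of an affine function vanishes because it has a primitive; here the four
    sides are computed explicitly and cancel. *)
Let affine (a d : C) x0 x1 y0 y1 : x0 <= x1 -> y0 <= y1 ->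
  let P' t r := (a + d * (r%:C * expi t)) * expi t in
  let Q' r t := ii * ((a + d * (r%:C * expi t)) * (r%:C * expi t)) in
  cint x0 x1 (P' y0) + cint y0 y1 (Q' x1) - cint x0 x1 (P' y1) - cint y0 y1 (Q' x0) = 0.
Proof.
move=> x01 y01 P' Q'.
have cst (k : C) : continuous (fun _ : R => k) by exact: cont_cst.
have expi2 t : expi (2 * t) = expi t * expi t by rewrite -expiD mulrDl mul1r.
have PE t : cint x0 x1 (P' t) =
    (x1 - x0)%:C * (a * expi t) + d * expi t * expi t * ((x1 ^+ 2 - x0 ^+ 2) / 2)%:C.
  rewrite -cint_id // -cint_cst // -cintZ; last exact: continuous_realC.
  rewrite -cintD; [|exact: cst|by apply: continuousM_C; [exact: cst|exact: continuous_realC]].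
  by apply: eq_cint => r _; rewrite /P'; ring.
have QE r : cint y0 y1 (Q' r) = a * r%:C * (expi y1 - expi y0) +
    d * (r ^+ 2 / 2)%:C * (expi y1 * expi y1 - expi y0 * expi y0).
  rewrite -!expi2 -cint_expi // -(mul1r y1) -(mul1r y0) -cint_expi // !mul1r.
  have c1 k l : continuous (fun t => ii * k%:C * expi (l * t)).
    by apply: continuousM_C; [exact: cst|exact: continuous_expiM].
  rewrite -!cintZ //; rewrite -cintD; try by apply: continuousM_C.
  by apply: eq_cint => t _; rewrite /Q' mul1r expi2 rmorphM rmorphXn /= fmorphV !rmorph_nat; field.
by rewrite !PE !QE !rmorphM !rmorphB !rmorphXn /= fmorphV !rmorph_nat; field.
Qed.


(** Subtracting the affine approximation of [G] at the point (p, q) leaves [E] unchanged, by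
    [affine]. The remainder is small compared with the diameter, and the sides have length of the
    order of the diameter, so [E] is small compared with its square. *)
Let E_local p q : r1 <= p <= r2 -> 0 <= q <= 2 * pi -> forall e, 0 < e ->
  exists2 r, 0 < r & forall x0 x1 y0 y1, r1 <= x0 <= p -> p <= x1 <= r2 ->
    0 <= y0 <= q -> q <= y1 <= 2 * pi -> x1 - x0 < r -> y1 - y0 < r ->
    modulus (E x0 x1 y0 y1) <= e * ((x1 - x0) + (y1 - y0)) ^+ 2.
Proof.
move=> hp hq e e0.
(* [L] bounds the displacement of the polar point by the half-perimeter [S]. [N] collects two rays
   and two arcs, each with the factor 2 of [modulus_cint], and one factor [L]. *)
pose L := 1 + 2 * r2; pose N := 4 * (1 + r2) * L.
have r2_ge0 : 0 <= r2 by exact: le_trans r12.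
have L0 : 0 < L by rewrite /L; lra.
have N0 : 0 < N by rewrite !mulr_gt0 //; lra.
have [|d hd] := @hG (zz (p, q)); first by rewrite modulus_zz clE.
have eN : 0 < e / N by rewrite divr_gt0.
have [r r0 H] := has_cderiv_eps hd eN.
exists (r / (2 * L)); first by rewrite divr_gt0 // mulr_gt0.
move=> x0 x1 y0 y1 /andP[rx0 x0p] /andP[px1 x1r] /andP[y0' y0q] /andP[qy1 y1'] hx hy.
set S := (x1 - x0) + (y1 - y0).
have x01 : x0 <= x1 by exact: le_trans px1.
have y01 : y0 <= y1 by exact: le_trans qy1.
have SL : L * S < r.
  have : S < r / (2 * L) + r / (2 * L) by rewrite /S ltrD.
  have -> : r / (2 * L) + r / (2 * L) = r / L by field; rewrite gt_eqF.
  by rewrite ltr_pdivlMr // mulrC.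
have dist x y : x0 <= x <= x1 -> y0 <= y <= y1 -> modulus (zz (x, y) - zz (p, q)) <= L * S.
  move=> /andP[h1 h2] /andP[h3 h4].
  have -> : zz (x, y) - zz (p, q) = (x - p)%:C * expi y + p%:C * (expi y - expi q).
    rewrite /zz /= !clE //; last by rewrite (le_trans rx0) //= (le_trans h2).
    by rewrite rmorphB /=; ring.
  apply: le_trans (modulusD _ _) _; rewrite modulus_rexpi modulusM modulusC.
  have a1 : `|x - p| <= x1 - x0 by rewrite ler_norml; apply/andP; split; lra.
  have a2 : modulus (expi y - expi q) <= 2 * (y1 - y0).
    apply: le_trans (modulus_expiB _ _) _; rewrite ler_wpM2l // ler_norml; apply/andP; split; lra.
  have /andP[p1 p2] := hp; have p0 : 0 <= p by exact: le_trans p1.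
  rewrite (ger0_norm p0).
  have : p * modulus (expi y - expi q) <= r2 * (2 * (y1 - y0)) by rewrite ler_pM // modulus_ge0.
  rewrite /L /S mulrDl mul1r; have : 0 <= 2 * r2 * (x1 - x0) by rewrite !mulr_ge0 // subr_ge0.
  by nra.
pose a := G (zz (p, q)) - d * zz (p, q).
have etaG x y : x0 <= x <= x1 -> y0 <= y <= y1 ->
    modulus (G (zz (x, y)) - (a + d * zz (x, y))) <= e / N * (L * S).
  move=> h1 h2; have -> : G (zz (x, y)) - (a + d * zz (x, y)) =
      G (zz (x, y)) - G (zz (p, q)) - d * (zz (x, y) - zz (p, q)) by rewrite /a; ring.
  have D := dist _ _ h1 h2; apply: le_trans (H _ (le_lt_trans D SL)) _.
  by rewrite ler_wpM2l // ltW.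
pose P' t r := (a + d * (r%:C * expi t)) * expi t.
pose Q' r t := ii * ((a + d * (r%:C * expi t)) * (r%:C * expi t)).
have cP' t : continuous (P' t).
  apply: continuousM_C; last exact: cont_cst.
  apply: continuousD_C; first exact: cont_cst.
  apply: continuousM_C; first exact: cont_cst.
  by apply: continuousM_C; [exact: continuous_realC|exact: cont_cst].
have cQ' x : continuous (Q' x).
  apply: continuousM_C; first exact: cont_cst.
  have cr : continuous (fun t => x%:C * expi t : C).
    by apply: continuousM_C; [exact: cont_cst|exact: continuous_expi].
  apply: continuousM_C; last exact: cr.
  apply: continuousD_C; first exact: cont_cst.
  by apply: continuousM_C; [exact: cont_cst|exact: cr].
have -> : E x0 x1 y0 y1 = (cint x0 x1 (fun r => P y0 r - P' y0 r) +
    cint y0 y1 (fun t => Q x1 t - Q' x1 t)) - (cint x0 x1 (fun r => P y1 r - P' y1 r) +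
    cint y0 y1 (fun t => Q x0 t - Q' x0 t)).
  rewrite !cintB //; have := affine a d x01 y01; rewrite -/(P' y0) -/(P' y1) -/(Q' x0) -/(Q' x1) /E.
  set A0 := cint _ _ (P' y0); set A1 := cint _ _ (P' y1).
  set B0 := cint _ _ (Q' x0); set B1 := cint _ _ (Q' x1).
  move: (cint x0 x1 (P y0)) (cint x0 x1 (P y1)) (cint y0 y1 (Q x0)) (cint y0 y1 (Q x1)) => u v w z h.
  rewrite -[LHS]subr0 -h; clear; ring.
have K0 : 0 <= e / N * (L * S).
  by rewrite mulr_ge0 ?(ltW eN) // mulr_ge0 ?(ltW L0) // addr_ge0 // subr_ge0.
have bP y : y0 <= y <= y1 -> modulus (cint x0 x1 (fun r => P y r - P' y r)) <=
    2 * (e / N * (L * S)) * (x1 - x0).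
  move=> hy0; apply: modulus_cint => // [|x hx0].
    by apply: continuousD_C; [exact: continuous_P|exact: continuousN_C].
  have cx : cl x = x by apply: clE; case/andP: hx0 => h1 h2; rewrite (le_trans rx0) //= (le_trans h2).
  rewrite /P /P' -mulrBl modulusM modulus_expi mulr1.
  by have := etaG x y hx0 hy0; rewrite {2}/zz /= cx.
have bQ x : x0 <= x <= x1 -> modulus (cint y0 y1 (fun t => Q x t - Q' x t)) <=
    2 * (e / N * (L * S) * r2) * (y1 - y0).
  move=> hx0; apply: modulus_cint => // [|y hy0].
    by apply: continuousD_C; [exact: continuous_Q|exact: continuousN_C].
  have /andP[h1 h2] := hx0.
  have cx : cl x = x by apply: clE; rewrite (le_trans rx0) //= (le_trans h2).
  rewrite /Q /Q' -mulrBr modulusM.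
  have -> : zz (x, y) = x%:C * expi y by rewrite /zz /= cx.
  rewrite -mulrBl modulusM modulus_rexpi (_ : modulus ii = 1); last first.
    by rewrite /= expr0n expr1n add0r sqrtr1.
  rewrite mul1r; apply: ler_pM; rewrite ?modulus_ge0 //.
    by have := etaG x y hx0 hy0; rewrite /zz /= cx.
  by rewrite ger0_norm ?(le_trans h2) // (le_trans _ h1) // (le_trans _ rx0).
apply: le_trans (modulusD _ _) _; rewrite modulusN.
apply: le_trans (lerD (modulusD _ _) (modulusD _ _)) _.
have hy00 : y0 <= y0 <= y1 by rewrite lexx.
have hy11 : y0 <= y1 <= y1 by rewrite lexx andbT.
have hx00 : x0 <= x0 <= x1 by rewrite lexx.
have hx11 : x0 <= x1 <= x1 by rewrite lexx andbT.
apply: le_trans (lerD (lerD (bP _ hy00) (bQ _ hx11)) (lerD (bP _ hy11) (bQ _ hx00))) _.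
set K := e / N * (L * S) in K0 *.
have -> : e * S ^+ 2 = 4 * (1 + r2) * K * S.
  rewrite /K; have Nn : N != 0 by rewrite gt_eqF.
  have -> : 4 * (1 + r2) * (e / N * (L * S)) * S = e / N * N * S ^+ 2 by rewrite /N; ring.
  by rewrite divfK.
have k1 : 0 <= K * (x1 - x0) by rewrite mulr_ge0 // subr_ge0.
have k2 : 0 <= K * (y1 - y0) by rewrite mulr_ge0 // subr_ge0.
have k3 : 0 <= r2 * (K * (x1 - x0)) by rewrite mulr_ge0.
by rewrite /S; nra.
Qed.

(** On the full rectangle of angles from 0 to 2 pi the two rays coincide by periodicity and cancel,
    which leaves the difference of the two circles. *)
Theorem cauchy_annulus :
  avg (fun t => G (r1%:C * expi t) * (r1%:C * expi t)) =
  avg (fun t => G (r2%:C * expi t) * (r2%:C * expi t)).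
Proof.
have tp := ltW (twopi_gt0 R).
have : E r1 r2 0 (2 * pi) = 0.
  by apply: bisection_eq0 => // *; [exact: E_split1|exact: E_split2].
have PP : P (2 * pi) = P 0.
  by apply/funext => r; rewrite /P /zz /= -(add0r (2 * pi)) expi_2pi.
have QE r : r1 <= r <= r2 -> Q r = fun t => ii * (G (r%:C * expi t) * (r%:C * expi t)).
  by move=> hr; apply/funext => t; rewrite /Q /zz /= clE.
rewrite /E PP.
have -> (u v w : C) : u + v - u - w = v - w by ring.
move/eqP; rewrite subr_eq0 => /eqP QQ.
have aQ r : r1 <= r <= r2 ->
    ii * avg (fun t => G (r%:C * expi t) * (r%:C * expi t)) = ((2 * pi)^-1)%:C * cint 0 (2 * pi) (Q r).
  move=> hr; rewrite -avgZ; first by rewrite /avg (QE _ hr).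
  have -> : (fun t => G (r%:C * expi t) * (r%:C * expi t)) = fun t => G (zz (r, t)) * zz (r, t).
    by apply/funext => t; rewrite /zz /= clE.
  by apply: continuousM_C; [exact: cont_sec2 continuous_G|exact: cont_sec2 continuous_zz].
apply: (mulfI (x := ii)); first by rewrite eq_complex /= oner_eq0 andbF.
by rewrite !aQ ?QQ ?lexx ?r12.
Qed.

End goursat.

Arguments Normc.normc : simpl never.
Arguments expi : simpl never.

(** * Cauchy's theorem with an exceptional point, mean values and Cauchy's formula *)

Section cauchy_formula.
Variable R : realType.
Local Notation C := (R[i]^o)%type.
Local Notation leb := (@lebesgue_measure R).
Implicit Types (g : C -> C) (z w d : C) (r s t rho : R).

Definition hol rho g := forall z, modulus z < rho -> exists d, has_cderiv g z d.

Lemma continuous_circle g r : (forall z, modulus z = `|r| -> clim (at_ z) g (g z)) ->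
  continuous (fun t => g (r%:C * expi t)).
Proof.
move=> cg; apply: continuous_comp_clim => [|t]; last by apply: cg; rewrite modulus_rexpi.
by apply: continuousM_C; [exact: cont_cst|exact: continuous_expi].
Qed.

Lemma hol_clim rho g z : hol rho g -> modulus z < rho -> clim (at_ z) g (g z).
Proof. by move=> hg /hg[d /has_cderiv_continuous]. Qed.

Lemma hol_circle rho g r : hol rho g -> 0 <= r < rho -> continuous (fun t => g (r%:C * expi t)).
Proof.
move=> hg /andP[r0 rr]; apply: continuous_circle => z zr; apply: hol_clim hg _.
by rewrite zr ger0_norm.
Qed.

(** The mean over the circle of radius x is continuous in x and vanishes at x = 0. By
    [cauchy_annulus] it is constant on either side of x = |w|, and continuity joins the two
    sides. *)
Lemma cauchy_punctured rho (K : C -> C) w r :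
  (forall z, modulus z < rho -> clim (at_ z) K (K z)) ->
  (forall z, modulus z < rho -> z != w -> exists d, has_cderiv K z d) ->
  0 <= r < rho -> avg (fun t => K (r%:C * expi t) * (r%:C * expi t)) = 0.
Proof.
move=> cK dK /andP[r0 rr].
pose cl x := Num.max 0 (Num.min x r).
have cl_itv x : 0 <= cl x <= r by rewrite /cl le_max lexx /= ge_max r0 /= ge_min lexx orbT.
have clE x : 0 <= x <= r -> cl x = x.
  by move=> /andP[h1 h2]; rewrite /cl (min_idPl h2) (max_idPr h1).
have continuous_cl : continuous cl.
  move=> x; apply: (@continuous_max _ _ (cst 0) (fun x => Num.min x r)); first exact: cvg_cst.
  by apply: (@continuous_min _ _ id (cst r)); [exact: cvg_id|exact: cvg_cst].
pose zz (p : R * R) : C := (cl p.1)%:C * expi p.2.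
have czz : continuous zz.
  apply: continuousM_C.
    apply: (@cont_comp _ _ _ (fun p : R * R => cl p.1) (fun r => r%:C : C)); last exact: continuous_realC.
    by apply: (@cont_comp _ _ _ (fst : R * R -> R) cl) => // p; exact: cvg_fst.
  apply: (@cont_comp _ _ _ (snd : R * R -> R) (@expi R)); last exact: continuous_expi.
  by move=> p; exact: cvg_snd.
have cKz : continuous (fun p => K (zz p)).
  apply: continuous_comp_clim => // p; apply: cK; rewrite modulus_rexpi.
  by have /andP[h1 h2] := cl_itv p.1; rewrite ger0_norm // (le_lt_trans h2).
pose I x := avg (fun t => K (zz (x, t)) * zz (x, t)).
have cI : continuous I.
  exact: (continuous_param_avg (continuousM_C cKz czz)).
have IE x : 0 <= x <= r -> I x = avg (fun t => K (x%:C * expi t) * (x%:C * expi t)).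
  by move=> hx; apply: eq_avg => t; rewrite /zz /= clE.
have I0 : I 0 = 0.
  rewrite IE ?lexx //; under eq_avg do rewrite mul0r mulr0.
  exact: avg_cst.
have Ieq x y : 0 <= x -> x <= y -> y <= r -> (y < modulus w \/ modulus w < x) -> I x = I y.
  move=> x0 xy yr H; rewrite !IE ?x0 ?(le_trans xy) ?(le_trans x0) //.
  apply: (cauchy_annulus x0 xy) => z /andP[h1 h2]; apply: dK.
    exact: le_lt_trans h2 (le_lt_trans yr rr).
  by apply/eqP => zw; move: h1 h2; rewrite zw => h1 h2; case: H => h; lra.
rewrite -IE ?r0 ?lexx //.
have near_eq x : 0 <= x <= r -> (forall e, 0 < e -> exists2 y, `|x - y| < e & I y = 0) -> I x = 0.
  move=> hx H; apply: modulus_le0; apply/ler_addgt0Pl => e e0; rewrite addr0.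
  have /ccvgP/(_ _ e0)/nbhs_ballP[d /= d0 Hd] := cI x.
  have [y xy Iy] := H _ d0; have := Hd y xy; rewrite Iy sub0r modulusN; exact: ltW.
have left x : 0 <= x <= r -> x <= modulus w -> I x = 0.
  move=> /andP[x0 xr] xw; move: x0; rewrite le_eqVlt => /predU1P[<-|x0]; first exact: I0.
  apply: near_eq; first by rewrite ltW.
  move=> e e0; pose m := Num.min x e; have m0 : 0 < m by rewrite /m lt_min x0.
  have mx : m <= x by rewrite /m ge_min lexx.
  have me : m <= e by rewrite /m ge_min lexx orbT.
  exists (x - m / 2); first by rewrite opprB addrC subrK gtr0_norm; lra.
  by rewrite -I0; apply/esym/Ieq; try lra; left; lra.
have [rw|wr] := leP r (modulus w); first by apply: left => //; rewrite r0 lexx.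
have w0 := modulus_ge0 w.
(* The mean is constant for radii above |w|, and continuity from the right carries the value 0
   across |w|. *)
suff <- : I (modulus w) = I r by apply: left; rewrite ?lexx ?w0 ?ltW.
apply/eqP; rewrite -subr_eq0; apply/eqP/modulus_le0/ler_addgt0Pl => e e0; rewrite addr0.
have /ccvgP/(_ _ e0)/nbhs_ballP[d /= d0 Hd] := cI (modulus w).
pose m := Num.min (r - modulus w) d.
have m0 : 0 < m by rewrite /m lt_min d0 subr_gt0 wr.
have mx : m <= r - modulus w by rewrite /m ge_min lexx.
have me : m <= d by rewrite /m ge_min lexx orbT.
have := Hd (modulus w + m / 2); rewrite /ball /= opprD addrA subrr sub0r normrN gtr0_norm ?divr_gt0 //.
have -> : I (modulus w + m / 2) = I r by apply: Ieq; try lra; right; lra.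
by rewrite modulusB => h; apply: ltW; apply: h; lra.
Qed.

Lemma has_cderiv_near g h z d : (\forall w \near at_ z, g w = h w) -> g z = h z ->
  has_cderiv g z d -> has_cderiv h z d.
Proof.
move=> gh ghz hg; apply: (has_cderiv_intro hg); near=> w.
by rewrite -ghz -slopeE; congr (_ - _); apply/esym; near: w.
Unshelve. all: by end_near. Qed.

Lemma near_neq z w : z != w -> \forall x \near at_ z, x != w.
Proof.
move=> zw; apply/at_P; exists (modulus (z - w)); first by rewrite modulus_gt0 // subr_eq0.
by move=> x h; apply/eqP => xw; move: h; rewrite xw modulusB ltxx.
Qed.

Lemma has_cderiv_slope g w d z d' : z != w -> has_cderiv g z d' -> exists e, has_cderiv (slope g w d) z e.
Proof.
move=> zw hz.
have h := has_cderivM (has_cderivB hz (has_cderiv_cst (g w) z))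
  (has_cderivV _ (has_cderivB (has_cderiv_id z) (has_cderiv_cst w z))).
eexists; apply: has_cderiv_near (h _); last by rewrite subr_eq0.
- by apply: filterS (near_neq zw) => x xw; rewrite /slope (negPf xw).
- by rewrite /slope (negPf zw).
Qed.

(** The completed difference quotient is continuous at [w] and differentiable elsewhere. Both the
    mean value property and Cauchy's formula are read off from this identity. *)
Lemma avg_slope rho g w d r : hol rho g -> has_cderiv g w d -> 0 <= r < rho ->
  avg (fun t => slope g w d (r%:C * expi t) * (r%:C * expi t)) = 0.
Proof.
move=> hg hd; apply: (@cauchy_punctured rho _ w) => z zr.
  have [->|zw] := eqVneq z w; first by rewrite {2}/slope eqxx.
  have [d' hd'] := hg _ zr; have [e he] := has_cderiv_slope d zw hd'.
  exact: has_cderiv_continuous he.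
by move=> zw; have [d' hd'] := hg _ zr; exact: has_cderiv_slope zw hd'.
Qed.

Lemma mean_value rho g r : hol rho g -> 0 <= r < rho -> avg (fun t => g (r%:C * expi t)) = g 0.
Proof.
move=> hg hr; have rho0 : modulus (0 : C) < rho.
  by rewrite Normc.normc0; case/andP: hr => h1; exact: le_lt_trans.
have [d hd] := hg _ rho0; have := avg_slope hg hd hr.
under eq_avg => t do rewrite -[X in _ * X]subr0 -slopeE.
rewrite avgB; [|exact: hol_circle hg hr|exact: cont_cst].
by rewrite avg_cst => /eqP; rewrite subr_eq0 => /eqP.
Qed.

Lemma cint_conj (a b : R) (F : R -> C) : continuous F ->
  cint a b (fun t => (F t)^*%C) = (cint a b F)^*%C.
Proof.
move=> cF; rewrite /cint /=; congr (_ +i* _).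
  by apply: eq_Rintegral => t _; case: (F t).
rewrite -mulN1r -RintegralZl //; last exact: continuous_integrable (Im_cont cF).
by apply: eq_Rintegral => t _; case: (F t) => u v /=; rewrite mulN1r.
Qed.

Lemma avg_conj (F : R -> C) : continuous F -> avg (fun t => (F t)^*%C) = (avg F)^*%C.
Proof. by move=> cF; rewrite /avg cint_conj // rmorphM /= oppr0. Qed.

Lemma rexpi_neq w r t : modulus w < r -> r%:C * expi t - w != 0.
Proof.
move=> wr; rewrite subr_eq0; apply/eqP => h; move: wr; rewrite -h modulus_rexpi => h'.
by move: (ler_norm r); lra.
Qed.

Lemma conjc_modulus z : modulus z^*%C = modulus z.
Proof. by case: z => a b; rewrite /= /Normc.normc sqrrN. Qed.

Lemma modulus_sqrC z : ((modulus z ^+ 2)%:C : C) = z * z^*%C.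
Proof. by rewrite modulus_sqr; case: z => a b; simpc; rewrite /= !expr2; congr (_ +i* _); ring. Qed.

(** The pole has modulus r / |w| > 1, so the function is holomorphic beyond the closed unit disc; it
    vanishes at 0. Its boundary conjugate is w / (r e^(it) - w), which brings the kernels within
    reach of the mean value property. *)
Lemma hol_mobius r w : modulus w < r ->
  exists2 rho, 1 < rho & hol rho (fun z => z * w^*%C / (r%:C - z * w^*%C)).
Proof.
move=> wr; have r0 : 0 < r by exact: le_lt_trans (modulus_ge0 w) wr.
have H z : modulus z * modulus w < r -> exists d, has_cderiv (fun z => z * w^*%C / (r%:C - z * w^*%C)) z d.
  move=> zw; have hz := has_cderivM (has_cderiv_id z) (has_cderiv_cst w^*%C z).
  have h := has_cderivM hz (has_cderivV _ (has_cderivB (has_cderiv_cst r%:C z) hz)).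
  eexists; apply: h; rewrite subr_eq0; apply/eqP => /(congr1 (@modulus R)).
  by rewrite modulusM conjc_modulus modulusC gtr0_norm // => e; rewrite e ltxx in zw.
have [w0|w0] := eqVneq (modulus w) 0.
  by exists 2 => [|z _]; [rewrite ltr1n|apply: H; rewrite w0 mulr0].
have w1 : 0 < modulus w by rewrite lt_neqAle eq_sym w0 modulus_ge0.
exists (r / modulus w) => [|z]; first by rewrite ltr_pdivlMr // mul1r.
by rewrite ltr_pdivlMr //; exact: H.
Qed.

Lemma conjcM z w : (z * w)^*%C = z^*%C * w^*%C. Proof. exact: rmorphM. Qed.

Lemma conjcB z w : (z - w)^*%C = z^*%C - w^*%C. Proof. exact: rmorphB. Qed.

Lemma conjcV z : (z^-1)^*%C = (z^*%C)^-1. Proof. exact: fmorphV. Qed.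

Lemma conjc_mobius w r t : modulus w < r ->
  (expi t * w^*%C / (r%:C - expi t * w^*%C))^*%C = w / (r%:C * expi t - w).
Proof.
move=> wr; rewrite conjcM conjcV conjcB !conjcM conjcK conjc_real conjc_expi expiN.
have := rexpi_neq t wr; have := expi_neq0 t => e0 h0.
by field; rewrite h0 e0.
Qed.

(** The kernel is 1 + w / (r e^(it) - w), and the second summand is the conjugate of a holomorphic
    function vanishing at 0, hence of mean zero. *)
Lemma avg_cauchy_kernel w r : modulus w < r ->
  avg (fun t => r%:C * expi t / (r%:C * expi t - w)) = 1 :> C.
Proof.
move=> wr; have [rho rho1 H] := hol_mobius wr.
have r1 : (0 : R) <= 1 < rho by apply/andP; split=> //; exact: ler01.
have := mean_value H r1; rewrite mul0r mul0r => /(congr1 (@conjc R)).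
rewrite -avg_conj; last exact: (hol_circle H r1).
rewrite conjc0 => A.
rewrite -[RHS]addr0 -A -(avg_cst 1) -avgD; last 2 first.
- exact: cont_cst.
- have -> : (fun t => (1%:C * expi t * w^*%C / (r%:C - 1%:C * expi t * w^*%C))^*%C) =
    fun t => w / (r%:C * expi t - w).
    by apply/funext => t; rewrite mul1r conjc_mobius.
  apply: continuousM_C; first exact: cont_cst.
  apply: continuousV_C; first by move=> t; exact: rexpi_neq.
  apply: continuousD_C; last exact: cont_cst.
  by apply: continuousM_C; [exact: cont_cst|exact: continuous_expi].
apply: eq_avg => t; rewrite mul1r conjc_mobius //; have := rexpi_neq t wr => h0.
by field.
Qed.

Lemma continuous_rexpi r : continuous (fun t => r%:C * expi t : C).
Proof. by apply: continuousM_C; [exact: cont_cst|exact: continuous_expi]. Qed.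

Lemma continuous_kernel w r : modulus w < r -> continuous (fun t => r%:C * expi t / (r%:C * expi t - w) : C).
Proof.
move=> wr; apply: continuousM_C; first exact: continuous_rexpi.
apply: continuousV_C; first by move=> t; exact: rexpi_neq.
by apply: continuousD_C; [exact: continuous_rexpi|exact: cont_cst].
Qed.

Theorem cauchy_formula rho g w r : hol rho g -> modulus w < r -> r < rho ->
  g w = avg (fun t => g (r%:C * expi t) * (r%:C * expi t / (r%:C * expi t - w))).
Proof.
move=> hg wr rr; have r0 : 0 <= r < rho by rewrite rr andbT (le_trans (modulus_ge0 w)) // ltW.
have [d hd] := hg _ (lt_trans wr rr); have := avg_slope hg hd r0.
have -> : (fun t => slope g w d (r%:C * expi t) * (r%:C * expi t)) = fun t =>
    g (r%:C * expi t) * (r%:C * expi t / (r%:C * expi t - w)) -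
    g w * (r%:C * expi t / (r%:C * expi t - w)).
  apply/funext => t; have h := rexpi_neq t wr; rewrite /slope ifF; last by rewrite -subr_eq0 (negPf h).
  by field.
have ck := continuous_kernel wr.
rewrite avgB; [|by apply: continuousM_C; [exact: hol_circle hg r0|exact: ck]|
  by apply: continuousM_C; [exact: cont_cst|exact: ck]].
by rewrite avgZ // avg_cauchy_kernel // mulr1 => /eqP; rewrite subr_eq0 => /eqP.
Qed.

End cauchy_formula.

(** * Poisson kernel *)

Section poisson_kernel.
Variable R : realType.
Local Notation C := (R[i]^o)%type.
Local Notation leb := (@lebesgue_measure R).
Implicit Types (g h : C -> C) (z w d : C) (r s t rho : R).

Definition avgR (h : R -> R) : R := (2 * pi)^-1 * \int[leb]_(t in `[0, 2 * pi]) h t.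

Lemma Re_avg (F : R -> C) : Re (avg F) = avgR (fun t => Re (F t)).
Proof. by rewrite /avg /avgR /cint /= mul0r subr0. Qed.

Lemma avgR_ge0 (f : R -> R) : (forall t, 0 <= f t) -> 0 <= avgR f.
Proof.
move=> f0; rewrite /avgR mulr_ge0 ?invr_ge0 ?(ltW (twopi_gt0 R)) //.
by apply: Rintegral_ge0 => t _.
Qed.

Definition pk z t : R := (1 - modulus z ^+ 2) / modulus (expi t - z) ^+ 2.

Lemma expi_subr_neq0 w t : modulus w < 1 -> expi t - w != 0.
Proof. by move=> w1; have := rexpi_neq t w1; rewrite mul1r. Qed.

Lemma pk_gt0 w t : modulus w < 1 -> 0 < pk w t.
Proof.
move=> w1; rewrite /pk divr_gt0 ?exprn_gt0 ?modulus_gt0 ?expi_subr_neq0 //.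
by rewrite subr_gt0 expr_lt1 // modulus_ge0.
Qed.

(** The Poisson kernel is the Cauchy kernel plus the boundary values of the function of [hol_mobius]
    with r = 1. *)
Lemma pkE w t : modulus w < 1 ->
  (pk w t)%:C = expi t / (expi t - w) + expi t * w^*%C / (1 - expi t * w^*%C).
Proof.
move=> w1; have e0 := expi_neq0 t; have h0 := expi_subr_neq0 t w1.
rewrite /pk rmorphM rmorphB /= fmorphV /= rmorph1 !modulus_sqrC conjcB conjc_expi expiN.
have h1 : (expi t)^-1 - w^*%C != 0.
  have -> : (expi t)^-1 - w^*%C = (expi t - w)^*%C by rewrite conjcB conjc_expi expiN.
  by rewrite conjc_eq0.
have h2 : 1 - expi t * w^*%C != 0.
  by have -> : 1 - expi t * w^*%C = expi t * ((expi t)^-1 - w^*%C); [field|rewrite mulf_neq0].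
by field; rewrite ?h0 ?h2 ?e0 //= mulrC.
Qed.

Lemma continuous_pk w : modulus w < 1 -> continuous (pk w).
Proof.
move=> w1; have -> : pk w = fun t => Re (expi t / (expi t - w) + expi t * w^*%C / (1 - expi t * w^*%C)).
  by apply/funext => t; rewrite -pkE.
apply: Re_cont; have ce := @continuous_expi R.
have cew : continuous (fun t => expi t * w^*%C : C) by apply: continuousM_C; [exact: ce|exact: cont_cst].
apply: continuousD_C; apply: continuousM_C; [exact: ce| |exact: cew|].
  apply: continuousV_C => [t|]; first exact: expi_subr_neq0.
  by apply: continuousD_C; [exact: ce|exact: cont_cst].
apply: continuousV_C => [t|]; last first.
  by apply: continuousD_C; [exact: cont_cst|exact: continuousN_C cew].
have e0 := expi_neq0 t; have h0 := expi_subr_neq0 t w1.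
have -> : 1 - expi t * w^*%C = expi t * (expi t - w)^*%C.
  by rewrite conjcB conjc_expi expiN; field.
by rewrite mulf_neq0 // conjc_eq0.
Qed.

Lemma hol_min rho rho' g h : hol rho g -> hol rho' h -> hol (Num.min rho rho') (fun z => g z * h z).
Proof.
move=> hg hh z; rewrite lt_min => /andP[/hg[d hd] /hh[d' hd']].
by eexists; exact: has_cderivM hd hd'.
Qed.

(** In the splitting [pkE] the Cauchy kernel reproduces [g w]; the other summand times [g] is
    holomorphic and vanishes at 0, so it has mean zero. *)
Theorem poisson_formula rho g w : hol rho g -> 1 < rho -> modulus w < 1 ->
  g w = avg (fun t => g (expi t) * (pk w t)%:C).
Proof.
move=> hg rho1 w1; have [rho' rho'1 hm] := hol_mobius w1.
have m1 : (0 : R) <= 1 < Num.min rho rho' by apply/andP; split; [exact: ler01|rewrite lt_min rho1].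
have := mean_value (hol_min hg hm) m1; rewrite mul0r mul0r mulr0 => A.
have cg : continuous (fun t => g (expi t)).
  have -> : (fun t => g (expi t)) = fun t => g (1%:C * expi t) by apply/funext => t; rewrite mul1r.
  by apply: hol_circle hg _; apply/andP; split; [exact: ler01|].
rewrite (cauchy_formula hg w1 rho1) -[LHS]addr0 -A -avgD; last 2 first.
- apply: continuousM_C; last exact: continuous_kernel.
  by apply: hol_circle hg _; apply/andP; split; [exact: ler01|].
- exact: hol_circle (hol_min hg hm) m1.
by apply: eq_avg => t; rewrite mul1r -mulrDr pkE.
Qed.

Lemma avg_pk w : modulus w < 1 -> avgR (pk w) = 1.
Proof.
move=> w1; have h1 : hol 2 (fun=> 1 : C) by move=> z _; exists 0; exact: has_cderiv_cst.
have := poisson_formula h1 (ltr1n R 2) w1; move/(congr1 (@complex.Re R)); rewrite Re_avg /= => ->.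
by congr avgR; apply/funext => t; rewrite mul1r mulr0 subr0.
Qed.

Lemma avgR_D (f g : R -> R) : continuous f -> continuous g ->
  avgR (fun t => f t + g t) = avgR f + avgR g.
Proof.
move=> cf cg; rewrite /avgR RintegralD; [by rewrite mulrDr|by []|exact: continuous_integrable|exact: continuous_integrable].
Qed.

Lemma avgR_Z (k : R) (f : R -> R) : continuous f -> avgR (fun t => k * f t) = k * avgR f.
Proof.
move=> cf; rewrite /avgR RintegralZl; [by rewrite mulrCA|by []|exact: continuous_integrable].
Qed.

(** A variance identity: with respect to the probability density [pk w] the mean of [g] is [b], so
    the mean of |g|^2 equals |b|^2 plus the mean of |g - b|^2. *)
Theorem poisson_jensen rho g w : hol rho g -> 1 < rho -> modulus w < 1 ->
  modulus (g w) ^+ 2 <= avgR (fun t => modulus (g (expi t)) ^+ 2 * pk w t).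
Proof.
move=> hg rho1 w1; have E := poisson_formula hg rho1 w1; set b := g w in E *.
have cg : continuous (fun t => g (expi t)).
  have -> : (fun t => g (expi t)) = fun t => g (1%:C * expi t) by apply/funext => t; rewrite mul1r.
  by apply: hol_circle hg _; apply/andP; split; [exact: ler01|].
have cp := continuous_pk w1.
have cgp : continuous (fun t => g (expi t) * (pk w t)%:C).
  apply: continuousM_C; first exact: cg.
  exact: (@cont_comp _ _ _ (pk w) (fun r => r%:C : C) cp (@continuous_realC R)).
have cbgp : continuous (fun t => Re (b^*%C * (g (expi t) * (pk w t)%:C))).
  by apply: Re_cont; apply: continuousM_C; [exact: cont_cst|exact: cgp].
have cN : continuous (fun t => modulus (g (expi t) - b) ^+ 2 * pk w t).
  move=> t; apply: cvgM; last exact: cp.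
  apply: (@cont_comp _ _ _ (fun t => modulus (g (expi t) - b)) (fun x => x ^+ 2)).
    apply: (@cont_comp _ _ _ (fun t => g (expi t) - b) (@modulus R)); last exact: continuous_modulus.
    by apply: continuousD_C; [exact: cg|exact: cont_cst].
  exact: exprn_continuous.
have -> : (fun t => modulus (g (expi t)) ^+ 2 * pk w t) = fun t =>
    modulus (g (expi t) - b) ^+ 2 * pk w t +
    (2 * Re (b^*%C * (g (expi t) * (pk w t)%:C)) + - modulus b ^+ 2 * pk w t).
  apply/funext => t; rewrite !modulus_sqr; case: (g (expi t)) => x y; case: (b) => u v /=.
  by ring.
have c2 : continuous (fun t => 2 * Re (b^*%C * (g (expi t) * (pk w t)%:C))).
  by move=> t; apply: cvgM; [exact: cvg_cst|exact: cbgp].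
have c3 : continuous (fun t => - modulus b ^+ 2 * pk w t).
  by move=> t; apply: cvgM; [exact: cvg_cst|exact: cp].
rewrite (avgR_D cN); last by move=> t; apply: cvgD; [exact: c2|exact: c3].
rewrite (avgR_D c2 c3) (avgR_Z _ cbgp) (avgR_Z _ cp) avg_pk // -Re_avg (avgZ _ cgp) -E mulr1.
have -> : 2 * Re (b^*%C * b) + - modulus b ^+ 2 = modulus b ^+ 2.
  by rewrite modulus_sqr; case: (b) => u v /=; ring.
rewrite lerDr; apply: avgR_ge0 => t; rewrite mulr_ge0 ?sqr_ge0 // ltW // pk_gt0 //.
Qed.

End poisson_kernel.

(** * Taylor approximation in one and two variables *)

Section taylor.
Variable R : realType.
Local Notation C := (R[i]^o)%type.
Implicit Types (g h : C -> C) (z w d : C) (r s t rho : R) (F : R -> C).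

Lemma modulus_rexpiB w r s t : modulus w <= s -> r - s <= modulus (r%:C * expi t - w).
Proof.
move=> ws; apply: le_trans (modulusB_ge _ _); rewrite modulus_rexpi.
by have := ler_norm r; lra.
Qed.

Lemma continuous_rexpiB r w : continuous (fun t => r%:C * expi t - w : C).
Proof. by apply: continuousD_C; [exact: continuous_rexpi|exact: cont_cst]. Qed.

(** The difference quotient of the kernel in [v] is again explicit, with denominator (r e^(it) -
    v)(r e^(it) - w), and its distance to the limiting kernel carries a factor v - w. Only a uniform
    bound on the remaining factor has to be found. *)
Lemma cauchy_transform F r w M : continuous F -> (forall t, modulus (F t) <= M) -> modulus w < r ->
  has_cderiv (fun v => avg (fun t => F t * (r%:C * expi t / (r%:C * expi t - v)))) w
    (avg (fun t => F t * (r%:C * expi t / (r%:C * expi t - w) ^+ 2))).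
Proof.
move=> cF FM wr; pose D := (r - modulus w) / 2.
have D0 : 0 < D by rewrite divr_gt0 // subr_gt0.
have r0 : 0 < r by exact: le_lt_trans (modulus_ge0 w) wr.
have M0 : 0 <= M by exact: le_trans (modulus_ge0 _) (FM 0).
have near_w v : modulus (v - w) < D -> modulus v <= r - D.
  move=> h; have : modulus v <= modulus (v - w) + modulus w.
    by have := modulusD (v - w) w; rewrite subrK.
  by rewrite /D in h *; lra.
have near_r v : modulus (v - w) < D -> modulus v < r by move=> /near_w; lra.
pose ker v t := F t * (r%:C * expi t * ((r%:C * expi t - v)^-1 * (r%:C * expi t - w)^-1)).
have cV v : modulus v < r -> continuous (fun t => (r%:C * expi t - v)^-1 : C).
  by move=> vr; apply: continuousV_C => [t|]; [exact: rexpi_neq|exact: continuous_rexpiB].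
have cker v : modulus v < r -> continuous (ker v).
  move=> vr; apply: continuousM_C; first exact: cF.
  apply: continuousM_C; first exact: continuous_rexpi.
  by apply: continuousM_C; exact: cV.
have cT v : modulus v < r -> continuous (fun t => F t * (r%:C * expi t / (r%:C * expi t - v))).
  by move=> vr; apply: continuousM_C; [exact: cF|exact: continuous_kernel].
apply: (has_cderiv_intro (phi := fun v => avg (ker v))); last first.
  apply/at_P; exists D => // v /near_r vr.
  rewrite -avgB; [|exact: cT|exact: cT]; rewrite mulrC -avgZ; last exact: cker.
  apply: eq_avg => t; rewrite /ker; have h1 := rexpi_neq t vr; have h2 := rexpi_neq t wr.
  by field; rewrite h1 h2.
have -> : avg (fun t => F t * (r%:C * expi t / (r%:C * expi t - w) ^+ 2)) = avg (ker w).
  by apply: eq_avg => t; rewrite /ker expr2 invfM.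
move=> e e0; apply/at_P.
(* All three denominators have modulus at least [D] once [v] is within [D] of [w]; the leading 2
   comes from [modulus_avg]. *)
pose B := 2 * (M * (r * (D^-1 * D^-1 * D^-1))).
have B0 : 0 <= B by rewrite !mulr_ge0 ?invr_ge0 // ltW.
exists (Num.min D (e / (B + 1))); first by rewrite lt_min D0 divr_gt0 // ltr_wpDl.
move=> v; rewrite lt_min => /andP[vD]; rewrite ltr_pdivlMr ?ltr_wpDl // => ve.
have vr := near_r _ vD; apply: le_lt_trans ve.
rewrite -avgB; [|exact: cker|exact: cker].
have -> : (fun t => ker v t - ker w t) = fun t => (v - w) * (F t * (r%:C * expi t *
    ((r%:C * expi t - v)^-1 * (r%:C * expi t - w)^-1 * (r%:C * expi t - w)^-1))).
  apply/funext => t; rewrite /ker; have h1 := rexpi_neq t vr; have h2 := rexpi_neq t wr.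
  by field; rewrite h1 h2.
rewrite avgZ; last first.
  apply: continuousM_C; first exact: cF.
  apply: continuousM_C; first exact: continuous_rexpi.
  by apply: continuousM_C; [apply: continuousM_C; exact: cV|exact: cV].
rewrite modulusM; apply: ler_wpM2l; first exact: modulus_ge0.
apply: le_trans (_ : B <= _); last by rewrite lerDl.
apply: modulus_avg.
  apply: continuousM_C; first exact: cF.
  apply: continuousM_C; first exact: continuous_rexpi.
  by apply: continuousM_C; [apply: continuousM_C; exact: cV|exact: cV].
move=> t; rewrite !modulusM !modulusV modulus_expi mulr1 modulusC (gtr0_norm r0).
have hv : D <= modulus (r%:C * expi t - v).
  by have := modulus_rexpiB r t (near_w v vD); rewrite opprB addrC subrK.
have hw : D <= modulus (r%:C * expi t - w).
  by have := modulus_rexpiB r t (lexx (modulus w)); rewrite /D in D0 *; lra.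
have iv : (modulus (r%:C * expi t - v))^-1 <= D^-1 by rewrite lef_pV2 ?posrE // (lt_le_trans D0).
have iw : (modulus (r%:C * expi t - w))^-1 <= D^-1 by rewrite lef_pV2 ?posrE // (lt_le_trans D0).
have i0 z : 0 <= (modulus z)^-1 by rewrite invr_ge0 modulus_ge0.
rewrite ler_pM ?modulus_ge0 ?mulr_ge0 ?(ltW r0) // ler_wpM2l ?(ltW r0) // ler_pM ?mulr_ge0 //.
by rewrite ler_pM.
Qed.

Lemma cauchy_transform_eq g r w M : (forall z, modulus z < r ->
    g z = avg (fun t => g (r%:C * expi t) * (r%:C * expi t / (r%:C * expi t - z)))) ->
  continuous (fun t => g (r%:C * expi t)) -> (forall t, modulus (g (r%:C * expi t)) <= M) ->
  modulus w < r ->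
  has_cderiv g w (avg (fun t => g (r%:C * expi t) * (r%:C * expi t / (r%:C * expi t - w) ^+ 2))).
Proof.
move=> gE cg gM wr; have h := cauchy_transform cg gM wr.
apply: has_cderiv_near h; last by rewrite -gE.
apply/at_P; exists (r - modulus w); first by rewrite subr_gt0.
move=> v vw; rewrite -gE //; have := modulusD (v - w) w; rewrite subrK; lra.
Qed.

(** Differentiate Cauchy's formula under the mean and bound the kernel, whose denominator is at
    least (r - s)^2; the factor 2 is that of [modulus_avg]. *)
Lemma cauchy_estimate rho g r s w d M : hol rho g -> r < rho -> modulus w <= s -> s < r ->
  (forall z, modulus z = r -> modulus (g z) <= M) -> has_cderiv g w d ->
  modulus d <= 2 * (M * (r / (r - s) ^+ 2)).
Proof.
move=> hg rr ws sr gM hd; have wr := le_lt_trans ws sr.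
have r0 : 0 < r by exact: le_lt_trans (modulus_ge0 w) wr.
have M' t : modulus (g (r%:C * expi t)) <= M.
  by apply: gM; rewrite modulus_rexpi gtr0_norm.
have M0 : 0 <= M by exact: le_trans (modulus_ge0 _) (M' 0).
have cg : continuous (fun t => g (r%:C * expi t)) by apply: hol_circle hg _; rewrite rr (ltW r0).
have gE z : modulus z < r ->
    g z = avg (fun t => g (r%:C * expi t) * (r%:C * expi t / (r%:C * expi t - z))).
  by move=> zr; apply: cauchy_formula hg zr rr.
rewrite (has_cderiv_uniq hd (cauchy_transform_eq gE cg M' wr)).
apply: modulus_avg => [|t].
  apply: continuousM_C; first exact: cg.
  apply: continuousM_C; first exact: continuous_rexpi.
  apply: continuousV_C => [t|]; first by rewrite expf_neq0 // rexpi_neq.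
  have -> : (fun t => (r%:C * expi t - w) ^+ 2) = fun t => (r%:C * expi t - w) * (r%:C * expi t - w) by [].
  by apply: continuousM_C; exact: continuous_rexpiB.
rewrite modulusM ler_pM ?modulus_ge0 // modulusM modulus_rexpi gtr0_norm // modulusV modulusX.
have hw := modulus_rexpiB r t ws; have sr0 : 0 < r - s by rewrite subr_gt0.
rewrite ler_wpM2l ?(ltW r0) // lef_pV2 ?posrE ?exprn_gt0 ?(lt_le_trans sr0) //.
by rewrite lerXn2r ?nnegrE ?modulus_ge0 // ltW.
Qed.

Lemma has_cderiv_poly (p : {poly C}) z : has_cderiv (fun z => p.[z]) z (p^`()).[z].
Proof.
elim/poly_ind: p => [|p c IH].
  have -> : (fun z : C => (0 : {poly C}).[z]) = fun=> 0 by apply/funext => x; rewrite horner0.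
  by rewrite deriv0 horner0; exact: has_cderiv_cst.
have -> : (fun z : C => (p * 'X + c%:P).[z]) = fun z => p.[z] * z + c.
  by apply/funext => x; rewrite !hornerE.
have -> : ((p * 'X + c%:P)^`()).[z] = p^`().[z] * z + p.[z] * 1 + 0.
  by rewrite derivD derivM derivX derivC addr0 hornerD !hornerM hornerX -[1]/(1%:P) hornerC addr0.
exact: has_cderivD (has_cderivM IH (has_cderiv_id z)) (has_cderiv_cst c z).
Qed.

Lemma hol_poly rho (p : {poly C}) : hol rho (fun z => p.[z]).
Proof. by move=> z _; eexists; exact: has_cderiv_poly. Qed.

(** The form in which holomorphy on the unit disc is used below: locally uniform approximation by
    polynomials. *)
Definition poly_lim g := forall r e, r < 1 -> 0 < e ->
  exists p : {poly C}, forall z, modulus z <= r -> modulus (g z - p.[z]) <= e.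

Lemma poly_lim_continuous g z : poly_lim g -> modulus z < 1 -> clim (at_ z) g (g z).
Proof.
move=> hg z1 e e0; pose r := (1 + modulus z) / 2.
have r1 : r < 1 by rewrite /r; lra.
have e3 : 0 < e / 3 by rewrite divr_gt0.
have e4 : 0 < e / 4 by rewrite divr_gt0.
have [p hp] := hg r _ r1 e4.
have /at_P[s s0 H] := has_cderiv_continuous (has_cderiv_poly p z) e3.
apply/at_P; exists (Num.min s (r - modulus z)); first by rewrite lt_min s0 /r; lra.
move=> w; rewrite lt_min => /andP[/H h wz].
have wr : modulus w <= r by have := modulusD (w - z) z; rewrite subrK; lra.
have -> : g w - g z = (g w - p.[w]) + (p.[w] - p.[z]) - (g z - p.[z]) by ring.
apply: le_lt_trans (modulusD _ _) _; rewrite modulusN.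
have := modulusD (g w - p.[w]) (p.[w] - p.[z]).
have := hp w wr; have := hp z; have zr : modulus z <= r by rewrite /r; lra.
by move=> /(_ zr); lra.
Qed.

(** Both sides are stable under uniform convergence on the closed disc of radius [r], and the
    identity holds for polynomials. *)
Lemma poly_lim_cauchy g r z : poly_lim g -> modulus z < r -> r < 1 ->
  g z = avg (fun t => g (r%:C * expi t) * (r%:C * expi t / (r%:C * expi t - z))).
Proof.
move=> hg zr r1; apply/eqP; rewrite -subr_eq0; apply/eqP/modulus_le0/ler_addgt0Pl => e e0.
have r0 : 0 < r by exact: le_lt_trans (modulus_ge0 z) zr.
(* [k] is the loss in the mean, namely the bound r / (r - |z|) of the kernel times 2, so that
   approximation up to e / (1 + k) gives a total error of e. *)
pose k := 2 * (r / (r - modulus z)); have k0 : 0 <= k by rewrite !mulr_ge0 ?invr_ge0 ?subr_ge0 ?ltW.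
have ek : 0 < e / (1 + k) by rewrite divr_gt0 //; lra.
have [p hp] := hg r _ r1 ek.
have cg : continuous (fun t => g (r%:C * expi t)).
  apply: continuous_circle => w wr; apply: poly_lim_continuous => //.
  by rewrite wr gtr0_norm.
have cp : continuous (fun t => p.[r%:C * expi t]).
  by apply: (hol_circle (@hol_poly 1 p)); rewrite r1 ltW.
have ck := continuous_kernel zr.
rewrite addr0; have := cauchy_formula (@hol_poly 1 p) zr r1 => pE.
rewrite (_ : g z - _ = (g z - p.[z]) - avg (fun t => (g (r%:C * expi t) - p.[r%:C * expi t]) *
   (r%:C * expi t / (r%:C * expi t - z)))); last first.
  rewrite pE (_ : (fun t => (g (r%:C * expi t) - p.[r%:C * expi t]) * _) = fun t =>
      g (r%:C * expi t) * (r%:C * expi t / (r%:C * expi t - z)) -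
      p.[r%:C * expi t] * (r%:C * expi t / (r%:C * expi t - z))); last first.
    by apply/funext => t; rewrite mulrBl.
  rewrite avgB; [|exact: continuousM_C cg ck|exact: continuousM_C cp ck].
  by rewrite opprB addrA subrK.
apply: le_trans (modulusD _ _) _; rewrite modulusN.
have h1 := hp z (ltW zr).
have h2 : modulus (avg (fun t => (g (r%:C * expi t) - p.[r%:C * expi t]) *
   (r%:C * expi t / (r%:C * expi t - z)))) <= 2 * (e / (1 + k) * (r / (r - modulus z))).
  apply: modulus_avg => [|t].
    by apply: continuousM_C ck; apply: continuousD_C; [exact: cg|exact: continuousN_C cp].
  rewrite modulusM ler_pM ?modulus_ge0 //.
    by apply: hp; rewrite modulus_rexpi gtr0_norm.
  rewrite modulusM modulus_rexpi gtr0_norm // modulusV ler_wpM2l ?(ltW r0) //.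
  have hz := modulus_rexpiB r t (lexx (modulus z)); have zr0 : 0 < r - modulus z by rewrite subr_gt0.
  by rewrite lef_pV2 ?posrE ?(lt_le_trans zr0).
apply: le_trans (lerD h1 h2) _.
have -> : e / (1 + k) + 2 * (e / (1 + k) * (r / (r - modulus z))) = e / (1 + k) * (1 + k).
  by rewrite /k; ring.
by rewrite divfK // gt_eqF //; lra.
Qed.

(** Weierstrass' theorem: Cauchy's formula survives the limit, and a Cauchy transform of bounded
    continuous boundary values is differentiable. *)
Lemma poly_lim_hol g : poly_lim g -> hol 1 g.
Proof.
move=> hg w w1; pose r := (1 + modulus w) / 2.
have r1 : r < 1 by rewrite /r; lra.
have wr : modulus w < r by rewrite /r; lra.
have r0 : 0 < r by exact: le_lt_trans (modulus_ge0 w) wr.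
have [p hp] := hg r 1 r1 ltr01.
have cg : continuous (fun t => g (r%:C * expi t)).
  apply: continuous_circle => z zr; apply: poly_lim_continuous => //.
  by rewrite zr gtr0_norm.
have cp : continuous (fun t => p.[r%:C * expi t]).
  by apply: (hol_circle (@hol_poly 1 p)); rewrite r1 ltW.
have [M hM] : exists M, forall t, modulus (p.[r%:C * expi t]) <= M.
  elim/poly_ind: (p) => [|q c [M hM]]; first by exists 0 => t; rewrite horner0 Normc.normc0.
  exists (M * r + modulus c) => t; rewrite hornerMXaddC; apply: le_trans (modulusD _ _) _.
  by rewrite lerD2r modulusM modulus_rexpi gtr0_norm // ler_wpM2r // ltW.
have bg t : modulus (g (r%:C * expi t)) <= 1 + M.
  have -> : g (r%:C * expi t) = (g (r%:C * expi t) - p.[r%:C * expi t]) + p.[r%:C * expi t].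
    by rewrite subrK.
  apply: le_trans (modulusD _ _) (lerD _ (hM t)).
  by apply: hp; rewrite modulus_rexpi gtr0_norm.
by eexists; apply: cauchy_transform_eq cg bg wr => z zr; exact: poly_lim_cauchy.
Qed.

Lemma modulus_avg_itv (F : R -> C) (M : R) : continuous F ->
  (forall t, 0 <= t <= 2 * pi -> modulus (F t) <= M) -> modulus (avg F) <= 2 * M.
Proof.
move=> cF FM; rewrite /avg modulusM modulusC ger0_norm ?invr_ge0 ?(ltW (twopi_gt0 R)) //.
have := modulus_cint cF (ltW (twopi_gt0 R)) FM; rewrite subr0.
by rewrite ler_pdivrMl ?twopi_gt0 // [leRHS]mulrC.
Qed.

(** The remainder of the geometric expansion of the Cauchy kernel. The bound on [g] is stated over
    [[0, 2 * pi]] only, because in two variables it comes from compactness of that square of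
    angles. *)
Lemma taylor_approx rho g r s w M N : hol rho g -> r < rho -> modulus w <= s -> s < r ->
  (forall t, 0 <= t <= 2 * pi -> modulus (g (r%:C * expi t)) <= M) ->
  modulus (g w - \sum_(n < N) avg (fun t => g (r%:C * expi t) * (r%:C * expi t) ^- n) * w ^+ n) <=
    2 * (M * ((s / r) ^+ N * (r / (r - s)))).
Proof.
move=> hg rr ws sr gM; have wr := le_lt_trans ws sr.
have r0 : 0 < r by exact: le_lt_trans (modulus_ge0 w) wr.
have s0 : 0 <= s by exact: le_trans (modulus_ge0 w) ws.
have cg : continuous (fun t => g (r%:C * expi t)) by apply: hol_circle hg _; rewrite rr (ltW r0).
have M0 : 0 <= M.
  by apply: le_trans (modulus_ge0 _) (gM 0 _); rewrite lexx ltW // twopi_gt0.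
have re0 t : r%:C * expi t != 0 :> C.
  by apply: mulf_neq0; rewrite ?expi_neq0 // eq_complex /= eqxx andbT gt_eqF.
have cX n : continuous (fun t => (r%:C * expi t) ^- n : C).
  apply: continuousV_C => [t|]; first by rewrite expf_neq0.
  elim: n => [|n IH]; first exact: cont_cst.
  have -> : (fun t => (r%:C * expi t) ^+ n.+1) = fun t => r%:C * expi t * (r%:C * expi t) ^+ n :> C.
    by apply/funext => t; rewrite exprS.
  by apply: continuousM_C; [exact: continuous_rexpi|exact: IH].
have cgX n : continuous (fun t => g (r%:C * expi t) * (r%:C * expi t) ^- n).
  by apply: continuousM_C; [exact: cg|exact: cX].
have cgk := continuousM_C cg (continuous_kernel wr).
(* An exact formula for the remainder: removing [N] terms of the geometric series multiplies the
   kernel by (w / (r e^(it)))^N. *)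
have sumE : g w - \sum_(n < N) avg (fun t => g (r%:C * expi t) * (r%:C * expi t) ^- n) * w ^+ n =
   avg (fun t => g (r%:C * expi t) * ((w / (r%:C * expi t)) ^+ N * (r%:C * expi t / (r%:C * expi t - w)))).
  elim: N => [|N IH].
    rewrite big_ord0 subr0 (cauchy_formula hg wr rr).
    by apply: eq_avg => t; rewrite expr0 mul1r.
  rewrite big_ord_recr /= opprD addrA IH [_ * w ^+ N]mulrC -avgZ; last exact: cgX.
  rewrite -avgB; last first.
  - by apply: continuousM_C; [exact: cont_cst|exact: cgX].
  - apply: continuousM_C; first exact: cg.
    apply: continuousM_C; last exact: continuous_kernel.
    have -> : (fun t => (w / (r%:C * expi t)) ^+ N) = fun t => w ^+ N * (r%:C * expi t) ^- N.
      by apply/funext => t; rewrite expr_div_n.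
    by apply: continuousM_C; [exact: cont_cst|exact: cX].
  apply: eq_avg => t; have h := rexpi_neq t wr; have h' := re0 t.
  rewrite !expr_div_n !exprS; have h'' := expf_neq0 N h'.
  move: (r%:C * expi t) h h' h'' => x h h'; move: (x ^+ N) => y h''.
  by field; rewrite h h' h''.
rewrite sumE; apply: modulus_avg_itv => [|t ht].
  apply: continuousM_C; first exact: cg.
  apply: continuousM_C; last exact: continuous_kernel.
  have -> : (fun t => (w / (r%:C * expi t)) ^+ N) = fun t => w ^+ N * (r%:C * expi t) ^- N.
    by apply/funext => t; rewrite expr_div_n.
  by apply: continuousM_C; [exact: cont_cst|exact: cX].
rewrite modulusM ler_pM ?modulus_ge0 //; first exact: gM.
rewrite modulusM ler_pM ?modulus_ge0 //.
  rewrite modulusX modulusM modulusV modulus_rexpi gtr0_norm //.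
  by rewrite lerXn2r ?nnegrE ?mulr_ge0 ?invr_ge0 ?modulus_ge0 ?(ltW r0) // ler_wpM2r // invr_ge0 ltW.
rewrite modulusM modulus_rexpi gtr0_norm // modulusV ler_wpM2l ?(ltW r0) //.
have hw := modulus_rexpiB r t ws; have sr0 : 0 < r - s by rewrite subr_gt0.
by rewrite lef_pV2 ?posrE ?(lt_le_trans sr0).
Qed.

End taylor.

(** * Holomorphic functions of two variables as limits of polynomials *)

Section two_variables.
Variable R : realType.
Local Notation C := (R[i]^o)%type.
Implicit Types (f g h : C * C -> C) (z w d : C) (r s t : R) (p : {poly {poly C}}).

(** Links slopes to the limit defining ['D_]. The functions [k] and [a] stand for the shifted values
    in C x C, which become values of a slice [g] only after computing the pairs. *)
Lemma has_cderiv_derive (g : C -> C) (k : C -> C) z d (a : C) :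
  (forall h : C, k h = g (h + z)) -> a = g z ->
  has_cderiv g z d <-> (fun h : C => h^-1 *: (k h - a)) @ (0 : C)^' --> d.
Proof.
move=> kE ->; split=> [hd|/ccvgP H].
  apply/ccvgP => e e0; have /at_P[r r0 H] := hd _ e0.
  rewrite /at_right /dnbhs /within /=; apply/nbhs_discP; exists r => // h hr h0.
  have := H (h + z); rewrite addrK subr0 in hr * => /(_ hr).
  rewrite /slope ifF; last by rewrite -subr_eq0 addrK (negPf h0).
  by rewrite addrK kE /GRing.scale /= mulrC.
move=> e e0; have := H _ e0; rewrite /dnbhs /within /= => /nbhs_discP[r r0 Hr].
apply/at_P; exists r => // w wr; rewrite /slope; case: eqP => [_|/eqP wz].
  by rewrite subrr Normc.normc0.
have := Hr (w - z); rewrite subr0 subr_eq0 => /(_ wr wz).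
by rewrite kE subrK /GRing.scale /= mulrC.
Qed.

Lemma partial1_cderiv f z1 z2 d :
  has_cderiv (fun w => f (w, z2)) z1 d -> partial1 f (z1, z2) = d.
Proof.
move=> hd; apply/cvg_lim => //.
apply/(has_cderiv_derive _ _ _).1: hd => //= h.
by congr f; congr (_, _); rewrite /= ?scaler0 ?add0r // /GRing.scale /= mulr1.
Qed.

Lemma partial2_cderiv f z1 z2 d :
  has_cderiv (fun w => f (z1, w)) z2 d -> partial2 f (z1, z2) = d.
Proof.
move=> hd; apply/cvg_lim => //.
apply/(has_cderiv_derive _ _ _).1: hd => //= h.
by congr f; congr (_, _); rewrite /= ?scaler0 ?add0r // /GRing.scale /= mulr1.
Qed.

Lemma differentiable_slice1 f z1 z2 : differentiable f (z1, z2) ->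
  exists d, has_cderiv (fun w => f (w, z2)) z1 d.
Proof.
move=> /(@diff_derivable _ _ _ _ _ ((1, 0) : C * C)) hf; exists (partial1 f (z1, z2)).
apply/(has_cderiv_derive _ _ _).2: hf => //= h.
by congr f; congr (_, _); rewrite /= ?scaler0 ?add0r // /GRing.scale /= mulr1.
Qed.

Lemma differentiable_slice2 f z1 z2 : differentiable f (z1, z2) ->
  exists d, has_cderiv (fun w => f (z1, w)) z2 d.
Proof.
move=> /(@diff_derivable _ _ _ _ _ ((0, 1) : C * C)) hf; exists (partial2 f (z1, z2)).
apply/(has_cderiv_derive _ _ _).2: hf => //= h.
by congr f; congr (_, _); rewrite /= ?scaler0 ?add0r // /GRing.scale /= mulr1.
Qed.

Definition ev p (z : C * C) : C := p.[(z.1)%:P].[z.2].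

Lemma ev1 p z1 z2 : ev p (z1, z2) = (map_poly (horner_eval z2) p).[z1].
Proof.
rewrite /ev /= -[in RHS](hornerC z1 z2) -[z1%:P.[z2]]/(horner_eval z2 z1%:P).
by rewrite horner_map.
Qed.

(** The second variable lives in the coefficients, so its derivative acts coefficientwise. *)
Definition deriv2 p : {poly {poly C}} := map_poly (@deriv C) p.

Lemma horner_deriv2 p z : (deriv2 p).[z%:P] = (p.[z%:P])^`().
Proof.
rewrite (@horner_coef_wide _ (size p)) ?size_poly // horner_coef raddf_sum /=.
apply: eq_bigr => i _; rewrite coef_map_id0 ?deriv0 // derivM.
by rewrite -rmorphXn /= derivC mulr0 addr0.
Qed.

Lemma deriv_deriv2 p : (deriv2 p)^`() = deriv2 p^`().
Proof.
apply/polyP => i; rewrite coef_deriv !coef_map_id0 ?deriv0 // coef_deriv.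
by rewrite derivMn.
Qed.

Lemma has_cderiv_ev1 p z1 z2 : has_cderiv (fun w => ev p (w, z2)) z1 (ev p^`() (z1, z2)).
Proof.
have -> : (fun w => ev p (w, z2)) = fun w => (map_poly (horner_eval z2) p).[w].
  by apply/funext => w; rewrite ev1.
by rewrite ev1 -deriv_map; exact: has_cderiv_poly.
Qed.

Lemma has_cderiv_ev2 p z1 z2 : has_cderiv (fun w => ev p (z1, w)) z2 (ev (deriv2 p) (z1, z2)).
Proof. by rewrite /ev /= horner_deriv2; exact: has_cderiv_poly. Qed.

(** The two-variable form of [poly_lim], on closed bidiscs. It passes to slices and to both partial
    derivatives. *)
Definition poly_lim2 g := forall r e, r < 1 -> 0 < e -> exists p, forall z1 z2,
  modulus z1 <= r -> modulus z2 <= r -> modulus (g (z1, z2) - ev p (z1, z2)) <= e.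

Lemma poly_lim2_slice1 g z2 : poly_lim2 g -> modulus z2 < 1 -> poly_lim (fun w => g (w, z2)).
Proof.
move=> hg z21 r e r1 e0; have [|p hp] := hg (Num.max r (modulus z2)) e _ e0.
  by rewrite gt_max r1.
exists (map_poly (horner_eval z2) p) => z zr; rewrite -ev1.
by apply: hp; rewrite le_max ?zr ?lexx ?orbT.
Qed.

Lemma poly_lim2_slice2 g z1 : poly_lim2 g -> modulus z1 < 1 -> poly_lim (fun w => g (z1, w)).
Proof.
move=> hg z11 r e r1 e0; have [|p hp] := hg (Num.max r (modulus z1)) e _ e0.
  by rewrite gt_max r1.
exists (p.[z1%:P]) => z zr; rewrite -/(ev p (z1, z)).
by apply: hp; rewrite le_max ?zr ?lexx ?orbT.
Qed.

Lemma poly_lim2_cderiv1 g z1 z2 : poly_lim2 g -> modulus z1 < 1 -> modulus z2 < 1 ->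
  has_cderiv (fun w => g (w, z2)) z1 (partial1 g (z1, z2)).
Proof.
by move=> hg h1 h2; have [d hd] := poly_lim_hol (poly_lim2_slice1 hg h2) h1; rewrite (partial1_cderiv hd).
Qed.

Lemma poly_lim2_cderiv2 g z1 z2 : poly_lim2 g -> modulus z1 < 1 -> modulus z2 < 1 ->
  has_cderiv (fun w => g (z1, w)) z2 (partial2 g (z1, z2)).
Proof.
by move=> hg h1 h2; have [d hd] := poly_lim_hol (poly_lim2_slice2 hg h1) h2; rewrite (partial2_cderiv hd).
Qed.

(** Cauchy's estimate for g - p on a slice: the radius shrinks from [q] to [r] in exchange for
    control of the derivative. *)
Lemma poly_lim2_estimate1 g p r q e : poly_lim2 g -> r < q -> q < 1 ->
  (forall z1 z2, modulus z1 <= q -> modulus z2 <= q -> modulus (g (z1, z2) - ev p (z1, z2)) <= e) ->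
  forall z1 z2, modulus z1 <= r -> modulus z2 <= r ->
    modulus (partial1 g (z1, z2) - ev p^`() (z1, z2)) <= 2 * (e * (q / (q - r) ^+ 2)).
Proof.
move=> hg rq q1 H z1 z2 h1 h2; have r1 := lt_trans rq q1.
have hd := has_cderivB (poly_lim2_cderiv1 hg (le_lt_trans h1 r1) (le_lt_trans h2 r1)) (has_cderiv_ev1 p z1 z2).
apply: (cauchy_estimate (rho := 1) _ q1 h1 rq _ hd).
  move=> z z1'; have [d' hd'] := poly_lim_hol (poly_lim2_slice1 hg (le_lt_trans h2 r1)) z1'.
  by eexists; exact: has_cderivB hd' (has_cderiv_ev1 p z z2).
by move=> z zq; apply: H; rewrite ?zq // (le_trans h2) // ltW.
Qed.

Lemma poly_lim2_estimate2 g p r q e : poly_lim2 g -> r < q -> q < 1 ->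
  (forall z1 z2, modulus z1 <= q -> modulus z2 <= q -> modulus (g (z1, z2) - ev p (z1, z2)) <= e) ->
  forall z1 z2, modulus z1 <= r -> modulus z2 <= r ->
    modulus (partial2 g (z1, z2) - ev (deriv2 p) (z1, z2)) <= 2 * (e * (q / (q - r) ^+ 2)).
Proof.
move=> hg rq q1 H z1 z2 h1 h2; have r1 := lt_trans rq q1.
have hd := has_cderivB (poly_lim2_cderiv2 hg (le_lt_trans h1 r1) (le_lt_trans h2 r1)) (has_cderiv_ev2 p z1 z2).
apply: (cauchy_estimate (rho := 1) _ q1 h2 rq _ hd).
  move=> z z1'; have [d' hd'] := poly_lim_hol (poly_lim2_slice2 hg (le_lt_trans h1 r1)) z1'.
  by eexists; exact: has_cderivB hd' (has_cderiv_ev2 p z1 z).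
by move=> z zq; apply: H; rewrite ?zq // (le_trans h1) // ltW.
Qed.

Lemma estimate_factor r : r < 1 -> exists2 q, r < q < 1 & exists2 K, 0 < K &
  forall e, 0 < e -> 2 * (e * (q / (q - r) ^+ 2)) <= K * e.
Proof.
move=> r1; exists ((1 + r) / 2); first by lra.
set q := (1 + r) / 2; have qr : 0 < (q - r) ^+ 2 by rewrite exprn_gt0 // /q; lra.
(* The radius [r] is arbitrary below 1, so [q] may be negative, whence its absolute value; adding 1
   keeps the constant positive. *)
exists (2 * (`|q| / (q - r) ^+ 2) + 1).
  by rewrite ltr_wpDl // mulr_ge0 // divr_ge0 // ltW.
clearbody q; move=> e e0; apply: (@le_trans _ _ (2 * (`|q| / (q - r) ^+ 2) * e)).
  rewrite -mulrA ler_wpM2l // [leRHS]mulrC ler_wpM2l ?(ltW e0) //.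
  by rewrite ler_wpM2r ?ler_norm // invr_ge0 ltW.
by rewrite ler_wpM2r ?(ltW e0) // lerDl.
Qed.

Lemma poly_lim2_partial1 g : poly_lim2 g -> poly_lim2 (partial1 g).
Proof.
move=> hg r e r1 e0; have [q /andP[rq q1] [K K0 HK]] := estimate_factor r1.
have eK : 0 < e / K by rewrite divr_gt0.
have [p hp] := hg q _ q1 eK; exists p^`() => z1 z2 h1 h2.
apply: le_trans (poly_lim2_estimate1 hg rq q1 hp h1 h2) _.
by apply: le_trans (HK _ eK) _; rewrite mulrC divfK // gt_eqF.
Qed.

Lemma poly_lim2_partial2 g : poly_lim2 g -> poly_lim2 (partial2 g).
Proof.
move=> hg r e r1 e0; have [q /andP[rq q1] [K K0 HK]] := estimate_factor r1.
have eK : 0 < e / K by rewrite divr_gt0.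
have [p hp] := hg q _ q1 eK; exists (deriv2 p) => z1 z2 h1 h2.
apply: le_trans (poly_lim2_estimate2 hg rq q1 hp h1 h2) _.
by apply: le_trans (HK _ eK) _; rewrite mulrC divfK // gt_eqF.
Qed.

(** One polynomial close to [g] on a larger bidisc serves all derivatives: two nested Cauchy
    estimates lose factors [L] and [K], and 1 + K + L + K L dominates every loss. *)
Lemma poly_lim2_approx g r e : poly_lim2 g -> r < 1 -> 0 < e -> exists p, forall z1 z2,
  modulus z1 <= r -> modulus z2 <= r ->
  [/\ modulus (g (z1, z2) - ev p (z1, z2)) <= e,
      modulus (partial1 g (z1, z2) - ev p^`() (z1, z2)) <= e,
      modulus (partial2 g (z1, z2) - ev (deriv2 p) (z1, z2)) <= e,
      modulus (partial1 (partial2 g) (z1, z2) - ev (deriv2 p)^`() (z1, z2)) <= e &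
      modulus (partial2 (partial1 g) (z1, z2) - ev (deriv2 p)^`() (z1, z2)) <= e].
Proof.
move=> hg r1 e0; have [q /andP[rq q1] [K K0 HK]] := estimate_factor r1.
have [q' /andP[qq q'1] [L L0 HL]] := estimate_factor q1.
pose N := 1 + K + L + K * L.
have KL : 0 < K * L by rewrite mulr_gt0.
have N0 : 0 < N by rewrite /N !addr_gt0.
pose e' := e / N; have e'0 : 0 < e' by rewrite divr_gt0.
have Ne : N * e' = e by rewrite /e' mulrC divfK // gt_eqF.
have [p hp] := hg q' _ q'1 e'0; exists p => z1 z2 h1 h2.
have Ke : 0 <= K * e' by rewrite mulr_ge0 ?ltW.
have Le : 0 <= L * e' by rewrite mulr_ge0 ?ltW.
have KLe : 0 <= K * L * e' by rewrite mulr_ge0 ?ltW.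
have Le0 : 0 < L * e' by rewrite mulr_gt0.
have eE : e = e' + K * e' + L * e' + K * L * e' by rewrite -Ne /N; ring.
have rq' := lt_trans rq qq.
have b1 z1' z2' : modulus z1' <= q -> modulus z2' <= q ->
    modulus (partial1 g (z1', z2') - ev p^`() (z1', z2')) <= L * e'.
  by move=> u1 u2; exact: le_trans (poly_lim2_estimate1 hg qq q'1 hp u1 u2) (HL _ e'0).
have b2 z1' z2' : modulus z1' <= q -> modulus z2' <= q ->
    modulus (partial2 g (z1', z2') - ev (deriv2 p) (z1', z2')) <= L * e'.
  by move=> u1 u2; exact: le_trans (poly_lim2_estimate2 hg qq q'1 hp u1 u2) (HL _ e'0).
have w1 := le_trans h1 (ltW rq); have w2 := le_trans h2 (ltW rq).
have w1' := le_trans w1 (ltW qq); have w2' := le_trans w2 (ltW qq).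
split.
- by apply: le_trans (hp _ _ w1' w2') _; rewrite eE; lra.
- by apply: le_trans (b1 _ _ w1 w2) _; rewrite eE; lra.
- by apply: le_trans (b2 _ _ w1 w2) _; rewrite eE; lra.
- apply: le_trans (poly_lim2_estimate1 (poly_lim2_partial2 hg) rq q1 b2 h1 h2) _.
  by apply: le_trans (HK _ Le0) _; rewrite eE mulrA; lra.
- rewrite deriv_deriv2; apply: le_trans (poly_lim2_estimate2 (poly_lim2_partial1 hg) rq q1 b1 h1 h2) _.
  by apply: le_trans (HK _ Le0) _; rewrite eE mulrA; lra.
Qed.

(** The two mixed derivatives have the same polynomial approximants, because differentiation in the
    two variables commutes on polynomials. *)
Lemma poly_lim2_mixed g z1 z2 : poly_lim2 g -> modulus z1 < 1 -> modulus z2 < 1 ->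
  partial2 (partial1 g) (z1, z2) = partial1 (partial2 g) (z1, z2).
Proof.
move=> hg h1 h2; apply/eqP; rewrite -subr_eq0; apply/eqP/modulus_le0/ler_addgt0Pl => e e0.
have e2 : 0 < e / 2 by rewrite divr_gt0.
have [|p hp] := @poly_lim2_approx g (Num.max (modulus z1) (modulus z2)) _ hg _ e2.
  by rewrite gt_max h1.
have [||_ _ _ a b] := hp z1 z2; rewrite ?le_max ?lexx ?orbT //.
rewrite addr0 (_ : _ - _ = (partial2 (partial1 g) (z1, z2) - ev (deriv2 p)^`() (z1, z2)) -
  (partial1 (partial2 g) (z1, z2) - ev (deriv2 p)^`() (z1, z2))); last by ring.
have := lerD b a; rewrite -splitr; apply: le_trans.
by rewrite -[X in _ <= _ + X]modulusN; exact: modulusD.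
Qed.

Lemma expr_small (x K e : R) : 0 <= x < 1 -> 0 < e -> exists N : nat, K * x ^+ N <= e.
Proof.
move=> /andP[x0 x1] e0; have xn : `|x| < 1 by rewrite ger0_norm.
have K1 : 0 < `|K| + 1 by rewrite ltr_wpDl.
have /cvgrPdist_lt/(_ (e / (`|K| + 1))) := cvg_expr xn; rewrite divr_gt0 // => /(_ isT) [N _ H].
exists N; have := H N (leqnn N); rewrite /= sub0r normrN ger0_norm ?exprn_ge0 //.
rewrite ltr_pdivlMr // => h; apply: le_trans (ltW h); rewrite mulrC ler_wpM2l ?exprn_ge0 //.
by have := ler_norm K; lra.
Qed.

Lemma avg_sum (n : nat) (F : 'I_n -> R -> C) : (forall i, continuous (F i)) ->
  avg (fun t => \sum_i F i t) = \sum_i avg (F i) /\ continuous (fun t => \sum_i F i t).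
Proof.
elim: n F => [|n IH] F cF.
  split; last first.
    have -> : (fun t => \sum_i F i t) = fun=> 0 by apply/funext => t; rewrite big_ord0.
    exact: cont_cst.
  by rewrite big_ord0; under eq_avg do rewrite big_ord0; exact: avg_cst.
have [e c] := IH (fun i => F (widen_ord (leqnSn n) i)) (fun i => cF _).
have -> : (fun t => \sum_i F i t) = fun t =>
   \sum_(i < n) F (widen_ord (leqnSn n) i) t + F ord_max t.
  by apply/funext => t; rewrite big_ord_recr.
split; last exact: continuousD_C c (cF _).
by rewrite (avgD c (cF _)) e big_ord_recr.
Qed.

Lemma expr_small2 (x K e : R) : 0 <= K -> 0 <= x < 1 -> 0 < e -> forall m : nat,
  exists N : nat, m%:R * (K * x ^+ N) <= e.
Proof.
move=> K0 hx e0 m; have [N hN] := expr_small (m%:R * K) hx e0.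
by exists N; rewrite mulrA.
Qed.

Section taylor2.
Variable f : C * C -> C.
Hypothesis cf : forall z : C * C, bidisc z -> forall e : R, 0 < e -> exists2 r : R, 0 < r &
  forall w : C * C, modulus (w.1 - z.1) < r -> modulus (w.2 - z.2) < r -> modulus (f w - f z) < e.
Hypothesis hf1 : forall z2, modulus z2 < 1 -> hol 1 (fun w => f (w, z2)).
Hypothesis hf2 : forall z1, modulus z1 < 1 -> hol 1 (fun w => f (z1, w)).

Let q_ok (q : R) : 0 < q < 1 -> forall t, modulus (q%:C * expi t : C) < 1.
Proof. by move=> /andP[q0 q1] t; rewrite modulus_rexpi gtr0_norm. Qed.

Let torus (q : R) (p : R * R) := f (q%:C * expi p.1, q%:C * expi p.2).

Let continuous_torus q : 0 < q < 1 -> continuous (torus q).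
Proof.
move=> hq p; apply/ccvgP => e e0.
have [|r r0 H] := @cf (q%:C * expi p.1, q%:C * expi p.2) _ _ e0.
  by split; rewrite /= /unit_disc /=; exact: q_ok.
have c1 : continuous (fun p : R * R => q%:C * expi p.1 : C).
  by apply: (@cont_comp _ _ _ (fst : R * R -> R) (fun t => q%:C * expi t : C));
    [move=> ?; exact: cvg_fst|exact: continuous_rexpi].
have c2 : continuous (fun p : R * R => q%:C * expi p.2 : C).
  by apply: (@cont_comp _ _ _ (snd : R * R -> R) (fun t => q%:C * expi t : C));
    [move=> ?; exact: cvg_snd|exact: continuous_rexpi].
have /ccvgP/(_ _ r0) h1 := c1 p; have /ccvgP/(_ _ r0) h2 := c2 p.
by near=> x; apply: H => /=; near: x.
Unshelve. all: by end_near. Qed.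

(** Expand in the first variable on a circle of radius [q], then expand the Taylor coefficients,
    which depend on the second variable, in that variable. Joint continuity bounds [f] on the torus
    and makes the inner coefficients continuous in the outer angle. *)
Lemma taylor2 : poly_lim2 f.
Proof.
(* A negative [r] is replaced by 0 so that s / q is a ratio in [0, 1). *)
move=> r e r1 e0; pose s := Num.max r 0; pose q := (1 + s) / 2.
have s0 : 0 <= s by rewrite le_max lexx orbT.
have s1 : s < 1 by rewrite gt_max r1 ltr01.
have hq : 0 < q < 1 by rewrite /q; lra.
have sq : s < q by rewrite /q; lra.
have /andP[q0 q1] := hq.
have [M hM] : exists M : R, forall t u, 0 <= t <= 2 * pi -> 0 <= u <= 2 * pi ->
    modulus (f (q%:C * expi t, q%:C * expi u)) <= M.
  have cK : compact ((fun x : R * R => modulus (torus q x)) @` (`[0, 2 * pi]%classic `*` `[0, 2 * pi]%classic)).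
    apply: continuous_compact.
      apply: continuous_subspaceT.
      exact: (@cont_comp _ _ _ (torus q) (@modulus R) (continuous_torus hq) (@continuous_modulus R)).
    by apply: compact_setX; exact: segment_compact.
  have [M [_ /(_ (M + 1))]] := compact_bounded cK; rewrite ltrDl ltr01 => /(_ isT) bM.
  exists (M + 1) => t u ht hu; apply: le_trans (ler_norm _) _; apply: bM.
  by exists (t, u) => //; split; rewrite /= in_itv.
pose k := q / (q - s); have k0 : 0 <= k by rewrite divr_ge0 ?subr_ge0 ?ltW.
have tp := ltW (twopi_gt0 R).
have M0 : 0 <= M by apply: le_trans (modulus_ge0 _) (hM 0 0 _ _); rewrite lexx.
have xs : 0 <= s / q < 1 by rewrite divr_ge0 ?(ltW q0) //= ltr_pdivrMr // mul1r.
have tay1 t w N : 0 <= t <= 2 * pi -> modulus w <= s ->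
  modulus (f (q%:C * expi t, w) - \sum_(n < N) avg (fun u =>
      f (q%:C * expi t, q%:C * expi u) * (q%:C * expi u) ^- n) * w ^+ n) <= 2 * (M * ((s / q) ^+ N * k)).
  move=> ht ws; apply: (taylor_approx (g := fun v => f (q%:C * expi t, v)) N (hf2 (q_ok hq t)) q1 ws sq) => u hu.
  exact: hM.
(* The remainder estimate with no Taylor terms bounds [f] on the circle times the closed disc of
   radius [s]. *)
pose M2 := 2 * (M * k); have M20 : 0 <= M2 by rewrite mulr_ge0 // mulr_ge0.
have bM2 t w : 0 <= t <= 2 * pi -> modulus w <= s -> modulus (f (q%:C * expi t, w)) <= M2.
  by move=> ht ws; have := tay1 t w 0%N ht ws; rewrite big_ord0 subr0 expr0 mul1r.
have e2 : 0 < e / 2 by rewrite divr_gt0.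
have [N hN] : exists N : nat, 2 * (M2 * ((s / q) ^+ N * k)) <= e / 2.
  have [N hN] := expr_small (2 * M2 * k) xs e2; exists N.
  by apply: le_trans hN; rewrite le_eqVlt; apply/orP; left; apply/eqP; ring.
(* The inner order is chosen after [N], since the errors of the [N] coefficients add up; each is at
   most 4 M k (s / q)^N' once weighted by the power of [w1]. *)
have [N' hN'] : exists N' : nat, N%:R * (4 * M * k * (s / q) ^+ N') <= e / 2.
  by apply: expr_small2 => //; rewrite mulr_ge0 // mulr_ge0.
pose B n t := avg (fun u => f (q%:C * expi t, q%:C * expi u) * (q%:C * expi u) ^- n).
have re0 t : q%:C * expi t != 0 :> C.
  by apply: mulf_neq0; rewrite ?expi_neq0 // eq_complex /= eqxx andbT gt_eqF.
have cX n : continuous (fun t => (q%:C * expi t) ^- n : C).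
  apply: continuousV_C => [t|]; first by rewrite expf_neq0.
  elim: n => [|n IH]; first exact: cont_cst.
  have -> : (fun t => (q%:C * expi t) ^+ n.+1) = fun t => q%:C * expi t * (q%:C * expi t) ^+ n :> C.
    by apply/funext => t; rewrite exprS.
  by apply: continuousM_C; [exact: continuous_rexpi|exact: IH].
have cB n : continuous (B n).
  have cX2 : continuous (fun x : R * R => (q%:C * expi x.2) ^- n : C).
    by apply: (@cont_comp _ _ _ (snd : R * R -> R) (fun t => (q%:C * expi t) ^- n : C));
      [move=> ?; exact: cvg_snd|exact: cX].
  exact: (continuous_param_avg (continuousM_C (continuous_torus hq) cX2)).
pose a m n := avg (fun t => B n t * (q%:C * expi t) ^- m).
pose p : {poly {poly C}} := \sum_(m < N) (\sum_(n < N') (a m n)%:P * 'X^n)%:P * 'X^m.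
exists p => w1 w2 w1r w2r.
have w1s : modulus w1 <= s by rewrite le_max w1r.
have w2s : modulus w2 <= s by rewrite le_max w2r.
have pE : ev p (w1, w2) = \sum_(m < N) (\sum_(n < N') a m n * w2 ^+ n) * w1 ^+ m.
  rewrite /ev /p /= horner_sum horner_sum; apply: eq_bigr => m _.
  rewrite hornerM hornerC hornerXn hornerM -rmorphXn /= hornerC horner_sum; congr (_ * _).
  by apply: eq_bigr => n _; rewrite hornerM hornerC hornerXn.
have w2lt : modulus w2 < 1 by exact: le_lt_trans s1.
pose A m := avg (fun t => f (q%:C * expi t, w2) * (q%:C * expi t) ^- m).
have cf2 : continuous (fun t => f (q%:C * expi t, w2)).
  by apply: (hol_circle (hf1 w2lt)); rewrite q1 ltW.
have tayA : modulus (f (w1, w2) - \sum_(m < N) A m * w1 ^+ m) <= e / 2.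
  apply: le_trans hN.
  apply: (taylor_approx (g := fun v => f (v, w2)) N (hf1 w2lt) q1 w1s sq) => t ht.
  exact: bM2.
(* The mean defining the [m]-th coefficient may enlarge errors by q^(-m); the factor |w1|^m, at most
   q^m, undoes this uniformly in [m]. *)
have bA m : modulus (A m - \sum_(n < N') a m n * w2 ^+ n) * modulus w1 ^+ m <= 4 * M * k * (s / q) ^+ N'.
  have [sE sC] := @avg_sum N' (fun n t => w2 ^+ n * (B n t * (q%:C * expi t) ^- m))
     (fun n => continuousM_C (@cont_cst _ _ _) (continuousM_C (cB n) (cX m))).
  have -> : A m - \sum_(n < N') a m n * w2 ^+ n = avg (fun t =>
      (f (q%:C * expi t, w2) - \sum_(n < N') B n t * w2 ^+ n) * (q%:C * expi t) ^- m).
    have -> : \sum_(n < N') a m n * w2 ^+ n = avg (fun t =>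
        \sum_(n < N') w2 ^+ n * (B n t * (q%:C * expi t) ^- m)).
      rewrite sE; apply: eq_bigr => n _.
      by rewrite (avgZ (w2 ^+ n) (continuousM_C (cB n) (cX m))) mulrC.
    rewrite -(avgB (continuousM_C cf2 (cX m)) sC); apply: eq_avg => t.
    rewrite mulrBl mulr_suml; congr (_ - _); apply: eq_bigr => n _; ring.
  have cD : continuous (fun t => (f (q%:C * expi t, w2) - \sum_(n < N') B n t * w2 ^+ n) *
      (q%:C * expi t) ^- m).
    have -> : (fun t => (f (q%:C * expi t, w2) - \sum_(n < N') B n t * w2 ^+ n) *
      (q%:C * expi t) ^- m) = fun t => f (q%:C * expi t, w2) * (q%:C * expi t) ^- m -
        \sum_(n < N') w2 ^+ n * (B n t * (q%:C * expi t) ^- m).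
      apply/funext => t; rewrite mulrBl mulr_suml; congr (_ - _); apply: eq_bigr => n _; ring.
    exact: (continuousD_C (continuousM_C cf2 (cX m)) (continuousN_C sC)).
  have qm : 0 < q ^+ m by rewrite exprn_gt0.
  have bnd : modulus (avg (fun t => (f (q%:C * expi t, w2) - \sum_(n < N') B n t * w2 ^+ n) *
      (q%:C * expi t) ^- m)) <= 2 * (2 * (M * ((s / q) ^+ N' * k)) * q ^- m).
    apply: (modulus_avg_itv cD) => t ht; rewrite modulusM modulusV modulusX modulus_rexpi gtr0_norm //.
    by rewrite ler_wpM2r ?invr_ge0 ?(ltW qm) //; exact: tay1.
  apply: (@le_trans _ _ (2 * (2 * (M * ((s / q) ^+ N' * k)) * q ^- m) * q ^+ m)).
    apply: ler_pM => //; rewrite ?modulus_ge0 ?exprn_ge0 ?modulus_ge0 //.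
    by rewrite lerXn2r ?nnegrE ?modulus_ge0 ?(ltW q0) // (le_trans w1s) // ltW.
  rewrite le_eqVlt; apply/orP; left; apply/eqP; rewrite -!mulrA mulVf ?gt_eqF //.
  by ring.
have -> : f (w1, w2) - ev p (w1, w2) = (f (w1, w2) - \sum_(m < N) A m * w1 ^+ m) +
   \sum_(m < N) (A m - \sum_(n < N') a m n * w2 ^+ n) * w1 ^+ m.
  have -> : \sum_(m < N) (A m - \sum_(n < N') a m n * w2 ^+ n) * w1 ^+ m =
      \sum_(m < N) A m * w1 ^+ m - \sum_(m < N) (\sum_(n < N') a m n * w2 ^+ n) * w1 ^+ m.
    by rewrite -sumrB; apply: eq_bigr => m _; rewrite mulrBl.
  by rewrite pE addrA subrK.
apply: le_trans (modulusD _ _) _; rewrite [e]splitr; apply: lerD => //.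
apply: le_trans hN'.
have msum (n : nat) (F : 'I_n -> C) : modulus (\sum_i F i) <= \sum_i modulus (F i).
  elim: n F => [|n IH] F; first by rewrite !big_ord0 Normc.normc0.
  by rewrite !big_ord_recl; apply: le_trans (modulusD _ _) _; rewrite lerD2l.
apply: le_trans (msum _ _) _.
apply: (@le_trans _ _ (\sum_(m < N) (4 * M * k * (s / q) ^+ N'))).
  by apply: ler_sum => m _; rewrite modulusM modulusX.
by rewrite sumr_const card_ord [leRHS]mulr_natl.
Qed.

End taylor2.

Theorem holomorphic2_poly_lim2 f : holomorphic2 f -> poly_lim2 f.
Proof.
move=> hf; apply: taylor2.
- move=> z /hf/differentiable_continuous/ccvgP cz e /cz.
  move=> [[A B]] /= [/nbhs_discP[r1 r10 H1] /nbhs_discP[r2 r20 H2]] H.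
  exists (Num.min r1 r2); first by rewrite lt_min r10.
  move=> w; rewrite !lt_min => /andP[a _] /andP[_ b]; apply: H; split => /=; [exact: H1|exact: H2].
- by move=> z2 h2 z1 h1; apply: differentiable_slice1; apply: hf; split.
- by move=> z1 h1 z2 h2; apply: differentiable_slice2; apply: hf; split.
Qed.

End two_variables.

(** * Plane measure and weighted integrals *)

Section plane_measure.
Variable R : realType.
Local Notation leb := (@lebesgue_measure R).
Local Notation m2 := (leb \x leb)%E.
Local Open Scope ereal_scope.

(** The integral of a nonnegative function is a supremum over simple functions below it, and this
    set grows with the function. *)
Lemma ge0_le_integral_nomeas d (T : measurableType d) (mu : {measure set T -> \bar R}) (D : set T)
  (f g : T -> \bar R) : (forall x, D x -> 0 <= f x) -> (forall x, D x -> f x <= g x) ->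
  \int[mu]_(x in D) f x <= \int[mu]_(x in D) g x.
Proof.
move=> f0 fg; have g0 x : D x -> 0 <= g x by move=> Dx; exact: le_trans (f0 _ Dx) (fg _ Dx).
rewrite !ge0_integralE //; apply: le_ereal_sup => _ [h hf <-]; exists h => //= x.
 apply: le_trans (hf x) _; rewrite /patch; case: ifPn => //; rewrite inE; exact: fg.
Qed.

(** The image of Lebesgue measure under a translation agrees with it on half-open intervals, so the
    two are equal by uniqueness. [integral_scale] treats dilations likewise, after rescaling the
    measure by [c]. *)
Lemma integral_shift (f : R -> \bar R) (a : R) : measurable_fun [set: R] f -> (forall x, 0 <= f x) ->
  \int[leb]_x f (x + a)%R = \int[leb]_x f x.
Proof.
move=> mf f0.
have ms : measurable_fun [set: R] ((fun x => x + a)%R : _ -> measurableTypeR R) by exact: measurable_funD.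
transitivity (\int[pushforward leb ((fun x => x + a)%R : _ -> measurableTypeR R)]_x f x).
  by rewrite ge0_integral_pushforward // => x _; exact: f0.
apply: eq_measure_integral => A mA _; apply/esym/lebesgue_measure_unique => // _ [[u v]] _ <-.
rewrite /pushforward /=.
transitivity (leb `](u - a)%R, (v - a)%R]%classic); last first.
  by apply: (congr1 leb); apply/seteqP; split=> x /=; rewrite !in_itv /= ltrBlDr lerBrDr.
rewrite !lebesgue_measure_itv /= !lte_fin ltrBlDr subrK.
by case: ifP => // _; rewrite -!EFinB; congr (_%:E); ring.
Qed.

Lemma integral_scale (f : R -> \bar R) (c : R) : (0 < c)%R -> measurable_fun [set: R] f ->
  (forall x, 0 <= f x) -> c%:E * \int[leb]_x f (c * x)%R = \int[leb]_x f x.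
Proof.
move=> c0 mf f0.
have ms : measurable_fun [set: R] ((fun x => c * x)%R : _ -> measurableTypeR R) by exact: measurable_funM.
pose k : {nonneg R} := NngNum (ltW c0).
transitivity (\int[pushforward (mscale k leb) ((fun x => c * x)%R : _ -> measurableTypeR R)]_x f x).
  rewrite ge0_integral_pushforward //.
  have mfs : measurable_fun [set: R] (f \o *%R c) by exact: measurableT_comp mf ms.
  by rewrite preimage_setT ge0_integral_mscale // => x _; exact: f0.
apply: eq_measure_integral => A mA _; apply/esym/lebesgue_measure_unique => // _ [[u v]] _ <-.
rewrite /pushforward /mscale /=.
transitivity (c%:E * leb `](u / c)%R, (v / c)%R]%classic); last first.
  by congr (_ * leb _); apply/seteqP; split=> x /=; rewrite !in_itv /= ltr_pdivrMr // ler_pdivlMr // mulrC.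
rewrite !lebesgue_measure_itv /= !lte_fin ltr_pM2r ?invr_gt0 //.
case: ifP => _; last by rewrite mule0.
by rewrite -!EFinB -EFinM; congr (_%:E); field; rewrite gt_eqF.
Qed.

Implicit Types F : R * R -> \bar R.

Lemma measurable_shear1 F (c : R) : measurable_fun [set: R * R] F ->
  measurable_fun [set: R * R] (fun p : R * R => F (p.1 + c * p.2, p.2)%R).
Proof.
move=> mF; apply: (measurableT_comp mF); apply: measurable_fun_pair => //=.
by apply: measurable_funD => //; apply: measurable_funM.
Qed.

Lemma measurable_shear2 F (c : R) : measurable_fun [set: R * R] F ->
  measurable_fun [set: R * R] (fun p : R * R => F (p.1, p.2 + c * p.1)%R).
Proof.
move=> mF; apply: (measurableT_comp mF); apply: measurable_fun_pair => //=.
by apply: measurable_funD => //; apply: measurable_funM.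
Qed.

Lemma measurable_sec1 F (y : R) : measurable_fun [set: R * R] F -> measurable_fun [set: R] (fun x : R => F (x, y)).
Proof. by move=> mF; exact: measurableT_comp mF (measurable_pair2 y). Qed.

Lemma measurable_sec2 F (x : R) : measurable_fun [set: R * R] F -> measurable_fun [set: R] (fun y : R => F (x, y)).
Proof. by move=> mF; exact: measurableT_comp mF (measurable_pair1 x). Qed.

Lemma tonelli1 F : measurable_fun [set: R * R] F -> (forall p, 0 <= F p) ->
  \int[m2]_p F p = \int[leb]_x \int[leb]_y F (x, y).
Proof. by move=> mF F0; rewrite fubini_tonelli1. Qed.

Lemma tonelli2 F : measurable_fun [set: R * R] F -> (forall p, 0 <= F p) ->
  \int[m2]_p F p = \int[leb]_y \int[leb]_x F (x, y).
Proof. by move=> mF F0; rewrite fubini_tonelli2. Qed.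

Lemma integral_shear1 F (c : R) : measurable_fun [set: R * R] F -> (forall p, 0 <= F p) ->
  \int[m2]_p F (p.1 + c * p.2, p.2)%R = \int[m2]_p F p.
Proof.
move=> mF F0; rewrite (tonelli2 mF F0) (tonelli2 (measurable_shear1 c mF) (fun p => F0 _)).
apply: eq_integral => y _ /=.
by rewrite (integral_shift (f := fun x => F (x, y))) //; exact: measurable_sec1.
Qed.

Lemma integral_shear2 F (c : R) : measurable_fun [set: R * R] F -> (forall p, 0 <= F p) ->
  \int[m2]_p F (p.1, p.2 + c * p.1)%R = \int[m2]_p F p.
Proof.
move=> mF F0; rewrite (tonelli1 mF F0) (tonelli1 (measurable_shear2 c mF) (fun p => F0 _)).
apply: eq_integral => x _ /=.
by rewrite (integral_shift (f := fun y => F (x, y))) //; exact: measurable_sec2.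
Qed.

Definition rot (c s : R) (p : R * R) : R * R := (c * p.1 - s * p.2, s * p.1 + c * p.2)%R.

Lemma measurable_rot F (c s : R) : measurable_fun [set: R * R] F ->
  measurable_fun [set: R * R] (fun p : R * R => F (rot c s p)).
Proof.
move=> mF; apply: (measurableT_comp mF); apply: measurable_fun_pair => //=.
  by apply: measurable_funB; apply: measurable_funM.
by apply: measurable_funD; apply: measurable_funM.
Qed.

(* A rotation is a product of three shears; the half-turn is the square of a
   quarter-turn. *)
Lemma integral_rot F (c s : R) : (c ^+ 2 + s ^+ 2 = 1)%R -> measurable_fun [set: R * R] F ->
  (forall p, 0 <= F p) -> \int[m2]_p F (rot c s p) = \int[m2]_p F p.
Proof.
have gen (c' s' : R) G : (c' ^+ 2 + s' ^+ 2 = 1)%R -> (c' != -1)%R -> measurable_fun [set: R * R] G ->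
    (forall p, 0 <= G p) -> \int[m2]_p G (rot c' s' p) = \int[m2]_p G p.
  move=> e c1 mG G0; have c2 : (1 + c' != 0)%R by rewrite addrC addr_eq0.
  (* Minus the tangent of half the rotation angle. The shears of slopes [T], [s'], [T] compose to
     the rotation, and [T] makes sense exactly when the angle is not a half-turn. *)
  pose T := (- (s' / (1 + c')))%R.
  pose G1 p := G (p.1 + T * p.2, p.2)%R.
  pose G2 p := G1 (p.1, p.2 + s' * p.1)%R.
  have mG1 : measurable_fun [set: R * R] G1 by exact: measurable_shear1.
  have mG2 : measurable_fun [set: R * R] G2 by exact: measurable_shear2.
  rewrite -(integral_shear1 T mG G0) -(integral_shear2 s' mG1 (fun p => G0 _)).
  rewrite -(integral_shear1 T mG2 (fun p => G0 _)).
  suff -> : (fun p => G (rot c' s' p)) = (fun p => G2 (p.1 + T * p.2, p.2)%R) by [].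
  apply/funext => -[x y].
  have s2 : (s' ^+ 2 = (1 - c') * (1 + c'))%R.
    by apply/eqP; rewrite -subr_eq0 (_ : _ - _ = c' ^+ 2 + s' ^+ 2 - 1)%R; [rewrite e subrr|ring].
  have Ts : (T * s' = c' - 1)%R.
    by rewrite /T mulNr mulrAC -expr2 s2 mulfK // opprB.
  have T1 : (T * (1 + c') = - s')%R by rewrite /T mulNr divfK.
  rewrite /G2 /G1 /rot /=; congr (G (_, _)).
    have -> : (x + T * y + T * (y + s' * (x + T * y)) = x * (1 + T * s') + T * y * (2 + T * s'))%R by ring.
    by rewrite Ts (_ : (2 + (c' - 1)) = 1 + c')%R ?[(T * y * _)%R]mulrAC ?T1; ring.
  have -> : (y + s' * (x + T * y) = s' * x + y * (1 + T * s'))%R by ring.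
  by rewrite Ts; ring.
move=> e mF F0; have [c1|c1] := eqVneq c (-1)%R; last exact: gen.
have s0 : s = 0%R.
  by apply/eqP; rewrite -sqrf_eq0; apply/eqP; move: e; rewrite c1 sqrrN expr1n; lra.
have e' : (0 ^+ 2 + 1 ^+ 2 = 1 :> R)%R by rewrite expr0n expr1n add0r.
have z1 : (0 != -1 :> R)%R by rewrite eq_sym oppr_eq0 oner_eq0.
rewrite -[RHS](gen _ _ _ e' z1 mF F0) -[RHS](gen _ _ (fun p => F (rot 0 1 p)) e' z1 (measurable_rot 0 1 mF)) //.
suff -> : (fun p => F (rot c s p)) = (fun p => F (rot 0 1 (rot 0 1 p))) by [].
by apply/funext => -[x y]; rewrite /rot /= c1 s0; congr (F (_, _)); ring.
Qed.

Lemma integral_scale2 F (c : R) : (0 < c)%R -> measurable_fun [set: R * R] F -> (forall p, 0 <= F p) ->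
  (c ^+ 2)%:E * \int[m2]_p F (c * p.1, c * p.2)%R = \int[m2]_p F p.
Proof.
move=> c0 mF F0.
have mF' : measurable_fun [set: R * R] (fun p : R * R => F (c * p.1, c * p.2)%R).
  apply: (measurableT_comp mF); apply: measurable_fun_pair => //=; exact: measurable_funM.
pose h x := \int[leb]_y F (x, y).
have mh : measurable_fun [set: R] h := measurable_fun_fubini_tonelli_F (m2 := leb) F mF F0.
have h0 x : 0 <= h x by apply: integral_ge0 => y _; exact: F0.
have -> : \int[m2]_p F p = \int[leb]_x h x := tonelli1 mF F0.
have -> : \int[m2]_p F (c * p.1, c * p.2)%R = \int[leb]_x \int[leb]_y F (c * x, c * y)%R.
  exact: (tonelli1 mF' (fun p => F0 _)).
rewrite -(integral_scale c0 mh h0) expr2 EFinM -muleA -ge0_integralZl//; last 3 first.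
- exact: (measurable_fun_fubini_tonelli_F (m2 := leb) _ mF' (fun p => F0 _)).
- by move=> x _; apply: integral_ge0 => y _; exact: F0.
- by rewrite lee_fin ltW.
congr (_ * _); apply: eq_integral => x _.
by rewrite (integral_scale (f := fun y => F (c * x, y)%R)) //; exact: measurable_sec2.
Qed.

End plane_measure.

(** * Products of sigma-finite measures and Tonelli's theorem on rectangles *)

Section product_sigma_finite.
Local Open Scope ereal_scope.
Context d1 d2 (T1 : measurableType d1) (T2 : measurableType d2) (R : realType).
Variable m1 : {sigma_finite_measure set T1 -> \bar R}.
Variable m2 : {sigma_finite_measure set T2 -> \bar R}.

(** A named copy of the product measure that carries the sigma-finite structure, so that products
    can be factors of further products. *)
Definition prodm : set (T1 * T2) -> \bar R := m1 \x m2.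

HB.instance Definition _ := Measure.copy prodm (m1 \x m2).

Let sigma_finite_prodm : sigma_finite setT prodm.
Proof.
have /sigma_finiteP[F [TF ndF Foo]] := sigma_finiteT m1.
have /sigma_finiteP[G [TG ndG Goo]] := sigma_finiteT m2.
exists (fun k => F k `*` G k); last first.
  move=> k; have [mF Fk] := Foo k; have [mG Gk] := Goo k.
  split; first exact: measurableX.
  by rewrite /prodm product_measure1E // lte_mul_pinfty // ge0_fin_numE.
apply/seteqP; split => // -[x y] _.
have [i _ Fx] : (\bigcup_k F k) x by rewrite -TF.
have [j _ Gy] : (\bigcup_k G k) y by rewrite -TG.
(* The exhausting sequences are nondecreasing, so the larger index works for both coordinates. *)
exists (maxn i j) => //; split.
  by move/subsetPset: (ndF _ _ (leq_maxl i j)); exact.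
by move/subsetPset: (ndG _ _ (leq_maxr i j)); exact.
Qed.

HB.instance Definition _ := Measure_isSigmaFinite.Build _ _ _ prodm sigma_finite_prodm.

End product_sigma_finite.
Section weighted_integrals.
Local Open Scope ereal_scope.
Context d1 d2 (T1 : measurableType d1) (T2 : measurableType d2) (R : realType).
Variable m1 : {sigma_finite_measure set T1 -> \bar R}.
Variable m2 : {sigma_finite_measure set T2 -> \bar R}.
Variables (D1 : set T1) (D2 : set T2) (F : T1 * T2 -> \bar R).
Hypotheses (mD1 : measurable D1) (mD2 : measurable D2).
Hypothesis (mF : measurable_fun (D1 `*` D2) F).
Hypothesis F0 : forall x y, D1 x -> D2 y -> 0 <= F (x, y).

(** Extension by zero to the whole product, where Tonelli's theorem applies. *)
Let G := F \_ (D1 `*` D2).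

Let mG : measurable_fun [set: T1 * T2] G.
Proof. by apply/(measurable_restrictT _ (measurableX mD1 mD2)). Qed.

Let G0 p : 0 <= G p.
Proof. by rewrite /G patchE; case: p => x y; case: ifPn => //; rewrite inE => -[]; exact: F0. Qed.

Let innerE x : \int[m2]_y G (x, y) = ((fun x => \int[m2]_(y in D2) F (x, y)) \_ D1) x.
Proof.
rewrite patchE; case: ifPn => xD; last first.
  apply: integral0_eq => y _; rewrite /G patchE ifF //; apply/negbTE.
  by rewrite notin_setE => -[/= ? _]; move: xD; rewrite notin_setE.
rewrite [RHS]integral_mkcond; apply: eq_integral => y _; rewrite /G !patchE.
by move: xD; rewrite inE => xD; congr (if _ then _ else _); apply/idP/idP; rewrite !inE => // -[].
Qed.

Let innerE2 y : \int[m1]_x G (x, y) = ((fun y => \int[m1]_(x in D1) F (x, y)) \_ D2) y.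
Proof.
rewrite patchE; case: ifPn => xD; last first.
  apply: integral0_eq => x _; rewrite /G patchE ifF //; apply/negbTE.
  by rewrite notin_setE => -[/= _ ?]; move: xD; rewrite notin_setE.
rewrite [RHS]integral_mkcond; apply: eq_integral => x _; rewrite /G !patchE.
by move: xD; rewrite inE => xD; congr (if _ then _ else _); apply/idP/idP; rewrite !inE => // -[].
Qed.

Lemma measurable_integral_fst : measurable_fun D1 (fun x => \int[m2]_(y in D2) F (x, y)).
Proof.
apply/(measurable_restrictT _ mD1).
rewrite (_ : _ \_ D1 = fun x => \int[m2]_y G (x, y)); last by apply/funext => x; rewrite innerE.
exact: (measurable_fun_fubini_tonelli_F (m2 := m2) _ mG G0).
Qed.

Lemma measurable_integral_snd : measurable_fun D2 (fun y => \int[m1]_(x in D1) F (x, y)).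
Proof.
apply/(measurable_restrictT _ mD2).
rewrite (_ : _ \_ D2 = fun y => \int[m1]_x G (x, y)); last by apply/funext => y; rewrite innerE2.
exact: (measurable_fun_fubini_tonelli_G (m1 := m1) _ mG G0).
Qed.

Lemma integral_iterated : \int[m1 \x m2]_(p in D1 `*` D2) F p = \int[m1]_(x in D1) \int[m2]_(y in D2) F (x, y).
Proof.
rewrite integral_mkcond (fubini_tonelli1 _ mG G0) [RHS]integral_mkcond.
by apply: eq_integral => x _; rewrite -innerE.
Qed.

Lemma integral_exchange :
  \int[m1]_(x in D1) \int[m2]_(y in D2) F (x, y) = \int[m2]_(y in D2) \int[m1]_(x in D1) F (x, y).
Proof.
rewrite -integral_iterated integral_mkcond (fubini_tonelli2 _ mG G0) [RHS]integral_mkcond.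
by apply: eq_integral => x _; rewrite -innerE2.
Qed.

End weighted_integrals.

(** * Weighted means, their products, and Fatou's lemma *)

Section mean_spaces.
Local Open Scope ereal_scope.
Variable R : realType.

(* The circle, the disc, a mass distribution on the circle and their products are
   treated uniformly as weighted integrals [k * \int_D f dm]. *)
Record mspace := MSpace {
  mdisp : measure_display;
  pt : measurableType mdisp;
  mmeas : {sigma_finite_measure set pt -> \bar R};
  dom : set pt;
  mdom : measurable dom;
  wt : R;
  wt_ge0 : (0 <= wt)%R }.

Arguments dom : clear implicits. Arguments mdom : clear implicits. Arguments mmeas : clear implicits.
Arguments wt : clear implicits. Arguments wt_ge0 : clear implicits.

Definition mean (S : mspace) (f : pt S -> \bar R) : \bar R :=
  (wt S)%:E * \int[mmeas S]_(x in dom S) f x.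

Definition mprod (S T : mspace) : mspace :=
  @MSpace _ _ (prodm (mmeas S) (mmeas T)) _ (measurableX (mdom S) (mdom T))
    _ (mulr_ge0 (wt_ge0 S) (wt_ge0 T)).

Implicit Types S T : mspace.

Let wtE S : 0 <= (wt S)%:E. Proof. by rewrite lee_fin wt_ge0. Qed.

Lemma mean_ge0 S (f : pt S -> \bar R) : (forall x, dom S x -> 0 <= f x) -> 0 <= mean f.
Proof. by move=> f0; rewrite /mean mule_ge0 //; apply: integral_ge0. Qed.

Lemma eq_mean S (f g : pt S -> \bar R) : (forall x, dom S x -> f x = g x) -> mean f = mean g.
Proof. by move=> fg; rewrite /mean; congr (_ * _); apply: eq_integral => x; rewrite inE; exact: fg. Qed.

Lemma mean_le S (f g : pt S -> \bar R) : (forall x, dom S x -> 0 <= f x) ->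
  (forall x, dom S x -> f x <= g x) -> mean f <= mean g.
Proof. by move=> f0 fg; rewrite /mean lee_wpmul2l //; exact: ge0_le_integral_nomeas. Qed.

Lemma meanD S (f g : pt S -> \bar R) : (forall x, dom S x -> 0 <= f x) -> (forall x, dom S x -> 0 <= g x) ->
  measurable_fun (dom S) f -> measurable_fun (dom S) g ->
  mean (fun x => f x + g x) = mean f + mean g.
Proof.
move=> f0 g0 mf mg; rewrite /mean ge0_integralD //; last exact: mdom.
by rewrite ge0_muleDr //; apply: integral_ge0.
Qed.

Lemma meanZ S (k : R) (f : pt S -> \bar R) : (0 <= k)%R -> (forall x, dom S x -> 0 <= f x) ->
  measurable_fun (dom S) f -> mean (fun x => k%:E * f x) = k%:E * mean f.
Proof. by move=> k0 f0 mf; rewrite /mean ge0_integralZl_EFin //; [rewrite muleCA|exact: mdom]. Qed.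

Lemma mean_fatou S (f : (pt S -> \bar R)^nat) g : (forall n x, dom S x -> 0 <= f n x) ->
  (forall n, measurable_fun (dom S) (f n)) -> (forall x, dom S x -> f^~ x @ \oo --> g x) ->
  mean g <= limn_einf (fun n => mean (f n)).
Proof.
move=> f0 mf fg.
have g0 x : dom S x -> 0 <= g x.
  move=> Dx; rewrite -(cvg_lim _ (fg x Dx)) //; apply: lime_ge; first by apply: cvgP; exact: fg.
  by apply: nearW => n; exact: f0.
have mg : measurable_fun (dom S) g.
  by apply: (emeasurable_fun_cvg f) => x; [exact: mf|exact: fg].
pose k := (wt S)%:E.
have E (h : pt S -> \bar R) : (forall x, dom S x -> 0 <= h x) -> measurable_fun (dom S) h ->
    mean h = \int[mmeas S]_(x in dom S) (k * h x).
  by move=> h0 mh; rewrite /mean ge0_integralZl_EFin //; [exact: mdom|exact: wt_ge0].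
rewrite E //; under [X in _ <= limn_einf X]eq_fun => n do rewrite (E _ (f0 n) (mf n)).
apply: le_trans (fatou (mmeas S) (mdom S) _ _); last 2 first.
- by move=> n; apply: measurable_funeM.
- by move=> n x Dx; exact: (mule_ge0 (wtE S) (f0 n x Dx)).
apply: ge0_le_integral_nomeas => x Dx; first exact: (mule_ge0 (wtE S) (g0 x Dx)).
have h : (fun n => k * f n x) @ \oo --> k * g x by apply: cvgeZl => //; exact: fg.
by have [-> _] := cvg_limn_einf_sup h.
Qed.

Section product.
Variables (S T : mspace) (F : pt S * pt T -> \bar R).
Hypothesis mF : measurable_fun (dom (mprod S T)) F.
Hypothesis F0 : forall x y, dom S x -> dom T y -> 0 <= F (x, y).

Lemma measurable_mean : measurable_fun (dom S) (fun x => mean (fun y => F (x, y))).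
Proof.
apply: measurable_funeM; exact: (measurable_integral_fst (mmeas T) (mdom S) (mdom T) mF F0).
Qed.

Let int0 x : dom S x -> 0 <= \int[mmeas T]_(y in dom T) F (x, y).
Proof. by move=> Dx; apply: integral_ge0 => y; exact: F0. Qed.

Let meanE : mean (fun x => mean (fun y => F (x, y))) =
  (wt S * wt T)%:E * \int[mmeas S]_(x in dom S) \int[mmeas T]_(y in dom T) F (x, y).
Proof.
rewrite EFinM -muleA -(ge0_integralZl_EFin _ (mdom S)) //; last exact: wt_ge0.
exact: (measurable_integral_fst (mmeas T) (mdom S) (mdom T) mF F0).
Qed.

Lemma mean_iterated : mean (S := mprod S T) F = mean (fun x => mean (fun y => F (x, y))).
Proof. by rewrite meanE -(integral_iterated _ _ (mdom S) (mdom T) mF F0). Qed.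

End product.

Lemma mean_swap S T (F : pt S * pt T -> \bar R) : measurable_fun (dom (mprod S T)) F ->
  (forall x y, dom S x -> dom T y -> 0 <= F (x, y)) ->
  mean (fun x => mean (fun y => F (x, y))) = mean (fun y => mean (fun x => F (x, y))).
Proof.
move=> mF F0; rewrite -mean_iterated // /mean /= (integral_iterated _ _ (mdom S) (mdom T) mF F0).
rewrite (integral_exchange _ _ (mdom S) (mdom T) mF F0).
rewrite mulrC EFinM -muleA -(ge0_integralZl_EFin _ (mdom T)) //; last 2 first.
- exact: (measurable_integral_snd (mmeas S) (mdom S) (mdom T) mF F0).
- exact: wt_ge0.
by move=> y Dy; apply: integral_ge0 => x Dx; exact: F0.
Qed.

End mean_spaces.

Arguments dom {R} _. Arguments mdom {R} _. Arguments mmeas {R} _. Arguments wt {R} _. Arguments wt_ge0 {R} _.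

(** * Measurability of complex-valued functions *)

Section complex_measurable.
Variable R : realType.
Local Notation C := (R[i]^o)%type.
Context d (T : measurableType d).
Implicit Types (D : set T) (a b : T -> C) (f : C -> C).

Definition cmeas D a := measurable_fun D (fun x => Re (a x)) /\ measurable_fun D (fun x => Im (a x)).

Lemma cmeasD D a b : cmeas D a -> cmeas D b -> cmeas D (fun x => a x + b x).
Proof.
move=> [a1 a2] [b1 b2]; split.
  have -> : (fun x => Re (a x + b x)) = (fun x => Re (a x)) \+ (fun x => Re (b x)).
    by apply/funext => x /=; case: (a x) => ? ?; case: (b x).
  exact: measurable_funD.
have -> : (fun x => Im (a x + b x)) = (fun x => Im (a x)) \+ (fun x => Im (b x)).
  by apply/funext => x /=; case: (a x) => ? ?; case: (b x).
exact: measurable_funD.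
Qed.

Lemma cmeasM D a b : cmeas D a -> cmeas D b -> cmeas D (fun x => a x * b x).
Proof.
move=> [a1 a2] [b1 b2]; split.
  have -> : (fun x => Re (a x * b x)) = (fun x => Re (a x)) \* (fun x => Re (b x)) \- (fun x => Im (a x)) \* (fun x => Im (b x)).
    by apply/funext => x /=; case: (a x) => ? ?; case: (b x).
  by apply: measurable_funB; apply: measurable_funM.
have -> : (fun x => Im (a x * b x)) = (fun x => Re (a x)) \* (fun x => Im (b x)) \+ (fun x => Im (a x)) \* (fun x => Re (b x)).
  by apply/funext => x /=; case: (a x) => ? ?; case: (b x).
by apply: measurable_funD; apply: measurable_funM.
Qed.

Lemma cmeas_cst D (k : C) : cmeas D (fun=> k).
Proof. by split; exact: measurable_cst. Qed.

Lemma cmeasN D a : cmeas D a -> cmeas D (fun x => - a x).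
Proof.
move=> ma; have -> : (fun x => - a x) = fun x => -1 * a x by apply/funext => x; rewrite mulN1r.
by apply: cmeasM => //; exact: cmeas_cst.
Qed.

Lemma cmeasB D a b : cmeas D a -> cmeas D b -> cmeas D (fun x => a x - b x).
Proof. by move=> ma mb; apply: cmeasD => //; exact: cmeasN. Qed.

Lemma cmeas_expi D (t : T -> R) : measurable_fun D t -> cmeas D (fun x => expi (t x) : C).
Proof.
by move=> mt; split; apply: (measurableT_comp _ mt); apply: continuous_measurable_fun;
  [exact: continuous_cos|exact: continuous_sin].
Qed.

Lemma measurable_modulus_sqr D a : cmeas D a -> measurable_fun D (fun x => modulus (a x) ^+ 2).
Proof.
move=> [a1 a2]; rewrite (_ : (fun x => _) = (fun x => Re (a x) ^+ 2) \+ (fun x => Im (a x) ^+ 2)).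
  by apply: measurable_funD; exact: measurable_funX.
by apply/funext => x; rewrite modulus_sqr.
Qed.

Lemma measurable_invr D (r : T -> R) : (forall x, 0 <= r x) -> measurable_fun D r ->
  measurable_fun D (fun x => (r x)^-1).
Proof.
move=> r0 mr; rewrite (_ : (fun x => _) = fun x => r x `^ (-1)).
  exact: (measurableT_comp (measurable_powR (-1)) mr).
by apply/funext => x; rewrite powR_inv1.
Qed.

Lemma measurable_pk D a (t : T -> R) : cmeas D a -> measurable_fun D t ->
  measurable_fun D (fun x => pk (a x) (t x)).
Proof.
move=> ma mt; apply: measurable_funM.
  by apply: measurable_funB; [exact: measurable_cst|exact: measurable_modulus_sqr].
apply: measurable_invr => [x|]; first exact: sqr_ge0.
by apply: measurable_modulus_sqr; apply: cmeasB => //; exact: cmeas_expi.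
Qed.

Lemma cmeas_horner D (p : {poly C}) a : cmeas D a -> cmeas D (fun x => p.[a x]).
Proof.
move=> ma; elim/poly_ind: p => [|p c IH].
  by under eq_fun do rewrite horner0; exact: cmeas_cst.
have -> : (fun x => (p * 'X + c%:P).[a x]) = fun x => p.[a x] * a x + c.
  by apply/funext => x; rewrite !hornerE.
by apply: cmeasD; [exact: cmeasM|exact: cmeas_cst].
Qed.

Lemma cmeas_ev D (p : {poly {poly C}}) a b : cmeas D a -> cmeas D b -> cmeas D (fun x => ev p (a x, b x)).
Proof.
move=> ma mb; rewrite /ev /=; elim/poly_ind: p => [|p c IH].
  have -> : (fun x => (0 : {poly {poly C}}).[(a x)%:P].[b x]) = fun=> 0.
    by apply/funext => x; rewrite !horner0.
  exact: cmeas_cst.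
have -> : (fun x => (p * 'X + c%:P).[(a x)%:P].[b x]) = fun x => p.[(a x)%:P].[b x] * a x + c.[b x].
  by apply/funext => x; rewrite hornerMXaddC hornerD hornerM hornerC.
by apply: cmeasD; [exact: cmeasM|exact: cmeas_horner].
Qed.

Lemma cmeas_cvg D (a : nat -> T -> C) b : (forall n, cmeas D (a n)) ->
  (forall x, D x -> forall e : R, 0 < e -> \forall n \near \oo, modulus (b x - a n x) <= e) -> cmeas D b.
Proof.
move=> ma ab; split.
  apply: (measurable_fun_cvg (h := fun n x => Re (a n x))) => [n|x Dx]; first by case: (ma n).
  apply/cvgrPdist_le => e e0; near=> n.
  have h : modulus (b x - a n x) <= e by near: n; exact: ab.
  apply: le_trans h; have := Re_le_modulus (b x - a n x).
  by case: (b x) => ? ?; case: (a n x).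
apply: (measurable_fun_cvg (h := fun n x => Im (a n x))) => [n|x Dx]; first by case: (ma n).
apply/cvgrPdist_le => e e0; near=> n.
have h : modulus (b x - a n x) <= e by near: n; exact: ab.
apply: le_trans h; have := Im_le_modulus (b x - a n x).
by case: (b x) => ? ?; case: (a n x).
Unshelve. all: by end_near. Qed.

(** A pointwise limit of polynomials: the [n]-th one approximates [g] to within 1 / (n + 1) for
    radii up to 1 - 1 / (n + 1), which eventually covers any given point of the bidisc. *)
Lemma cmeas_poly_lim2 D g a b : poly_lim2 g -> cmeas D a -> cmeas D b ->
  (forall x, D x -> modulus (a x) < 1) -> (forall x, D x -> modulus (b x) < 1) ->
  cmeas D (fun x => g (a x, b x)).
Proof.
move=> hg ma mb a1 b1.
have h n : {p : {poly {poly C}} | forall z1 z2, modulus z1 <= 1 - n.+1%:R^-1 -> modulus z2 <= 1 - n.+1%:R^-1 ->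
    modulus (g (z1, z2) - ev p (z1, z2)) <= n.+1%:R^-1}.
  by apply: cid; apply: hg; rewrite ?invr_gt0 // ltrBlDr ltrDl invr_gt0.
apply: (@cmeas_cvg D (fun n x => ev (sval (h n)) (a x, b x))) => [n|x Dx e e0]; first exact: cmeas_ev.
pose q := Num.min e (Num.min (1 - modulus (a x)) (1 - modulus (b x))).
have q0 : 0 < q by rewrite !lt_min e0 !subr_gt0 a1 // b1.
near=> n; have : n.+1%:R^-1 < q by near: n; exact: near_infty_natSinv_lt (PosNum q0).
rewrite !lt_min => /and3P[ne na nb]; apply: le_trans (ltW ne).
by apply: (svalP (h n)); rewrite lerBrDr -lerBrDl ltW.
Unshelve. all: by end_near. Qed.

Lemma measurable_fun_pairR D (f g : T -> R) : measurable D -> measurable_fun D f -> measurable_fun D g ->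
  measurable_fun D (fun x => (f x, g x)).
Proof.
move=> mD mf mg; apply: (eq_measurable_fun (fun x => ((f \_ D) x, (g \_ D) x))).
  by move=> x xD; rewrite !patchE xD.
by apply: measurable_funTS; apply: measurable_fun_pair; apply/(measurable_restrictT _ mD).
Qed.

End complex_measurable.

(** * The disc and the circle as weighted spaces; rotations and scalings of area integrals *)

Section disc_circle.
Variable R : realType.
Local Notation C := (R[i]^o)%type.
Local Notation leb := (@lebesgue_measure R).
Local Notation fmeas := {finite_measure set (measurableTypeR R) -> \bar R}.
Implicit Types (F : C -> \bar R) (z w : C) (s t : R) (nu : fmeas).
Local Open Scope ereal_scope.

Definition disc : set (R * R) := [set p : R * R | (p.1 ^+ 2 + p.2 ^+ 2 < 1)%R].
Definition toC (p : R * R) : C := p.1 +i* p.2.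

Lemma discE (p : R * R) : disc p <-> (modulus (toC p) < 1)%R.
Proof. by rewrite /disc /toC -[(modulus _ < 1)%R](@expr_lt1 _ 2) ?modulus_ge0 // modulus_sqr. Qed.

Lemma measurable_disc : measurable disc.
Proof.
have -> : disc = (fun p : R * R => p.1 ^+ 2 + p.2 ^+ 2)%R @^-1` `]-oo, 1%R[ by [].
rewrite -[X in measurable X]setTI.
have : measurable_fun [set: R * R] (fun p : R * R => p.1 ^+ 2 + p.2 ^+ 2)%R.
  by apply: measurable_funD; apply: measurable_funX.
by apply => //; exact: measurable_itv.
Qed.

Lemma measurable_arc : measurable (@arc R).
Proof. exact: measurable_itv. Qed.

Let pi_inv_ge0 : (0 <= pi^-1 :> R)%R. Proof. by rewrite invr_ge0 pi_ge0. Qed.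
Let twopi_inv_ge0 : (0 <= (2 * pi)^-1 :> R)%R. Proof. by rewrite invr_ge0 mulr_ge0 // pi_ge0. Qed.

Definition area_space : mspace R := MSpace (prodm leb leb) measurable_disc pi_inv_ge0.
Definition circ_space : mspace R := MSpace leb measurable_arc twopi_inv_ge0.
Definition nu_space nu : mspace R := MSpace nu measurable_arc twopi_inv_ge0.

Lemma area_intE F : area_int F = mean (S := area_space) (fun p => F (toC p)).
Proof. by []. Qed.

Lemma circle_intE F s : circle_int F s = mean (S := circ_space) (fun t => F (s%:C * expi t)%R).
Proof. by []. Qed.

Lemma area_le F G : (forall z, (modulus z < 1)%R -> 0 <= F z) ->
  (forall z, (modulus z < 1)%R -> F z <= G z) -> area_int F <= area_int G.
Proof.
by move=> F0 FG; rewrite !area_intE; apply: mean_le => p /discE; [exact: F0|exact: FG].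
Qed.

Lemma area_ge0 F : (forall z, (modulus z < 1)%R -> 0 <= F z) -> 0 <= area_int F.
Proof. by move=> F0; rewrite area_intE; apply: mean_ge0 => p /discE; exact: F0. Qed.

Definition dmeas F := measurable_fun disc (fun p => F (toC p)).

Lemma cmeas_toC D : cmeas D toC.
Proof. by split; apply: measurable_funTS => /=; [exact: measurable_fst|exact: measurable_snd]. Qed.

Lemma dmeas_comp d (T : measurableType d) (D : set T) (a : T -> C) F : measurable D -> dmeas F -> cmeas D a ->
  (forall x, D x -> (modulus (a x) < 1)%R) -> measurable_fun D (fun x => F (a x)).
Proof.
move=> mD mF [a1 a2] aD.
have E x : a x = toC (Re (a x), Im (a x)) by rewrite /toC; case: (a x).
rewrite (_ : (fun x => F (a x)) = (fun p => F (toC p)) \o (fun x => (Re (a x), Im (a x)))); last first.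
  by apply/funext => x; rewrite /= [in LHS]E.
apply: (measurable_comp measurable_disc _ mF); last exact: measurable_fun_pairR.
by move=> _ [x Dx <-]; apply/discE; rewrite -E; exact: aD.
Qed.

Lemma modulus_expiM t z : modulus (expi t * z)%R = modulus z.
Proof. by rewrite modulusM modulus_expi mul1r. Qed.

Lemma area_expi F t : dmeas F -> (forall z, (modulus z < 1)%R -> 0 <= F z) ->
  area_int (fun z => F (expi t * z)%R) = area_int F.
Proof.
move=> mF F0; rewrite !area_intE /mean /=; congr (_ * _).
rewrite integral_mkcond [RHS]integral_mkcond.
pose G := (fun p => F (toC p)) \_ disc.
have mG : measurable_fun [set: R * R] G by apply/(measurable_restrictT _ measurable_disc).
have G0 p : 0 <= G p.
  by rewrite /G patchE; case: ifPn => //; rewrite inE => /discE; exact: F0.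
rewrite -[RHS](integral_rot (c := cos t) (s := sin t) (cos2Dsin2 t) mG G0).
apply: eq_integral => -[x y] _; rewrite /G !patchE.
have E : toC (rot (cos t) (sin t) (x, y)) = (expi t * toC (x, y))%R.
  by apply/eqP; rewrite /toC /rot /expi eq_complex /=; apply/andP; split; apply/eqP; ring.
rewrite E; congr (if _ then _ else _); apply/idP/idP; rewrite !inE !discE E modulus_expiM //.
Qed.

Lemma mean_circ_cst (k : \bar R) : mean (S := circ_space) (fun=> k) = k.
Proof.
rewrite /mean /=.
have e : ((2 * pi)^-1 * (2 * pi) = 1 :> R)%R by rewrite mulVf // gt_eqF // twopi_gt0.
rewrite integral_cst; last exact: measurable_arc.
have h : leb (@arc R) = (2 * pi)%:E.
  by rewrite /arc lebesgue_measure_itv /= lte_fin twopi_gt0 oppr0 addr0.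
rewrite [X in _ * (k * X)](_ : _ = (2 * pi)%:E); last exact: h.
by rewrite muleCA -EFinM e mule1.
Qed.

(** Plays the role of polar coordinates: rotation invariance holds for each angle, and averaging
    over the angle commutes with the area integral. An inequality between circle means thus becomes
    one between area integrals. *)
Lemma area_circ F : dmeas F -> (forall z, (modulus z < 1)%R -> 0 <= F z) ->
  area_int F = area_int (fun z => mean (S := circ_space) (fun t => F (expi t * z)%R)).
Proof.
move=> mF F0.
rewrite -[LHS]mean_circ_cst [RHS]area_intE.
rewrite (mean_swap (S := area_space) (T := circ_space) (F := fun x => F (expi x.2 * toC x.1)%R)).
- by apply: eq_mean => t _; rewrite -(area_expi t mF F0).
- apply: dmeas_comp => //; first exact: (mdom (mprod area_space circ_space)).
  + apply: cmeasM; first by apply: cmeas_expi; apply: measurable_funTS; exact: measurable_snd.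
    split; apply: measurable_funTS => /=.
      by apply: measurableT_comp; [exact: measurable_fst|exact: measurable_fst].
    by apply: measurableT_comp; [exact: measurable_snd|exact: measurable_fst].
  + by move=> -[p t] [/= /discE pD _]; rewrite modulus_expiM.
- by move=> p t /discE pD _; apply: F0; rewrite modulus_expiM.
Qed.

(** By change of variables the left-hand side is the integral of [F] over the disc of radius [b]. *)
Lemma area_scale F (b : R) : (0 < b <= 1)%R -> dmeas F -> (forall z, (modulus z < 1)%R -> 0 <= F z) ->
  (b ^+ 2)%:E * area_int (fun z => F (b%:C * z)%R) <= area_int F.
Proof.
move=> /andP[b0 b1] mF F0; rewrite !area_intE /mean /= muleCA lee_wpmul2l ?lee_fin //.
rewrite integral_mkcond [leRHS]integral_mkcond.
pose G := (fun p => F (toC p)) \_ disc.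
have mG : measurable_fun [set: R * R] G by apply/(measurable_restrictT _ measurable_disc).
have G0 p : 0 <= G p.
  by rewrite /G patchE; case: ifPn => //; rewrite inE => /discE; exact: F0.
rewrite -[leRHS](integral_scale2 b0 mG G0) lee_wpmul2l ?lee_fin ?sqr_ge0 //.
have E x y : toC (b * x, b * y)%R = (b%:C * toC (x, y))%R.
  by rewrite /toC; apply/eqP; rewrite eq_complex /= !mul0r subr0 addr0 !eqxx.
have bM z : (modulus (b%:C * z) = b * modulus z)%R by rewrite modulusM modulusC gtr0_norm.
apply: ge0_le_integral_nomeas => -[x y] _; rewrite !patchE.
  case: ifPn => //; rewrite inE => /discE h; apply: F0; rewrite bM.
  by apply: le_lt_trans h; rewrite ler_piMl // modulus_ge0.
case: ifPn => [|_]; last exact: (G0 (_, _)).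
rewrite inE => /discE h; rewrite /G patchE ifT; first by rewrite E.
by rewrite inE; apply/discE; rewrite E bM; apply: le_lt_trans h; rewrite ler_piMl // modulus_ge0.
Qed.

Lemma area_lt_pinfty : area_int (fun _ : C => 1) < +oo.
Proof.
rewrite area_intE /mean /= lte_mul_pinfty ?lee_fin //.
rewrite integral_cst ?mul1e; last exact: measurable_disc.
suff h : (leb \x leb)%E disc < +oo by exact: h.
pose I : set R := `[(-1)%R, 1%R]%classic; pose Q := I `*` I.
suff [h1 h2] : (leb \x leb)%E disc <= (leb \x leb)%E Q /\ (leb \x leb)%E Q < +oo by exact: le_lt_trans h1 h2.
split.
  apply: le_measure; rewrite ?inE //; first exact: measurable_disc.
    by apply: measurableX; exact: measurable_itv.
  move=> [x y]; rewrite /disc /Q /I /= => h; rewrite !in_itv /= -!ler_norml.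
  have hu (u : R) : (u ^+ 2 < 1 -> `|u| <= 1)%R.
    by move=> u1; rewrite -(@expr_le1 _ 2) // real_normK ?num_real // ltW.
  by split; apply: hu; have := sqr_ge0 x; have := sqr_ge0 y; lra.
have mI : measurable I by exact: measurable_itv.
have hI : leb I < +oo.
  by rewrite /I lebesgue_measure_itv /=; case: ifP => _; rewrite ?ltry // -EFinB ltry.
have -> : (leb \x leb)%E Q = leb I * leb I by exact: product_measure1E.
have fI : leb I \is a fin_num by rewrite ge0_fin_numE.
by rewrite -(fineK fI) -EFinM ltry.
Qed.

End disc_circle.

(** * Poisson integrals and dilations *)

Section poisson_integral.
Variable R : realType.
Local Notation C := (R[i]^o)%type.
Local Notation leb := (@lebesgue_measure R).
Local Notation fmeas := {finite_measure set (measurableTypeR R) -> \bar R}.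
Implicit Types (g : C -> C) (z w x y : C) (s t a b : R) (nu : fmeas).

Lemma circ_avgR (f : R -> R) : continuous f -> (forall u, 0 <= f u) ->
  mean (S := circ_space R) (fun u => (f u)%:E) = (avgR f)%:E.
Proof.
move=> cf f0; rewrite /mean /avgR EFinM /=; congr (_ * _)%E.
rewrite /Rintegral fineK; last first.
  have /integrableP[_ h] := @continuous_integrable R f 0 (2 * pi) cf.
  rewrite ge0_fin_numE; last by apply: integral_ge0 => u _; rewrite lee_fin.
  by under eq_integral => u _ do rewrite -(gee0_abs (_ : 0 <= (f u)%:E)%E) ?lee_fin //.
rewrite /arc integral_itv_bndo_bndc //.
by apply/measurable_EFinP; apply: measurable_funTS; exact: continuous_measurable_fun.
Qed.

(** Both squared distances equal 1 + t^2 - 2 t cos (u - v). *)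
Lemma pk_sym t (u v : R) : pk (t%:C * expi u) v = pk (t%:C * expi v) u.
Proof.
rewrite /pk !modulus_rexpi; congr (_ / _); rewrite !modulus_sqr /expi /=.
have := cos2Dsin2 u; have := cos2Dsin2 v.
move: (cos u) (sin u) (cos v) (sin v) => c1 s1 c2 s2 h2 h1.
transitivity (c2 ^+ 2 + s2 ^+ 2 + t ^+ 2 * (c1 ^+ 2 + s1 ^+ 2) - 2 * t * (c1 * c2 + s1 * s2)); first by ring.
transitivity (c1 ^+ 2 + s1 ^+ 2 + t ^+ 2 * (c2 ^+ 2 + s2 ^+ 2) - 2 * t * (c1 * c2 + s1 * s2)); last by ring.
by rewrite h1 h2.
Qed.

(** The Herglotz kernel is holomorphic in [z], which exhibits the Poisson kernel as a harmonic
    function of [z]. *)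
Lemma pk_Re z (u : R) : modulus z < 1 -> pk z u = Re ((expi u + z) / (expi u - z)).
Proof.
move=> z1; have {}h : modulus (expi u - z) ^+ 2 != 0 by rewrite expf_neq0 // gt_eqF // modulus_gt0 // expi_subr_neq0.
move: h; rewrite /pk !modulus_sqr; case: z {z1} => x y.
rewrite /expi /=; rewrite -[X in (X - _) / _](cos2Dsin2 u); move: (cos u) (sin u) => c s h.
by field; rewrite h.
Qed.

Lemma disc_scale x : modulus x < 1 -> exists2 rho : R, 1 < rho & forall z, modulus z < rho -> modulus (x * z) < 1.
Proof.
move=> x1; have [x0|x0] := eqVneq (modulus x) 0.
  by exists 2 => [|z _]; [exact: ltr1n|rewrite modulusM x0 mul0r].
have {}x0 : 0 < modulus x by rewrite lt_neqAle eq_sym x0 modulus_ge0.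
exists (modulus x)^-1 => [|z]; first by rewrite invf_gt1.
by rewrite modulusM -[_^-1]mul1r ltr_pdivlMr // mulrC.
Qed.

(** Real part of the Poisson formula for the Herglotz kernel at y z, a function of [z] holomorphic
    beyond the closed unit disc because |y| < 1. *)
Lemma pk_harmonic y w (u : R) : modulus y < 1 -> modulus w < 1 ->
  avgR (fun v => pk (y * expi v) u * pk w v) = pk (y * w) u.
Proof.
move=> y1 w1.
have yv z : modulus z <= 1 -> modulus (y * z) < 1.
  by move=> z1; rewrite modulusM; apply: le_lt_trans y1; rewrite ler_piMr // modulus_ge0.
have [rho rho1 hg] : exists2 rho, 1 < rho & hol rho (fun z => (expi u + y * z) / (expi u - y * z)).
  have [rho rho1 hrho] := disc_scale y1.
  exists rho => // z zr; eexists; apply: has_cderivM.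
    by apply: has_cderivD; [exact: has_cderiv_cst|apply: has_cderivM; [exact: has_cderiv_cst|exact: has_cderiv_id]].
  apply: has_cderivV; last first.
    by apply: has_cderivB; [exact: has_cderiv_cst|apply: has_cderivM; [exact: has_cderiv_cst|exact: has_cderiv_id]].
  by apply: expi_subr_neq0; exact: hrho.
have := poisson_formula hg rho1 w1; move/(congr1 (@complex.Re R)); rewrite Re_avg /= -pk_Re; last exact: yv (ltW w1).
move=> ->; congr avgR; apply/funext => v.
rewrite pk_Re; last by apply: yv; rewrite modulus_expi.
by case: (_ / _) => p q /=; rewrite mulr0 subr0.
Qed.

Lemma avg_pk_sym z (u : R) : modulus z < 1 -> avgR (fun v => pk (z * expi v) u) = 1.
Proof.
move=> z1; have z0 : modulus (0 : C) < 1 by rewrite Normc.normc0.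
have pk0 v : pk (0 : C) v = 1.
  by rewrite /pk Normc.normc0 expr0n /= !subr0 modulus_expi expr1n divr1.
have := pk_harmonic u z1 z0; rewrite mulr0 pk0 => <-; congr avgR.
by apply/funext => v; rewrite pk0 mulr1.
Qed.

Lemma pk_bounds z (u : R) : modulus z < 1 ->
  (1 - modulus z ^+ 2) / 4 <= pk z u <= (1 - modulus z ^+ 2) / (1 - modulus z) ^+ 2.
Proof.
move=> z1; have p0 : 0 <= 1 - modulus z ^+ 2 by rewrite subr_ge0 expr_le1 ?modulus_ge0 ?ltW.
have m0 : 0 < modulus (expi u - z) by rewrite modulus_gt0 // expi_subr_neq0.
have q0 : 0 < 1 - modulus z by rewrite subr_gt0.
rewrite /pk !ler_wpM2l // lef_pV2 ?posrE ?exprn_gt0 //.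
  rewrite lerXn2r ?nnegrE ?modulus_ge0 ?(ltW q0) //.
  by have := modulusB_ge (expi u) z; rewrite modulus_expi.
have -> : 4 = 2 ^+ 2 :> R by ring.
rewrite lerXn2r ?nnegrE ?modulus_ge0 //; have := modulusD (expi u) (- z); rewrite modulus_expi modulusN.
by lra.
Qed.

Lemma poissonE nu z : modulus z < 1 -> (poisson nu z)%:E = mean (S := nu_space nu) (fun u => (pk z u)%:E).
Proof.
move=> z1; rewrite /poisson /mean EFinM /=; congr (_ * _)%E; rewrite /Rintegral fineK //.
rewrite ge0_fin_numE; last by apply: integral_ge0 => u _; rewrite lee_fin ltW // pk_gt0.
pose B := (1 - modulus z ^+ 2) / (1 - modulus z) ^+ 2.
apply: (@le_lt_trans _ _ (\int[nu]_(u in @arc R) B%:E)%E).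
  apply: ge0_le_integral_nomeas => u _; rewrite lee_fin; first by rewrite ltW // pk_gt0.
  by case/andP: (pk_bounds u z1).
rewrite integral_cst; last exact: measurable_arc.
by rewrite ltey_eq fin_numM //; apply: fin_num_measure; exact: measurable_arc.
Qed.

Lemma poisson_ge0 nu z : modulus z < 1 -> 0 <= poisson nu z.
Proof.
move=> z1; rewrite -lee_fin poissonE //; apply: mean_ge0 => u _.
by rewrite lee_fin ltW // pk_gt0.
Qed.

Lemma poisson_lower nu : nu (@arc R) != 0%E -> exists2 c : R, 0 < c &
  forall z, modulus z < 1 -> c * (1 - modulus z ^+ 2) <= poisson nu z.
Proof.
move=> nu0; have fn : nu (@arc R) \is a fin_num by apply: fin_num_measure; exact: measurable_arc.
pose m := fine (nu (@arc R)).
have m0 : 0 < m by rewrite fine_gt0 // lt0e nu0 measure_ge0 ltey_eq fn.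
exists ((2 * pi)^-1 * (m / 4)); first by rewrite mulr_gt0 ?invr_gt0 ?twopi_gt0 ?divr_gt0.
move=> z z1; rewrite -lee_fin poissonE //.
apply: (@le_trans _ _ (mean (S := nu_space nu) (fun=> ((1 - modulus z ^+ 2) / 4)%:E))); last first.
  apply: mean_le => u _; rewrite lee_fin; last by case/andP: (pk_bounds u z1).
  by rewrite divr_ge0 // subr_ge0 expr_le1 ?modulus_ge0 ?ltW.
rewrite /mean /= integral_cst; last exact: measurable_arc.
rewrite [X in (_ <= _ * (_ * X))%E](_ : _ = m%:E); last by rewrite /m fineK.
rewrite -!EFinM lee_fin le_eqVlt; apply/orP; left; apply/eqP.
ring.
Qed.

Lemma poly_lim_poly_lim2 g : poly_lim g -> poly_lim2 (fun z : C * C => g z.1).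
Proof.
move=> hg r e r1 e0; have [p hp] := hg r e r1 e0.
exists (map_poly polyC p) => z1 z2 h1 _; rewrite /ev /= horner_map /= hornerC.
exact: hp.
Qed.

Lemma cmeas_poly_lim d (T : measurableType d) (D : set T) g (a : T -> C) : poly_lim g -> cmeas D a ->
  (forall p, D p -> modulus (a p) < 1) -> cmeas D (fun p => g (a p)).
Proof. by move=> /poly_lim_poly_lim2 hg ma a1; exact: (cmeas_poly_lim2 hg ma ma a1 a1). Qed.

Lemma poly_lim_circle g x : poly_lim g -> modulus x < 1 ->
  continuous (fun u : R => modulus (g (x * expi u)) ^+ 2).
Proof.
move=> hg x1; apply: (@cont_comp _ _ _ (fun u => modulus (g (x * expi u))) (fun r : R => r ^+ 2)).
  apply: (@cont_comp _ _ _ (fun u => g (x * expi u)) (@modulus R)); last exact: continuous_modulus.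
  apply: continuous_comp_clim => [|u].
    by apply: continuousM_C; [exact: cont_cst|exact: continuous_expi].
  by apply: poly_lim_continuous => //; rewrite modulusM modulus_expi mulr1.
exact: exprn_continuous.
Qed.

End poisson_integral.

(** * Dilations and Poisson-weighted integrals *)

Section dilation.
Variable R : realType.
Local Notation C := (R[i]^o)%type.
Local Notation fmeas := {finite_measure set (measurableTypeR R) -> \bar R}.
Implicit Types (g : C -> C) (z w x y : C) (s t a b : R) (nu : fmeas).
Local Notation circ := (circ_space R).
Local Notation area := (area_space R).

Lemma continuous_pk_circ y (v : R) : modulus y < 1 -> continuous (fun u : R => pk (y * expi u) v).
Proof.
move=> y1; have ye u : modulus (y * expi u) < 1 by rewrite modulusM modulus_expi mulr1.
have -> : (fun u => pk (y * expi u) v) = fun u => Re ((expi v + y * expi u) / (expi v - y * expi u)).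
  by apply/funext => u; rewrite pk_Re.
have cy : continuous (fun u : R => y * expi u : C) by apply: continuousM_C; [exact: cont_cst|exact: continuous_expi].
apply: Re_cont; apply: continuousM_C; first by apply: continuousD_C; [exact: cont_cst|exact: cy].
apply: continuousV_C => [u|]; first exact: expi_subr_neq0.
by apply: continuousD_C; [exact: cont_cst|exact: continuousN_C cy].
Qed.

(* Bound [|g|^2] at [t x e^(iu)] by Poisson-Jensen, exchange the integrals, and use that
   the kernel [pk (y w) v] is harmonic in [w]. *)
Lemma circ_dilation g x y t (v : R) : poly_lim g -> modulus x < 1 -> modulus y < 1 -> 0 <= t < 1 ->
  (mean (S := circ) (fun u => (modulus (g (t%:C * (x * expi u))) ^+ 2 * pk (y * expi u) v)%:E) <=
   mean (S := circ) (fun u => (modulus (g (x * expi u)) ^+ 2 * pk (t%:C * (y * expi u)) v)%:E))%E.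
Proof.
move=> hg x1 y1 /andP[t0 t1].
have te u : modulus (t%:C * expi u) < 1 by rewrite modulus_rexpi ger0_norm.
have ye u : modulus (y * expi u) < 1 by rewrite modulusM modulus_expi mulr1.
have xe u : modulus (x * expi u) < 1 by rewrite modulusM modulus_expi mulr1.
have p0 z u : modulus z < 1 -> 0 <= pk z u by move=> z1; rewrite ltW // pk_gt0.
pose F (p : R * R) := (modulus (g (x * expi p.2)) ^+ 2 * pk (t%:C * expi p.1) p.2 * pk (y * expi p.1) v)%:E.
have F0 u u' : (0 <= F (u, u'))%E.
  by rewrite lee_fin; apply: mulr_ge0; [apply: mulr_ge0; [exact: sqr_ge0|exact: p0]|exact: p0].
have cmp1 (k : C) : cmeas (dom (mprod circ circ)) (fun p => k * expi p.1).
  by apply: cmeasM; [exact: cmeas_cst|apply: cmeas_expi; apply: measurable_funTS; exact: measurable_fst].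
have cmp2 (k : C) : cmeas (dom (mprod circ circ)) (fun p => k * expi p.2).
  by apply: cmeasM; [exact: cmeas_cst|apply: cmeas_expi; apply: measurable_funTS; exact: measurable_snd].
have mF : measurable_fun (dom (mprod circ circ)) F.
  apply/measurable_EFinP; apply: measurable_funM; last by apply: measurable_pk; [exact: cmp1|exact: measurable_cst].
  apply: measurable_funM.
    apply: measurable_modulus_sqr; apply: (cmeas_poly_lim hg); first exact: cmp2.
    by move=> p _; exact: xe.
  by apply: measurable_pk; [exact: cmp1|apply: measurable_funTS; exact: measurable_snd].
have [rho rho1 hrho] := disc_scale x1.
have hh : hol rho (fun w => g (x * w)).
  by move=> w /hrho/(poly_lim_hol hg)[d hd]; eexists; exact: has_cderiv_scale hd.
apply: (@le_trans _ _ (mean (S := circ) (fun u => mean (S := circ) (fun u' => F (u, u'))))).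
  apply: mean_le => u _; first by rewrite lee_fin mulr_ge0 ?sqr_ge0 ?p0.
  have := poisson_jensen hh rho1 (te u); rewrite mulrCA => h.
  have c1 : continuous (fun u' => modulus (g (x * expi u')) ^+ 2 * pk (t%:C * expi u) u').
    by move=> u'; apply: cvgM; [exact: (poly_lim_circle hg x1)|exact: (continuous_pk (te u))].
  rewrite (_ : mean _ = (avgR (fun u' => pk (y * expi u) v * (modulus (g (x * expi u')) ^+ 2 * pk (t%:C * expi u) u')))%:E).
    by rewrite avgR_Z // lee_fin mulrC ler_wpM2l // p0.
  rewrite -circ_avgR; last 2 first.
  - by move=> u'; apply: cvgM; [exact: cvg_cst|exact: c1].
  - by move=> u'; apply: mulr_ge0; [|apply: mulr_ge0]; rewrite ?sqr_ge0 ?p0.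
  by apply: eq_mean => u' _; rewrite /F /= mulrC.
rewrite (mean_swap (S := circ) (T := circ) mF (fun u u' _ _ => F0 u u')).
apply: mean_le => u _; first by apply: mean_ge0.
have c2 : continuous (fun u' => pk (y * expi u') v).
  exact: continuous_pk_circ.
rewrite (_ : mean _ = (avgR (fun u' => modulus (g (x * expi u)) ^+ 2 * (pk (y * expi u') v * pk (t%:C * expi u) u')))%:E).
  rewrite avgR_Z; last by move=> u'; apply: cvgM; [exact: c2|exact: (continuous_pk (te u))].
  by rewrite pk_harmonic // [y * _]mulrCA.
rewrite -circ_avgR; last 2 first.
- move=> u'; apply: cvgM; first exact: cvg_cst.
  by apply: cvgM; [exact: c2|exact: (continuous_pk (te u))].
- by move=> u'; apply: mulr_ge0; [|apply: mulr_ge0]; rewrite ?sqr_ge0 ?p0.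
by apply: eq_mean => u' _; rewrite /F /= [in LHS]pk_sym -mulrA; congr ((_ * _)%:E); rewrite mulrC.
Qed.

(** At y = 0 the kernel in [circ_dilation] is identically 1, which leaves the classical growth of
    circle means with the radius. *)
Lemma circ_monotone g x t : poly_lim g -> modulus x < 1 -> 0 <= t <= 1 ->
  (mean (S := circ) (fun u => (modulus (g (t%:C * (x * expi u))) ^+ 2)%:E) <=
   mean (S := circ) (fun u => (modulus (g (x * expi u)) ^+ 2)%:E))%E.
Proof.
move=> hg x1 /andP[t0]; rewrite le_eqVlt => /orP[/eqP->|t1].
  by rewrite le_eqVlt; apply/orP; left; apply/eqP; apply: eq_mean => u _; rewrite mul1r.
have pk0 v : pk (0 : C) v = 1.
  by rewrite /pk Normc.normc0 expr0n /= !subr0 modulus_expi expr1n divr1.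
have := @circ_dilation g x 0 t 0 hg x1; rewrite Normc.normc0 t0 t1 => /(_ ltr01 isT).
by under eq_mean do rewrite mul0r pk0 mulr1; under [leRHS]eq_mean do rewrite mul0r mulr0 pk0 mulr1.
Qed.

Lemma weight_mean nu z (k : R) : 0 <= k -> modulus z < 1 ->
  (k * poisson nu z)%:E = mean (S := nu_space nu) (fun v => (k * pk z v)%:E).
Proof.
move=> k0 z1; under eq_mean do rewrite EFinM.
rewrite EFinM poissonE // -meanZ //.
  by move=> v _; rewrite lee_fin ltW // pk_gt0.
apply/measurable_EFinP; apply: measurable_pk; first exact: cmeas_cst.
by apply: measurable_funTS; exact: measurable_id.
Qed.

Lemma dmeas_poisson nu : dmeas (fun z => (poisson nu z)%:E).
Proof.
have h : measurable_fun (dom area) (fun p => mean (S := nu_space nu) (fun v => (pk (toC p) v)%:E)).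
  apply: (measurable_mean (S := area) (T := nu_space nu) (F := fun q => (pk (toC q.1) q.2)%:E)); last first.
    by move=> p v /discE h _; rewrite lee_fin ltW // pk_gt0.
  apply/measurable_EFinP; apply: measurable_pk; last by apply: measurable_funTS; exact: measurable_snd.
  split; apply: measurable_funTS => /=.
    by apply: measurableT_comp; [exact: measurable_fst|exact: measurable_fst].
  by apply: measurableT_comp; [exact: measurable_snd|exact: measurable_fst].
by apply: eq_measurable_fun h => p /[!inE] /discE h; rewrite poissonE.
Qed.

Lemma measurable_poisson nu d (T : measurableType d) (D : set T) (f : T -> C) : measurable D -> cmeas D f ->
  (forall p, D p -> modulus (f p) < 1) -> measurable_fun D (fun p => poisson nu (f p)).
Proof.
by move=> mD mf f1; apply/measurable_EFinP; exact: (dmeas_comp mD (dmeas_poisson nu) mf f1).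
Qed.

(** Exchanging the circle mean with the integral against [nu] reduces the weight to a single kernel
    [pk], to which [circ_dilation] applies for each angle of [nu]. *)
Lemma circ_dilation_poisson nu g z a b : poly_lim g -> modulus z < 1 -> 0 <= b < 1 -> a = b ^+ 2 ->
  (mean (S := circ) (fun u => (modulus (g (a%:C * (expi u * z))) ^+ 2 * poisson nu (expi u * z))%:E) <=
   mean (S := circ) (fun u => (modulus (g (b%:C * (expi u * z))) ^+ 2 * poisson nu (b%:C * (expi u * z)))%:E))%E.
Proof.
move=> hg z1 /andP[b0 b1] ab.
have ez u : modulus (expi u * z) < 1 by rewrite modulus_expiM.
have bz w : modulus w < 1 -> modulus (b%:C * w) < 1.
  by move=> w1; rewrite modulusM modulusC ger0_norm //; apply: le_lt_trans w1; rewrite ler_piMl ?modulus_ge0 // ltW.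
have az w : modulus w < 1 -> modulus (a%:C * w) < 1.
  by move=> w1; rewrite ab rmorphXn /= expr2 -mulrA; apply: (bz); apply: (bz).
under eq_mean => u _ do rewrite (weight_mean _ (sqr_ge0 _) (ez u)).
under [leRHS]eq_mean => u _ do rewrite (weight_mean _ (sqr_ge0 _) (bz _ (ez u))).
have mez : cmeas (dom (mprod circ (nu_space nu))) (fun p => expi p.1 * z).
  by apply: cmeasM; [apply: cmeas_expi; apply: measurable_funTS; exact: measurable_fst|exact: cmeas_cst].
have mv : measurable_fun (dom (mprod circ (nu_space nu))) snd by apply: measurable_funTS; exact: measurable_snd.
have sw (k l : C) : modulus k <= 1 -> modulus l <= 1 ->
  mean (S := circ) (fun u => mean (S := nu_space nu) (fun v => (modulus (g (k * (expi u * z))) ^+ 2 * pk (l * (expi u * z)) v)%:E)) =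
  mean (S := nu_space nu) (fun v => mean (S := circ) (fun u => (modulus (g (k * (expi u * z))) ^+ 2 * pk (l * (expi u * z)) v)%:E)).
  move=> k1 l1.
  have mu k' u : modulus k' <= 1 -> modulus (k' * (expi u * z)) < 1.
    by move=> h; rewrite modulusM; apply: le_lt_trans (ez u); rewrite ler_piMl ?modulus_ge0.
  apply: (mean_swap (S := circ) (T := nu_space nu) (F := fun p => (modulus (g (k * (expi p.1 * z))) ^+ 2 * pk (l * (expi p.1 * z)) p.2)%:E)).
    apply/measurable_EFinP; apply: measurable_funM.
      apply: measurable_modulus_sqr; apply: (cmeas_poly_lim hg); last by move=> p _; exact: mu.
      by apply: cmeasM => //; exact: cmeas_cst.
    by apply: measurable_pk => //; apply: cmeasM => //; exact: cmeas_cst.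
  by move=> u v _ _; rewrite lee_fin mulr_ge0 ?sqr_ge0 // ltW // pk_gt0 // mu.
have b1' : modulus (b%:C : C) <= 1 by rewrite modulusC ger0_norm // ltW.
have a1' : modulus (a%:C : C) <= 1 by rewrite ab modulusC ger0_norm ?sqr_ge0 // expr_le1 // ltW.
have o1 : modulus (1 : C) <= 1 by rewrite Normc.normc1.
under eq_mean => u _ do under eq_mean => v _ do rewrite -[X in pk X](mul1r (expi u * z)).
rewrite (sw _ _ a1' o1) (sw _ _ b1' b1'); apply: mean_le => v _.
  by apply: mean_ge0 => u _; rewrite lee_fin mulr_ge0 ?sqr_ge0 // ltW // pk_gt0 // mul1r.
(* Taking x = b z, y = z and t = b, the dilation by [b] of g(b .) gives b^2 = a, while the kernel is
   moved from z to b z. *)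
have h := circ_dilation v hg (bz _ z1) z1 (introT andP (conj b0 b1)).
rewrite (eq_mean (S := circ) (g := fun u => (modulus (g (b%:C * (b%:C * z * expi u))) ^+ 2 * pk (z * expi u) v)%:E)); last first.
  by move=> u _; rewrite mul1r [expi u * z]mulrC ab rmorphXn /= expr2 !mulrA.
apply: le_trans h _; rewrite le_eqVlt; apply/orP; left; apply/eqP; apply: eq_mean => u _.
by rewrite [expi u * z]mulrC !mulrA.
Qed.

(* Splitting [a = b^2], the circle inequality moves one factor [b] from [g] to the weight;
   the change of variables [z -> b z] then costs [1 / b^2 = 1 / a]. *)
Lemma area_dilation nu g a : poly_lim g -> 0 < a < 1 ->
  (a%:E * area_int (fun z => (modulus (g (a%:C * z)) ^+ 2 * poisson nu z)%:E) <=
   area_int (fun z => (modulus (g z) ^+ 2 * poisson nu z)%:E))%E.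
Proof.
move=> hg /andP[a0 a1]; pose b := Num.sqrt a.
have b0 : 0 < b by rewrite sqrtr_gt0.
have b2 : b ^+ 2 = a by rewrite sqr_sqrtr // ltW.
have b1 : b < 1 by rewrite -(@expr_lt1 _ 2) // ?b2 // ltW.
have sc s z : 0 <= s <= 1 -> modulus z < 1 -> modulus (s%:C * z) < 1.
  move=> /andP[s0 s1] z1; rewrite modulusM modulusC ger0_norm //.
  by apply: le_lt_trans z1; rewrite ler_piMl ?modulus_ge0.
have ha : 0 <= a <= 1 by rewrite !ltW.
have hb : 0 <= b <= 1 by rewrite !ltW.
have h1 : 0 <= (1 : R) <= 1 by apply/andP; split; [exact: ler01|exact: lexx].
have nn s s' : 0 <= s <= 1 -> 0 <= s' <= 1 -> forall z, modulus z < 1 ->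
    (0 <= (modulus (g (s%:C * z)) ^+ 2 * poisson nu (s'%:C * z))%:E)%E.
  by move=> hs hs' z z1; rewrite lee_fin mulr_ge0 ?sqr_ge0 // poisson_ge0 // sc.
have dm s s' : 0 <= s <= 1 -> 0 <= s' <= 1 ->
    dmeas (fun z => (modulus (g (s%:C * z)) ^+ 2 * poisson nu (s'%:C * z))%:E).
  move=> hs hs'; apply/measurable_EFinP.
  have mc (k : C) : cmeas (@disc R) (fun p => k * toC p) by apply: cmeasM; [exact: cmeas_cst|exact: cmeas_toC].
  apply: measurable_funM.
    by apply: measurable_modulus_sqr; apply: (cmeas_poly_lim hg) (mc _) _ => p /discE h; exact: sc.
  by apply: measurable_poisson; [exact: measurable_disc|exact: mc|move=> p /discE h; exact: sc].
pose H z := (modulus (g (1%:C * z)) ^+ 2 * poisson nu (1%:C * z))%:E.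
rewrite (_ : area_int (fun z => (modulus (g z) ^+ 2 * poisson nu z)%:E) = area_int H); last first.
  by congr area_int; apply/funext => z; rewrite /H mul1r.
have hb' : 0 < b <= 1 by rewrite b0 ltW.
apply: le_trans (area_scale hb' (dm _ _ h1 h1) (nn _ _ h1 h1)); rewrite b2.
apply: lee_wpmul2l; first by rewrite lee_fin ltW.
have dma := dm _ _ ha h1; have dmb := dm _ _ hb hb.
rewrite (_ : area_int (fun z => (modulus (g (a%:C * z)) ^+ 2 * poisson nu z)%:E) =
  area_int (fun z => (modulus (g (a%:C * z)) ^+ 2 * poisson nu (1%:C * z))%:E)); last first.
  by congr area_int; apply/funext => z; rewrite mul1r.
rewrite (area_circ dma (nn _ _ ha h1)).
rewrite (_ : area_int (fun z => H (b%:C * z)) = area_int (fun z => (modulus (g (b%:C * z)) ^+ 2 * poisson nu (b%:C * z))%:E)); last first.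
  by congr area_int; apply/funext => z; rewrite /H !mul1r.
rewrite (area_circ dmb (nn _ _ hb hb)).
apply: area_le => z z1.
  by apply: mean_ge0 => u _; apply: nn => //; rewrite modulus_expiM.
under eq_mean => u _ do rewrite mul1r.
by apply: circ_dilation_poisson; rewrite ?(ltW b0) ?b2.
Qed.

(** Each kernel has mean 1 over rotations of [z], so the circle means of the Poisson integral equal
    the constant [k], the total mass on the arc divided by 2 pi. *)
Lemma area_poisson_lty nu : (area_int (fun z => (poisson nu z)%:E) < +oo)%E.
Proof.
rewrite (area_circ (dmeas_poisson nu)); last by move=> z z1; rewrite lee_fin poisson_ge0.
pose k := mean (S := nu_space nu) (fun=> 1%E).
have k0 : (0 <= k)%E by apply: mean_ge0.
have kf : k \is a fin_num.
  rewrite ge0_fin_numE // /k /mean /= integral_cst ?mul1e; last exact: measurable_arc.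
  have fn : nu (@arc R) \is a fin_num by apply: fin_num_measure; exact: measurable_arc.
  rewrite [X in (_ * X)%E](_ : _ = (fine (nu (@arc R)))%:E); last by rewrite fineK.
  by rewrite -EFinM ltry.
apply: (@le_lt_trans _ _ ((fine k)%:E * area_int (fun _ : C => 1%E))%E); last first.
  have h := area_lt_pinfty R.
  have g0 : (0 <= area_int (fun _ : C => 1%E))%E by apply: area_ge0.
  have gf : area_int (fun _ : C => 1%E) \is a fin_num by rewrite ge0_fin_numE.
  by rewrite -(fineK gf) -EFinM ltry.
rewrite !area_intE -meanZ ?fine_ge0 //.
apply: mean_le => p /discE z1; first by apply: mean_ge0 => u _; rewrite lee_fin poisson_ge0 // modulus_expiM.
rewrite mule1 fineK //.
under eq_mean => u _ do rewrite poissonE ?modulus_expiM //.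
rewrite (mean_swap (S := circ) (T := nu_space nu) (F := fun q => (pk (expi q.1 * toC p) q.2)%:E)); last 2 first.
- apply/measurable_EFinP; apply: measurable_pk; last by apply: measurable_funTS; exact: measurable_snd.
  by apply: cmeasM; [apply: cmeas_expi; apply: measurable_funTS; exact: measurable_fst|exact: cmeas_cst].
- by move=> u v _ _; rewrite lee_fin ltW // pk_gt0 // modulus_expiM.
apply: mean_le => v _.
  by apply: mean_ge0 => u _; rewrite lee_fin ltW // pk_gt0 // modulus_expiM.
rewrite circ_avgR; last 2 first.
- have -> : (fun u => pk (expi u * toC p) v) = fun u => pk (toC p * expi u) v by apply/funext => u; rewrite mulrC.
  exact: continuous_pk_circ.
- by move=> u; rewrite ltW // pk_gt0 // modulus_expiM.
rewrite -(avg_pk_sym v z1) lee_fin le_eqVlt; apply/orP; left; apply/eqP; congr avgR.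
by apply/funext => u; rewrite mulrC.
Qed.

End dilation.

(** * Hardy norms against weighted area integrals *)

Section parseval.
Variable R : realType.
Local Notation C := (R[i]^o)%type.
Local Notation leb := (@lebesgue_measure R).
Implicit Types (z w x y : C) (s t a b : R) (p q : {poly C}).
Local Notation circ := (circ_space R).
Local Notation area := (area_space R).

Lemma poly_lim_poly p : poly_lim (fun z => p.[z]).
Proof. by move=> r e _ e0; exists p => z _; rewrite subrr Normc.normc0 ltW. Qed.

Lemma continuous_poly_circ p x : continuous (fun u : R => p.[x * expi u]).
Proof.
apply: (continuous_comp_clim (G := fun w => p.[w])) => [|u].
  by apply: continuousM_C; [exact: cont_cst|exact: continuous_expi].
exact: has_cderiv_continuous (has_cderiv_poly _ _).
Qed.

(** Induction on p X + c: on the circle the cross term between c and w p(w) has mean zero, as w p(w)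
    is holomorphic and vanishes at 0. The threshold [N0] lets several polynomials share one
    summation range. *)
Lemma parseval p : exists N0 : nat, forall x (N : nat), (N0 <= N)%N ->
  avgR (fun u => modulus p.[x * expi u] ^+ 2) = \sum_(i < N) modulus p`_i ^+ 2 * modulus x ^+ i.*2.
Proof.
elim/poly_ind: p => [|p c [N0 IH]].
  exists 0%N => x N _; rewrite big1 => [|i _]; last by rewrite coef0 Normc.normc0 expr0n mul0r.
  rewrite /avgR (_ : (fun u => _) = fun=> 0); last by apply/funext => u; rewrite horner0 Normc.normc0 expr0n.
  by rewrite Rintegral_cst // mul0r mulr0.
exists N0.+1 => x -[//|N]; rewrite ltnS => /(IH x) {}IH.
rewrite big_ord_recl /= expr0 mulr1 coefD coefMX coefC /= add0r.
under eq_bigr => i _ do rewrite coefD coefMX coefC /= addr0.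
pose h w := x * w * p.[x * w].
have cp := @continuous_poly_circ p x.
have ch : continuous (fun u => h (expi u)).
  apply: continuousM_C; last exact: cp.
  by apply: continuousM_C; [exact: cont_cst|exact: continuous_expi].
have h0 : avg (fun u => h (expi u)) = 0.
  have hh : hol 2 h.
    move=> w _; eexists; apply: has_cderivM.
      by apply: has_cderivM; [exact: has_cderiv_cst|exact: has_cderiv_id].
    by apply: (has_cderiv_scale (G := fun w => p.[w])); exact: has_cderiv_poly.
  have m : 0 <= (1 : R) < 2 by apply/andP; split; [exact: ler01|exact: ltr1n].
  have := mean_value hh m; rewrite {2}/h mulr0 mul0r => <-.
  by apply: eq_avg => u; rewrite mul1r.
have E u : modulus (p * 'X + c%:P).[x * expi u] ^+ 2 =
    (modulus c ^+ 2 + modulus x ^+ 2 * modulus p.[x * expi u] ^+ 2) + 2 * Re (c^*%C * h (expi u)).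
  rewrite hornerMXaddC -exprMn -modulusM.
  have -> : modulus (x * p.[x * expi u]) = modulus (h (expi u)).
    by rewrite /h !modulusM modulus_expi mulr1.
  have -> : p.[x * expi u] * (x * expi u) + c = h (expi u) + c by rewrite /h mulrC.
  by rewrite !modulus_sqr; case: (h (expi u)) => a b; case: (c) => a' b' /=; ring.
rewrite (funext E).
have c0 : continuous (fun _ : R => modulus c ^+ 2) by move=> ?; exact: cvg_cst.
have c1 : continuous (fun u : R => modulus p.[x * expi u] ^+ 2).
  apply: (@cont_comp _ _ _ (fun u => modulus (p.[x * expi u])) (fun r : R => r ^+ 2)).
    exact: (@cont_comp _ _ _ (fun u => p.[x * expi u]) (@modulus R) cp (@continuous_modulus R)).
  exact: exprn_continuous.
have c2 : continuous (fun u : R => modulus x ^+ 2 * modulus p.[x * expi u] ^+ 2).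
  by move=> u; apply: cvgM; [exact: cvg_cst|exact: c1].
have cc : continuous (fun u => c^*%C * h (expi u) : C) by apply: continuousM_C; [exact: cont_cst|exact: ch].
have c3 := Re_cont cc.
rewrite avgR_D; last 2 first.
- by move=> u; apply: cvgD; [exact: c0|exact: c2].
- by move=> u; apply: cvgM; [exact: cvg_cst|exact: c3].
rewrite (avgR_D c0 c2) (avgR_Z _ c1) (avgR_Z _ c3) -Re_avg (avgZ _ ch) h0 mulr0 /= mulr0 addr0 IH.
congr (_ + _); last first.
  rewrite mulr_sumr; apply: eq_bigr => i _.
  have -> : (bump 0 i).*2 = (i.*2 + 2)%N by rewrite /bump /= add1n doubleS addn2.
  by rewrite exprD add0n; ring.
by rewrite /avgR Rintegral_cst //= lebesgue_measure_itv /= lte_fin twopi_gt0 /= subr0 mulrCA mulVf ?mulr1 // gt_eqF // twopi_gt0.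
Qed.

Lemma bernoulli a n : 0 <= a <= 1 -> 1 - n%:R * a <= (1 - a) ^+ n.
Proof.
move=> /andP[a0 a1]; elim: n => [|n IH]; first by rewrite expr0 mul0r subr0.
rewrite exprS; apply: le_trans (_ : (1 - a) * (1 - n%:R * a) <= _); last by rewrite ler_wpM2l // subr_ge0.
have : 0 <= n%:R * a ^+ 2 by rewrite mulr_ge0 ?sqr_ge0.
by rewrite -natr1; lra.
Qed.

Lemma area_gt0 : (0 < area_int (fun _ : C => 1))%E.
Proof.
rewrite area_intE /mean /= mule_gt0 ?lte_fin ?invr_gt0 ?pi_gt0 //.
rewrite integral_cst ?mul1e; last exact: measurable_disc.
pose I : set R := `[0, 2^-1]%classic.
have mI : measurable I by exact: measurable_itv.
have hI : leb I = (2^-1)%:E.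
  by rewrite /I lebesgue_measure_itv /= lte_fin invr_gt0 ltr0n -EFinB subr0.
have E : (leb \x leb)%E (I `*` I) = (leb I * leb I)%E by exact: product_measure1E.
suff : (0 < (leb \x leb)%E (I `*` I) <= (leb \x leb)%E (@disc R))%E by case/andP => h; exact: lt_le_trans.
apply/andP; split; first by rewrite E hI -EFinM lte_fin mulr_gt0 // invr_gt0.
apply: le_measure; rewrite ?inE; [exact: measurableX|exact: measurable_disc|].
move=> [u v] [/=]; rewrite /I /= !in_itv /= => /andP[u0 u1] /andP[v0 v1]; rewrite /disc /=.
have : u ^+ 2 <= 2^-1 ^+ 2 by rewrite lerXn2r ?nnegrE // invr_ge0.
have : v ^+ 2 <= 2^-1 ^+ 2 by rewrite lerXn2r ?nnegrE // invr_ge0.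
by lra.
Qed.

Lemma area_fin_num : area_int (fun _ : C => 1)%E \is a fin_num.
Proof. by rewrite ge0_fin_numE; [exact: area_lt_pinfty|exact: ltW area_gt0]. Qed.

Lemma measurable_lt_sqr b : measurable_fun [set: R * R] (fun p : R * R => modulus (toC p) ^+ 2 < b).
Proof.
apply: measurable_fun_ltr => //; apply: measurable_modulus_sqr; exact: cmeas_toC.
Qed.

(** Scaling by the square root of [b]. The area of the unit disc stays symbolic; it enters the
    estimates as a positive finite number. *)
Lemma area_subdisc b : 0 < b <= 1 ->
  area_int (fun z => if (modulus z ^+ 2 < b)%R then 1 else 0)%E = (b%:E * area_int (fun _ : C => 1))%E.
Proof.
move=> /andP[b0 b1]; rewrite !area_intE /mean muleCA; congr (_ * _)%E => /=.
pose s := Num.sqrt b; have s0 : 0 < s by rewrite sqrtr_gt0.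
have s2 : s ^+ 2 = b by rewrite sqr_sqrtr // ltW.
pose G (p : R * R) : \bar R := (if (modulus (toC p) ^+ 2 < b)%R then 1 else 0)%E.
have mG : measurable_fun [set: R * R] G.
  by apply: measurable_fun_ifT => //; exact: measurable_lt_sqr.
have G0 v : (0 <= G v)%E by rewrite /G; case: ifP.
rewrite integral_mkcond; transitivity (\int[leb \x leb]_p G p)%E.
  apply: eq_integral => p _; rewrite patchE; case: ifPn => // pD; rewrite /G ifF //.
  apply/negP => h; move: pD; rewrite notin_setE; apply; apply/discE.
  by rewrite -(@expr_lt1 _ 2) ?modulus_ge0 // (lt_le_trans h).
rewrite -(integral_scale2 s0 mG G0) s2; congr (_ * _)%E; rewrite [RHS]integral_mkcond.
apply: eq_integral => -[u v] _; rewrite patchE /G /=.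
have -> : toC (s * u, s * v) = s%:C * toC (u, v).
  by rewrite /toC; apply/eqP; rewrite eq_complex /= !mul0r subr0 addr0 !eqxx.
rewrite modulusM modulusC exprMn real_normK ?num_real // s2 gtr_pMr //.
congr (if _ then _ else _); apply/idP/idP; rewrite inE.
  by rewrite expr_lt1 ?modulus_ge0 // => /discE.
by move=> /discE h; rewrite expr_lt1 ?modulus_ge0.
Qed.

Lemma mean_sum (S : mspace R) (f : nat -> pt S -> \bar R) (N : nat) :
  (forall i v, dom S v -> 0 <= f i v)%E -> (forall i, measurable_fun (dom S) (f i)) ->
  mean (fun v => \sum_(i < N) f i v)%E = (\sum_(i < N) mean (f i))%E.
Proof.
move=> f0 mf; elim: N => [|N IH].
  rewrite big_ord0 /mean (eq_integral (fun=> 0%E)) ?integral0 ?mule0 // => x _.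
  by rewrite big_ord0.
rewrite big_ord_recr /= -IH -meanD //.
- by apply: eq_mean => x _; rewrite big_ord_recr.
- by move=> x Dx; apply: sume_ge0 => i _; exact: f0.
- by move=> v; exact: f0.
- by apply: emeasurable_sum => i; exact: mf.
Qed.

(** The squared norm of z^n for the weight 1 - |z|^2, classically 1 / ((n + 1) (n + 2)). A lower
    bound of order n^(-2) is used, matching the factor n^2 in the coefficients of a derivative. *)
Definition moment (n : nat) : \bar R :=
  area_int (fun z => ((1 - modulus z ^+ 2) * modulus z ^+ n.*2)%:E).

(* On the annulus [1 - 1/(2m) <= |z|^2 < 1 - 1/(4m)] with [m = n + 1] the integrand
   is at least [1/(8m)]; the annulus has measure proportional to [1/(4m)]. *)
Lemma moment_lower (n : nat) :
  ((32 * n.+1%:R ^+ 2)^-1%:E * area_int (fun _ : C => 1) <= moment n)%E.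
Proof.
set m : R := n.+1%:R; have m1 : 1 <= m by rewrite /m ler1n.
pose q := (4 * m)^-1.
have q0 : 0 < q by rewrite invr_gt0; lra.
have mq : m * q = 4^-1 by rewrite /q invfM mulrCA mulfV ?mulr1 // gt_eqF //; lra.
have q1 : q <= 4^-1 by rewrite /q lef_pV2 ?posrE //; lra.
pose A := 1 - 2 * q; pose B := 1 - q.
have hA : 0 < A <= 1 by rewrite /A; lra.
have hB : 0 < B <= 1 by rewrite /B; lra.
have AB : A < B by rewrite /A /B; lra.
pose chi b z : \bar R := (if (modulus z ^+ 2 < b)%R then 1 else 0)%E.
have mchi b : measurable_fun (@disc R) (fun v => chi b (toC v)).
  by apply: measurable_funTS; apply: measurable_fun_ifT => //; exact: measurable_lt_sqr.
pose F z : \bar R := ((1 - modulus z ^+ 2) * modulus z ^+ n.*2)%:E.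
have F0 z : modulus z < 1 -> (0 <= F z)%E.
  by move=> z1; rewrite lee_fin mulr_ge0 ?exprn_ge0 ?modulus_ge0 // subr_ge0 expr_le1 ?modulus_ge0 // ltW.
have mF : measurable_fun (@disc R) (fun v => F (toC v)).
  apply/measurable_EFinP; apply: measurable_funM.
    by apply: measurable_funB; [exact: measurable_cst|apply: measurable_modulus_sqr; exact: cmeas_toC].
  have -> : (fun p : R * R => modulus (toC p) ^+ n.*2) = fun v => (modulus (toC v) ^+ 2) ^+ n.
    by apply/funext => p; rewrite -exprM mul2n.
  by apply: measurable_funX; apply: measurable_modulus_sqr; exact: cmeas_toC.
pose k := q / 2; have k0 : 0 <= k by rewrite /k; lra.
have chi0 b z : (0 <= chi b z)%E by rewrite /chi; case: ifP.
(* The annulus is the difference of two discs; the inner disc is moved to the right so that no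
   extended reals are subtracted. *)
have key : (k%:E * area_int (chi B) <= moment n + k%:E * area_int (chi A))%E.
  rewrite /moment !area_intE -!meanZ //; [|exact: mchi|exact: mchi].
  rewrite -meanD //; last 3 first.
  - by move=> p /discE; exact: F0.
  - by move=> p _; rewrite mule_ge0 ?lee_fin.
  - by apply: measurable_funeM; exact: mchi.
  apply: mean_le => p /discE p1; first by rewrite mule_ge0 ?lee_fin.
  rewrite /chi; case: ifPn => [hB'|_]; last first.
    by rewrite mule0 adde_ge0 ?F0 // mule_ge0 ?lee_fin //; case: ifP.
  case: ifPn => [_|hA']; first by rewrite leeDr // F0.
  rewrite mule0 adde0 mule1 lee_fin -leNgt in hA' *.
  have -> : modulus (toC p) ^+ n.*2 = (modulus (toC p) ^+ 2) ^+ n by rewrite -exprM mul2n.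
  rewrite /k; apply: ler_pM; rewrite ?(ltW q0) ?invr_ge0 //; first by rewrite /B in hB'; lra.
  (* Bernoulli's inequality gives A^n >= 1 - 2 n q, which is at least 1 - 2 m q = 1/2. *)
  apply: (@le_trans _ _ (A ^+ n)); last by rewrite lerXn2r ?nnegrE ?sqr_ge0 // ltW; case/andP: hA.
  have h2q : 0 <= 2 * q <= 1 by lra.
  apply: le_trans (bernoulli n h2q).
  have : n%:R * (2 * q) <= m * (2 * q) by rewrite ler_wpM2r ?ler_nat //; lra.
  have : m * (2 * q) = 2 * (m * q) by ring.
  by rewrite mq; lra.
move: key; rewrite !area_subdisc // => key.
have kf := area_fin_num; rewrite -(fineK kf) in key *; set kap := fine _ in key *.
have [mf|mf] := boolP (moment n \is a fin_num); last first.
  have m0 : (0 <= moment n)%E by apply: area_ge0.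
  by rewrite ge0_fin_numE // -leNgt leye_eq in mf; rewrite (eqP mf) leey.
move: key; rewrite -(fineK mf) -!EFinM -EFinD !lee_fin; set M := fine _.
have -> : (32 * m ^+ 2)^-1 = q * q / 2 by rewrite /q; field; rewrite gt_eqF //; lra.
by rewrite /k /A /B; lra.
Qed.

End parseval.

(** * Weighted square means and norm convergence from pointwise convergence *)

Section square_means.
Variable R : realType.
Local Notation C := (R[i]^o)%type.
Variables (S : mspace R) (w : pt S -> R).
Hypothesis w0 : forall v, dom S v -> 0 <= w v.
Hypothesis mw : measurable_fun (dom S) w.
Implicit Types F G H : pt S -> C.
Local Notation meas := (cmeas (dom S)).

Definition msq F : \bar R := mean (fun v => (modulus (F v) ^+ 2 * w v)%:E).

Lemma msq_ge0 F : (0 <= msq F)%E.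
Proof. by apply: mean_ge0 => v Dv; rewrite lee_fin mulr_ge0 ?sqr_ge0 ?w0. Qed.

Let mF F : meas F -> measurable_fun (dom S) (fun v => (modulus (F v) ^+ 2 * w v)%:E).
Proof. by move=> cF; apply/measurable_EFinP; apply: measurable_funM => //; exact: measurable_modulus_sqr. Qed.

Let F0 F v : dom S v -> (0 <= (modulus (F v) ^+ 2 * w v)%:E)%E.
Proof. by move=> Dv; rewrite lee_fin mulr_ge0 ?sqr_ge0 ?w0. Qed.

Lemma eq_msq F G : (forall v, dom S v -> F v = G v) -> msq F = msq G.
Proof. by move=> FG; apply: eq_mean => v /FG ->. Qed.

Lemma msqZ (k : C) F : meas F -> msq (fun v => k * F v) = ((modulus k ^+ 2)%:E * msq F)%E.
Proof.
move=> cF; rewrite /msq -meanZ ?sqr_ge0 //; last exact: mF; last by move=> v; exact: F0.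
by apply: eq_mean => v _; rewrite modulusM exprMn -mulrA EFinM.
Qed.

Lemma modulus_parallelogram (x y : C) :
  modulus (x - y) ^+ 2 + modulus (x + y) ^+ 2 = 2 * modulus x ^+ 2 + 2 * modulus y ^+ 2.
Proof. by rewrite !modulus_sqr; case: x => a b; case: y => c d /=; ring. Qed.

Lemma msq_parallelogram F G : meas F -> meas G ->
  (msq (fun v => F v - G v)%R + msq (fun v => F v + G v)%R = 2%:E * msq F + 2%:E * msq G)%E.
Proof.
move=> cF cG; have h2 : 0 <= 2 :> R by [].
have m2 H : meas H -> measurable_fun (dom S) (fun v => 2%:E * (modulus (H v) ^+ 2 * w v)%:E)%E.
  by move=> cH; apply: measurable_funeM; exact: mF.
have n2 H v : dom S v -> (0 <= 2%:E * (modulus (H v) ^+ 2 * w v)%:E)%E.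
  by move=> Dv; apply: mule_ge0; [rewrite lee_fin|exact: F0].
rewrite /msq -(meanZ h2 (F0 F) (mF cF)) -(meanZ h2 (F0 G) (mF cG)).
rewrite -(meanD (n2 F) (n2 G) (m2 F cF) (m2 G cG)).
rewrite -(meanD (F0 (fun v => F v - G v)) (F0 (fun v => F v + G v)) (mF (cmeasB cF cG)) (mF (cmeasD cF cG))).
apply: eq_mean => v _; rewrite -!EFinM -!EFinD; congr (_%:E).
by rewrite -mulrDl modulus_parallelogram; ring.
Qed.

(** Pointwise |F|^2 <= 2 |G|^2 + 2 |F - G|^2. It lets a uniform error be paid for by the total
    weight. *)
Lemma msq_approx F G e : meas G -> 0 <= e -> (forall v, dom S v -> modulus (F v - G v) <= e) ->
  (msq F <= 2%:E * msq G + (2 * e ^+ 2)%:E * mean (fun v => (w v)%:E))%E.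
Proof.
move=> cG e0 FG; have h2 : 0 <= 2 :> R by [].
have he : 0 <= 2 * e ^+ 2 by rewrite mulr_ge0 ?sqr_ge0.
have w0' v : dom S v -> (0 <= (w v)%:E)%E by move=> Dv; rewrite lee_fin w0.
have mw' : measurable_fun (dom S) (fun v => (w v)%:E) by apply/measurable_EFinP.
rewrite /msq -(meanZ h2 (F0 G) (mF cG)) -(meanZ he w0' mw') -meanD.
- apply: mean_le => v Dv; first exact: F0.
  rewrite -!EFinM -EFinD lee_fin mulrA -mulrDl ler_wpM2r ?w0 //.
  have := modulus_parallelogram (F v - G v) (G v); rewrite subrK.
  have : modulus (F v - G v) ^+ 2 <= e ^+ 2 by rewrite lerXn2r ?nnegrE ?modulus_ge0 // FG.
  have := sqr_ge0 (modulus (F v - G v - G v)).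
  lra.
- by move=> v Dv; apply: mule_ge0; [rewrite lee_fin|exact: F0].
- by move=> v Dv; apply: mule_ge0; [rewrite lee_fin|exact: w0'].
- by apply: measurable_funeM; exact: mF.
- by apply: measurable_funeM.
Qed.

Lemma lt_limn_einf (u : (\bar R)^nat) (c : \bar R) : (c < limn_einf u)%E -> \forall n \near \oo, (c < u n)%E.
Proof.
rewrite limn_einf_lim (cvg_lim _ (@cvg_einfs_sup _ u)) // => /ereal_sup_gt[_ [N _ <-] hN].
exists N => // n Nn; apply: lt_le_trans hN _.
by apply: ereal_inf_lbound; exists n.
Qed.

Lemma modulus_sqr_cvg (a : nat -> C) (b : C) : (forall e : R, 0 < e -> \forall n \near \oo, modulus (b - a n) <= e) ->
  (fun n => modulus (a n) ^+ 2) @ \oo --> modulus b ^+ 2.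
Proof.
move=> ab; have h : (fun n => modulus (a n)) @ \oo --> modulus b.
  apply/cvgrPdist_le => e e0; near=> n.
  have {}h : modulus (b - a n) <= e by near: n; exact: ab.
  apply: le_trans h; rewrite ler_norml modulusB_ge andbT lerNl opprB modulusB.
  exact: modulusB_ge.
by rewrite expr2; under eq_fun do rewrite expr2; exact: cvgM.
Unshelve. all: by end_near. Qed.

(* The parallelogram law reduces this to Fatou's lemma for [F + G_n]. *)
Theorem radon_riesz F (G_ : nat -> pt S -> C) : meas F -> (forall n, meas (G_ n)) ->
  (forall v, dom S v -> forall e : R, 0 < e -> \forall n \near \oo, modulus (F v - G_ n v) <= e) ->
  (forall n, msq (G_ n) <= msq F)%E -> (msq F < +oo)%E ->
  forall d : R, 0 < d -> \forall n \near \oo, (msq (fun v => F v - G_ n v)%R <= d%:E)%E.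
Proof.
move=> cF cG GF nG fF d d0.
have fin0 : msq F \is a fin_num by rewrite ge0_fin_numE // msq_ge0.
have E4 : msq (fun v => F v + F v) = (4%:E * msq F)%E.
  rewrite (_ : (4%:E : \bar R) = (modulus (2 : C) ^+ 2)%:E).
    by rewrite -msqZ //; apply: eq_msq => v _; rewrite mulr_natl mulr2n.
  have -> : (2 : C) = (2 : R)%:C by rewrite rmorph_nat.
  by rewrite modulusC ger0_norm //; congr (_%:E); ring.
have fat : (msq (fun v => F v + F v)%R <= limn_einf (fun n => msq (fun v => F v + G_ n v)%R))%E.
  apply: (mean_fatou (f := fun n v => (modulus (F v + G_ n v) ^+ 2 * w v)%:E)) => [n v|n|v Dv].
    exact: (F0 (fun v => F v + G_ n v)).
    by apply: mF; exact: cmeasD.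
  apply: cvg_EFin; first by near=> n.
  apply: cvgM; last exact: cvg_cst.
  apply: modulus_sqr_cvg => e e0; have [N _ hN] := GF v Dv e e0; exists N => // n /hN /=.
  by rewrite opprD addrACA subrr add0r.
(* With m the square mean of [F], the means of F + G_n eventually exceed 4 m - d. The parallelogram
   law then leaves at most 2 m + 2 m - (4 m - d) = d for F - G_n. *)
have {}fat : ((4 * fine (msq F) - d)%:E < limn_einf (fun n => msq (fun v => F v + G_ n v)%R))%E.
  apply: lt_le_trans fat; rewrite E4 -(fineK fin0) -EFinM lte_fin ltrBlDr ltrDl //.
have := lt_limn_einf fat; apply: filterS => n h.
have := msq_parallelogram cF (cG n); have := nG n.
have := msq_ge0 (fun v => F v - G_ n v); move: h.
have := msq_ge0 (G_ n).
move: (msq (fun v => F v - G_ n v)) (msq (fun v => F v + G_ n v)) (msq (G_ n)) => X Y Z.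
rewrite -(fineK fin0) /=; move: (fine _) => m.
move: X Y Z => [X| |] [Y| |] [Z| |] //=; rewrite ?leey //.
rewrite -!EFinM -!EFinD !lee_fin lte_fin => Z0 h X0 h' [h''].
by lra.
Unshelve. all: by end_near. Qed.

End square_means.

(** * Circle means bounded by Poisson-weighted integrals of the derivative *)

Section hardy_bound.
Variable R : realType.
Local Notation C := (R[i]^o)%type.
Local Notation fmeas := {finite_measure set (measurableTypeR R) -> \bar R}.
Implicit Types (g : C -> C) (z w x y : C) (s t a b : R) (nu : fmeas) (p q : {poly C}).
Local Notation circ := (circ_space R).
Local Notation area := (area_space R).

Definition poisson_w nu : pt area -> R := fun v => poisson nu (toC v).

Lemma poisson_w_ge0 nu v : dom area v -> 0 <= poisson_w nu v.
Proof. by move=> /discE; exact: poisson_ge0. Qed.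

Lemma measurable_poisson_w nu : measurable_fun (dom area) (poisson_w nu).
Proof. by apply: measurable_poisson; [exact: measurable_disc|exact: cmeas_toC|move=> v /discE]. Qed.

Lemma modulus_natr (n : nat) : modulus (n%:R : C) = n%:R.
Proof.
have -> : (n%:R : C) = (n%:R : R)%:C by rewrite rmorph_nat.
by rewrite modulusC ger0_norm.
Qed.

(* Parseval: the area integral of [|p'|^2 (1 - |z|^2)] is [sum n^2 |p_n|^2 moment (n - 1)]
   with [moment (n - 1) >= c / n^2], and the weight dominates [1 - |z|^2]. *)
Lemma hardy_poly nu : nu (@arc R) != 0%E -> exists2 K : R, 0 < K & forall p x, modulus x <= 1 ->
  ((avgR (fun u => modulus p.[x * expi u] ^+ 2))%:E <=
   K%:E * ((modulus p.[0] ^+ 2)%:E + msq (poisson_w nu) (fun v => p^`().[toC v])))%E.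
Proof.
move=> /poisson_lower[c c0 hc]; pose kap := fine (area_int (fun _ : C => 1%E)).
have kapE : area_int (fun _ : C => 1%E) = kap%:E by rewrite /kap fineK // area_fin_num.
have kap0 : 0 < kap by rewrite -lte_fin -kapE area_gt0.
(* The inverse of the product of [c], from the lower bound of the weight, and kap / 32, from
   [moment_lower]; its n^2 cancels the one in the coefficients of the derivative. *)
pose K0 := 32 / (c * kap); have K00 : 0 < K0 by rewrite divr_gt0 // mulr_gt0.
exists (1 + K0) => [|p x x1]; first by rewrite addr_gt0.
have [N0 h0] := parseval p; have [N1 h1] := parseval p^`().
pose N := maxn N0 N1.
have {}h0 := h0 x N.+1 (leq_trans (leq_maxl _ _) (leqnSn _)).
have {}h1 y := h1 y N (leq_maxr _ _).
pose Q := \sum_(i < N) modulus p`_i.+1 ^+ 2.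
have up : avgR (fun u => modulus p.[x * expi u] ^+ 2) <= modulus p.[0] ^+ 2 + Q.
  rewrite h0 big_ord_recl /= expr0 mulr1 horner_coef0 lerD2l; apply: ler_sum => i _.
  by rewrite /bump /= add1n ler_piMr ?sqr_ge0 // exprn_ile1 // modulus_ge0.
have lo : ((c * kap / 32 * Q)%:E <= msq (poisson_w nu) (fun v => p^`().[toC v]))%E.
  pose F z : \bar R := (c * (1 - modulus z ^+ 2) * modulus p^`().[z] ^+ 2)%:E.
  have F0 z : modulus z < 1 -> (0 <= F z)%E.
    move=> z1; rewrite lee_fin mulr_ge0 ?sqr_ge0 // mulr_ge0 ?(ltW c0) //.
    by rewrite subr_ge0 expr_le1 ?modulus_ge0 ?ltW.
  have mF : dmeas F.
    apply/measurable_EFinP; apply: measurable_funM.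
      apply: measurable_funM => //; apply: measurable_funB => //.
      by apply: measurable_modulus_sqr; exact: cmeas_toC.
    by apply: measurable_modulus_sqr; apply: cmeas_horner; exact: cmeas_toC.
  apply: (@le_trans _ _ (area_int F)); last first.
    rewrite area_intE; apply: mean_le => v /discE v1; first exact: F0.
    by rewrite lee_fin mulrC ler_wpM2l ?sqr_ge0 // hc.
  rewrite (area_circ mF F0) area_intE.
  rewrite (eq_mean (S := area) (g := fun v => (\sum_(i < N) (c * modulus p^`()`_i ^+ 2)%:E *
      ((1 - modulus (toC v) ^+ 2) * modulus (toC v) ^+ i.*2)%:E)%E)); last first.
    move=> v /discE v1.
    pose k := c * (1 - modulus (toC v) ^+ 2).
    have k0 : 0 <= k by rewrite mulr_ge0 ?(ltW c0) // subr_ge0 expr_le1 ?modulus_ge0 ?ltW.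
    have c1 : continuous (fun u => modulus p^`().[toC v * expi u] ^+ 2).
      exact: (poly_lim_circle (@poly_lim_poly R p^`()) v1).
    transitivity ((avgR (fun u => k * modulus p^`().[toC v * expi u] ^+ 2))%:E).
      rewrite -circ_avgR => [|u|u]; last 2 first.
      - by apply: cvgM; [exact: cvg_cst|exact: c1].
      - by rewrite mulr_ge0 ?sqr_ge0.
      by apply: eq_mean => u _; rewrite /F modulus_expiM [expi u * _]mulrC.
    rewrite (avgR_Z _ c1) h1 mulr_sumr -sumEFin; apply: eq_bigr => i _.
    by rewrite -EFinM /k; congr (_%:E); ring.
  have m0 (i : nat) v : dom area v -> (0 <= ((1 - modulus (toC v) ^+ 2) * modulus (toC v) ^+ i.*2)%:E)%E.
    move=> /discE v1; rewrite lee_fin mulr_ge0 ?exprn_ge0 ?modulus_ge0 //.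
    by rewrite subr_ge0 expr_le1 ?modulus_ge0 ?ltW.
  have mm (i : nat) : measurable_fun (dom area) (fun v => ((1 - modulus (toC v) ^+ 2) * modulus (toC v) ^+ i.*2)%:E).
    apply/measurable_EFinP; apply: measurable_funM.
      by apply: measurable_funB; [exact: measurable_cst|apply: measurable_modulus_sqr; exact: cmeas_toC].
    rewrite (_ : (fun v : pt area => _) = fun v : pt area => (modulus (toC v) ^+ 2) ^+ i); last first.
      by apply/funext => v; rewrite -exprM mul2n.
    by apply: measurable_funX; apply: measurable_modulus_sqr; exact: cmeas_toC.
  have ci (i : nat) : 0 <= c * modulus p^`()`_i ^+ 2 by rewrite mulr_ge0 ?sqr_ge0 // ltW.
  rewrite (mean_sum (S := area) (f := fun i v => ((c * modulus p^`()`_i ^+ 2)%:E *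
      ((1 - modulus (toC v) ^+ 2) * modulus (toC v) ^+ i.*2)%:E)%E)); last 2 first.
  - by move=> i v Dv; apply: mule_ge0; [rewrite lee_fin|exact: m0].
  - by move=> i; apply: measurable_funeM; exact: mm.
  rewrite /Q mulr_sumr -sumEFin; apply: lee_sum => i _.
  rewrite (meanZ (ci i) (m0 i) (mm i)).
  have := moment_lower R i; rewrite kapE -EFinM => h.
  apply: le_trans (lee_wpmul2l _ h); last by rewrite lee_fin.
  have -> : modulus p^`()`_i = i.+1%:R * modulus p`_i.+1.
    by rewrite coef_deriv -[_ *+ _]mulr_natl modulusM modulus_natr.
  rewrite -EFinM lee_fin exprMn.
  rewrite le_eqVlt; apply/orP; left; apply/eqP.
  by field; rewrite nat1r pnatr_eq0.
move: lo; have := msq_ge0 (poisson_w_ge0 nu) (fun v => p^`().[toC v]).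
case: (msq _ _) => [A| |] // A0 lo; last by rewrite addey // gt0_muley ?leey // lte_fin addr_gt0.
rewrite -EFinD -EFinM !lee_fin in A0 lo *; apply: (le_trans up).
have : Q <= K0 * A.
  have -> : Q = K0 * (c * kap / 32 * Q) by rewrite /K0; field; rewrite !gt_eqF.
  by rewrite ler_wpM2l // ltW.
have := sqr_ge0 (modulus p.[0]); move: (modulus p.[0] ^+ 2) => B B0 hQ.
have : 0 <= K0 * B by rewrite mulr_ge0 // ltW.
rewrite mulrDl mul1r mulrDr; lra.
Qed.

(** Couples a function with its derivative through common approximants, so that an inequality
    relating [p] to its derivative can pass to the limit. *)
Definition poly_lim1 g g' := forall r e : R, r < 1 -> 0 < e ->
  exists p, forall z, modulus z <= r -> modulus (g z - p.[z]) <= e /\ modulus (g' z - p^`().[z]) <= e.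

Lemma poly_lim1_fst g g' : poly_lim1 g g' -> poly_lim g.
Proof. by move=> h r e r1 e0; have [p hp] := h r e r1 e0; exists p => z /hp[]. Qed.

Lemma poly_lim1_snd g g' : poly_lim1 g g' -> poly_lim g'.
Proof. by move=> h r e r1 e0; have [p hp] := h r e r1 e0; exists p^`() => z /hp[]. Qed.

(** Approximation by [p] holds only on a disc of radius a < 1, while the weighted integral runs over
    the whole disc. Hence [hardy_poly] is applied to p(a z) at the point x / a, and the integral of
    |a g'(a z)|^2 is brought back to that of |g'|^2 by [area_dilation]. *)
Lemma hardy_bound nu : nu (@arc R) != 0%E -> exists2 K : R, 0 < K & forall g g' x, poly_lim1 g g' ->
  modulus x < 1 ->
  (mean (S := circ) (fun u => (modulus (g (x * expi u)) ^+ 2)%:E) <=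
   K%:E * ((modulus (g 0) ^+ 2)%:E + msq (poisson_w nu) (fun v => g' (toC v))))%E.
Proof.
move=> /hardy_poly[K K0 hK]; exists (4 * K) => [|g g' x gg' x1]; first by rewrite mulr_gt0.
have hg := poly_lim1_fst gg'; have hg' := poly_lim1_snd gg'.
have w0 := poisson_w_ge0 nu; have mw := @measurable_poisson_w nu.
have A0 := msq_ge0 w0 (fun v => g' (toC v)).
have [Af|] := boolP (msq (poisson_w nu) (fun v => g' (toC v)) \is a fin_num); last first.
  by rewrite ge0_fin_numE // -leNgt leye_eq => /eqP ->; rewrite addey // gt0_muley ?leey // lte_fin mulr_gt0.
have wE : exists om : R, mean (S := area) (fun v => (poisson_w nu v)%:E) = om%:E /\ 0 <= om.
  have o0 : (0 <= mean (S := area) (fun v => (poisson_w nu v)%:E))%E.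
    by apply: mean_ge0 => v Dv; rewrite lee_fin w0.
  exists (fine (mean (S := area) (fun v => (poisson_w nu v)%:E))); rewrite fine_ge0 // fineK //.
  by rewrite ge0_fin_numE //; exact: area_poisson_lty.
have [om [omE om0]] := wE.
rewrite circ_avgR; [|exact: poly_lim_circle|by move=> u; exact: sqr_ge0].
move: A0; rewrite -(fineK Af); set A := fine _ => A0; rewrite lee_fin in A0.
rewrite -EFinD -EFinM lee_fin; apply/ler_addgt0Pl => d d0.
(* The total coefficient of e^2: 4 K from the value at the origin, 4 K om from the derivative, where
   [om] is the integral of the weight, and 2 from replacing [g] by [p] on the circle. *)
pose L := 4 * K + 4 * K * om + 2; have L0 : 0 < L.
  have : 0 <= K * om by rewrite mulr_ge0 // ltW.
  by rewrite /L -mulrA; lra.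
pose e := Num.sqrt (d / L); have e0 : 0 < e by rewrite sqrtr_gt0 divr_gt0.
have e2 : L * e ^+ 2 = d by rewrite sqr_sqrtr ?divr_ge0 ?ltW // mulrC divfK // gt_eqF.
pose a := (1 + modulus x) / 2.
have mx := modulus_ge0 x.
have xa : modulus x <= a by rewrite /a; lra.
have a0 : 0 < a by rewrite /a; lra.
have a1 : a < 1 by rewrite /a; lra.
have [p hp] := gg' a e a1 e0.
pose q := p \Po (a%:C *: 'X).
have qE z : q.[z] = p.[a%:C * z] by rewrite /q horner_comp hornerZ hornerX.
have q'E z : q^`().[z] = a%:C * p^`().[a%:C * z].
  by rewrite /q deriv_comp derivZ derivX hornerM horner_comp !hornerZ hornerX -[1]/(1%:P) hornerC mulr1 mulrC.
pose y := x / a%:C.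
have aC0 : a%:C != 0 :> C by rewrite eq_complex /= eqxx andbT gt_eqF.
have ay : a%:C * y = x by rewrite /y mulrC divfK.
have y1 : modulus y <= 1 by rewrite /y modulusM modulusV modulusC gtr0_norm // ler_pdivrMr // mul1r.
have sq2 (z z' : C) : modulus (z - z') <= e -> modulus z ^+ 2 <= 2 * modulus z' ^+ 2 + 2 * e ^+ 2.
  move=> h; have := modulus_parallelogram (z - z') z'; rewrite subrK.
  have : modulus (z - z') ^+ 2 <= e ^+ 2 by rewrite lerXn2r ?nnegrE ?modulus_ge0 // ltW.
  by have := sqr_ge0 (modulus (z - z' - z')); lra.
have xe u : modulus (x * expi u) <= a by rewrite modulusM modulus_expi mulr1.
have cg := poly_lim_circle hg x1.
have cp : continuous (fun u => modulus p.[x * expi u] ^+ 2).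
  exact: (poly_lim_circle (@poly_lim_poly R p) x1).
have step1 : avgR (fun u => modulus (g (x * expi u)) ^+ 2) <=
    2 * avgR (fun u => modulus p.[x * expi u] ^+ 2) + 2 * e ^+ 2.
  have c2 : continuous (fun u => 2 * modulus p.[x * expi u] ^+ 2).
    by move=> u; apply: cvgM; [exact: cvg_cst|exact: cp].
  have c3 : continuous (fun _ : R => 2 * e ^+ 2) by move=> ?; exact: cvg_cst.
  have -> : 2 * e ^+ 2 = avgR (fun _ : R => 2 * e ^+ 2).
    by apply: EFin_inj; rewrite -circ_avgR ?mean_circ_cst // => u; rewrite mulr_ge0 ?sqr_ge0.
  rewrite -(avgR_Z _ cp) -(avgR_D c2 c3) -lee_fin -!circ_avgR //.
  - apply: mean_le => u _; rewrite lee_fin ?sqr_ge0 //; apply: sq2.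
    by have [] := hp _ (xe u).
  - by move=> u; apply: cvgD; [exact: c2|exact: c3].
  - by move=> u; rewrite addr_ge0 // mulr_ge0 ?sqr_ge0.
  - by move=> u; exact: sqr_ge0.
have step2 := hK q y y1.
have e3 : (fun u => modulus q.[y * expi u] ^+ 2) = (fun u => modulus p.[x * expi u] ^+ 2).
  by apply/funext => u; rewrite qE mulrA ay.
rewrite e3 qE mulr0 in step2.
have z0 : modulus (0 : C) <= a by rewrite Normc.normc0 ltW.
have h00 : modulus p.[0] ^+ 2 <= 2 * modulus (g 0) ^+ 2 + 2 * e ^+ 2.
  by apply: sq2; rewrite modulusB; have [] := hp _ z0.
have cmg : cmeas (dom area) (fun v => g' (a%:C * toC v)).
  apply: (cmeas_poly_lim hg'); first by apply: cmeasM; [exact: cmeas_cst|exact: cmeas_toC].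
  move=> v /discE v1; rewrite modulusM modulusC gtr0_norm //; apply: lt_trans a1.
  by rewrite gtr_pMr.
have step3 : (msq (poisson_w nu) (fun v => q^`().[toC v]) <= (2 * A + 2 * e ^+ 2 * om)%:E)%E.
  apply: le_trans (msq_approx (e := e) w0 mw (G := fun v => a%:C * g' (a%:C * toC v)) _ (ltW e0) _) _.
  - by apply: cmeasM => //; exact: cmeas_cst.
  - move=> v /discE v1; rewrite q'E -mulrBr modulusM modulusC gtr0_norm // -[leRHS]mul1r.
    have av : modulus (a%:C * toC v) <= a by rewrite modulusM modulusC gtr0_norm // ler_piMr ?ltW.
    apply: ler_pM; [exact: ltW|exact: modulus_ge0|exact: ltW|].
    by rewrite modulusB; have [] := hp _ av.
  rewrite omE (EFinD (2 * A)) (EFinM 2 A); apply: leeD; last by rewrite -EFinM.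
  rewrite lee_wpmul2l ?lee_fin // msqZ // modulusC gtr0_norm // expr2 EFinM -muleA.
  have aa : 0 < a < 1 by rewrite a0.
  have dil := area_dilation nu hg' aa.
  apply: (@le_trans _ _ (a%:E * A%:E)%E).
    rewrite lee_wpmul2l ?lee_fin ?(ltW a0) // (le_trans dil) // /A fineK //.
  by rewrite -EFinM lee_fin ler_piMl // ltW.
have {}step2 := le_trans step2 (lee_wpmul2l (ltW K0 : (0 <= K%:E)%E) (leeD (lexx _) step3)).
rewrite -EFinD -EFinM lee_fin in step2.
apply: (le_trans step1).
have KA : 0 <= K * A by rewrite mulr_ge0 // ltW.
have hK00 : K * modulus p.[0] ^+ 2 <= K * (2 * modulus (g 0) ^+ 2 + 2 * e ^+ 2) by rewrite ler_wpM2l // ltW.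
rewrite -e2 /L; move: step2 hK00; rewrite !mulrDr !mulrDl.
move: (modulus p.[0] ^+ 2) (modulus (g 0) ^+ 2) (e ^+ 2) => P G E.
lra.
Qed.

End hardy_bound.

(** * Energy bounds on the bidisc *)

Section two_variable_bounds.
Variable R : realType.
Local Notation C := (R[i]^o)%type.
Local Notation fmeas := {finite_measure set (measurableTypeR R) -> \bar R}.
Implicit Types (f g h F G : C * C -> C) (x : C) (r s t : R) (nu : fmeas).
Local Notation circ := (circ_space R).
Local Notation area := (area_space R).

Lemma poly_lim2_lim1_slice1 f z2 : poly_lim2 f -> modulus z2 < 1 ->
  poly_lim1 (fun w => f (w, z2)) (fun w => partial1 f (w, z2)).
Proof.
move=> hf z21 r e r1 e0; have [|p hp] := @poly_lim2_approx R f (Num.max r (modulus z2)) e hf _ e0.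
  by rewrite gt_max r1.
exists (map_poly (horner_eval z2) p) => z zr; rewrite deriv_map -!ev1.
by have [||a b _ _ _] := hp z z2; rewrite ?le_max ?zr ?lexx ?orbT.
Qed.

Lemma poly_lim2_lim1_slice2 f z1 : poly_lim2 f -> modulus z1 < 1 ->
  poly_lim1 (fun w => f (z1, w)) (fun w => partial2 f (z1, w)).
Proof.
move=> hf z11 r e r1 e0; have [|p hp] := @poly_lim2_approx R f (Num.max r (modulus z1)) e hf _ e0.
  by rewrite gt_max r1.
exists (p.[z1%:P]) => z zr; rewrite -horner_deriv2.
by have [||a _ b _ _] := hp z1 z; rewrite ?le_max ?zr ?lexx ?orbT.
Qed.

Definition flip f : C * C -> C := fun z => f (z.2, z.1).

Lemma poly_lim2_flip f : poly_lim2 f -> poly_lim2 (flip f).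
Proof.
move=> hf r e r1 e0; have [p hp] := hf r e r1 e0.
exists (swapXY p) => z1 z2 h1 h2; rewrite /flip /=.
have -> : ev (swapXY p) (z1, z2) = ev p (z2, z1).
  exact: horner2_swapXY.
exact: hp.
Qed.

(** The reflection r -> -r turns a nondecreasing function near 1 from the left into a nonincreasing
    one from the right. The limits in the Dirichlet integrals thereby exist and are suprema. *)
Lemma lim_at_left_sup (phi : R -> \bar R) :
  (forall s t, 0 <= s -> s <= t -> t < 1 -> (phi s <= phi t)%E) ->
  lim (phi r @[r --> (1 : R)^'-]) = ereal_sup [set phi r | r in [set r | 0 <= r < 1]].
Proof.
move=> hphi; apply/cvg_lim => //; apply/cvg_at_leftNP.
have -> : [set phi r | r in [set r | 0 <= r < 1]] = [set (phi \o -%R) x | x in `](-1 : R), 0]].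
  apply/seteqP; split => _ [r /= hr <-].
    by exists (- r); rewrite /= ?opprK // in_itv /=; lra.
  by exists (- r) => //=; move: hr; rewrite in_itv /=; lra.
apply: (@nonincreasing_at_right_cvge R (phi \o -%R) (-1) (BRight 0)) => [|s t].
  by rewrite bnd_simp ltrN10.
rewrite !in_itv /= => hs ht st; apply: hphi; lra.
Qed.

Lemma measurable_dom_fst (S T : mspace R) (F : pt S -> R) : measurable_fun (dom S) F ->
  measurable_fun (dom (mprod S T)) (fun q => F q.1).
Proof.
move=> mF; apply: (measurable_comp (mdom S) _ mF); last by apply: measurable_funTS; exact: measurable_fst.
by move=> _ [q [q1 _] <-].
Qed.

Lemma measurable_dom_snd (S T : mspace R) (F : pt T -> R) : measurable_fun (dom T) F ->
  measurable_fun (dom (mprod S T)) (fun q => F q.2).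
Proof.
move=> mF; apply: (measurable_comp (mdom T) _ mF); last by apply: measurable_funTS; exact: measurable_snd.
by move=> _ [q [_ q2] <-].
Qed.

Lemma cmeas_snd (S T : mspace R) (a : pt T -> C) : cmeas (dom T) a -> cmeas (dom (mprod S T)) (fun q => a q.2).
Proof. by move=> [ra ia]; split; [exact: (measurable_dom_snd (S := S) ra)|exact: (measurable_dom_snd (S := S) ia)]. Qed.

Lemma cmeas_fst (S T : mspace R) (a : pt S -> C) : cmeas (dom S) a -> cmeas (dom (mprod S T)) (fun q => a q.1).
Proof. by move=> [ra ia]; split; [exact: (measurable_dom_fst (T := T) ra)|exact: (measurable_dom_fst (T := T) ia)]. Qed.

Section outer.
Variables (nu : fmeas) (K : R).
Hypothesis K0 : 0 < K.
Hypothesis hK : forall (g g' : C -> C) x, poly_lim1 g g' -> modulus x < 1 ->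
  (mean (S := circ) (fun u => (modulus (g (x * expi u)) ^+ 2)%:E) <=
   K%:E * ((modulus (g 0) ^+ 2)%:E + msq (poisson_w nu) (fun v => g' (toC v))))%E.
Variables (S : mspace R) (w : pt S -> R) (a : pt S -> C).
Hypothesis w0 : forall v, dom S v -> 0 <= w v.
Hypothesis mw : measurable_fun (dom S) w.
Hypothesis ma : cmeas (dom S) a.
Hypothesis a1 : forall v, dom S v -> modulus (a v) < 1.

(** Apply the one-variable bound to each slice F(a v, .), multiply by the weight [w v] and
    integrate. The outer space is the disc with a Poisson weight for slice means and the circle with
    weight 1 for torus means. *)
Lemma slice_hardy_bound F G x : poly_lim2 F -> poly_lim2 G ->
  (forall z, modulus z < 1 -> poly_lim1 (fun w => F (z, w)) (fun w => G (z, w))) -> modulus x < 1 ->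
  (mean (S := S) (fun v => mean (S := circ) (fun u => (modulus (F (a v, x * expi u)%R) ^+ 2 * w v)%R%:E)) <=
   K%:E * (msq w (fun v => F (a v, 0%R)) +
     msq (S := mprod S area) (fun q => w q.1 * poisson_w nu q.2)%R (fun q => G (a q.1, toC q.2))))%E.
Proof.
move=> hF hG FG x1.
have xe u : modulus (x * expi u) < 1 by rewrite modulusM modulus_expi mulr1.
have z0 : modulus (0 : C) < 1 by rewrite Normc.normc0.
have mG : measurable_fun (dom (mprod S area)) (fun q =>
    (modulus (G (a q.1, toC q.2)) ^+ 2 * (w q.1 * poisson_w nu q.2))%:E).
  apply/measurable_EFinP; apply: measurable_funM; last first.
    by apply: measurable_funM; [exact: measurable_dom_fst|apply: measurable_dom_snd; exact: measurable_poisson_w].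
  apply: measurable_modulus_sqr; apply: (cmeas_poly_lim2 hG).
  - exact: cmeas_fst.
  - by apply: (@cmeas_snd S area (@toC R)); exact: cmeas_toC.
  - by move=> q [q1 _]; exact: a1.
  - by move=> q [_ /discE].
have G0 v v' : dom S v -> dom area v' -> (0 <= (modulus (G (a v, toC v')) ^+ 2 * (w v * poisson_w nu v'))%:E)%E.
  by move=> Dv Dv'; rewrite lee_fin mulr_ge0 ?sqr_ge0 // mulr_ge0 ?w0 // poisson_w_ge0.
rewrite [X in (_ + X)%E]/msq (mean_iterated mG G0) /msq -meanD; last 4 first.
- by move=> v Dv; rewrite lee_fin mulr_ge0 ?sqr_ge0 ?w0.
- by move=> v Dv; apply: mean_ge0 => v' Dv'; exact: G0.
- apply/measurable_EFinP; apply: measurable_funM => //; apply: measurable_modulus_sqr.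
  by apply: (cmeas_poly_lim2 hF) => //; exact: cmeas_cst.
- exact: (measurable_mean mG G0).
rewrite -meanZ ?(ltW K0) //; last 2 first.
- move=> v Dv; apply: adde_ge0; first by rewrite lee_fin mulr_ge0 ?sqr_ge0 ?w0.
  by apply: mean_ge0 => v' Dv'; exact: G0.
- apply: emeasurable_funD; last exact: (measurable_mean mG G0).
  apply/measurable_EFinP; apply: measurable_funM => //; apply: measurable_modulus_sqr.
  by apply: (cmeas_poly_lim2 hF) => //; exact: cmeas_cst.
have hs v : dom S v -> poly_lim (fun z => F (a v, z)) by move=> Dv; exact: poly_lim2_slice2 hF (a1 Dv).
apply: mean_le => v Dv.
  by apply: mean_ge0 => u _; rewrite lee_fin mulr_ge0 ?sqr_ge0 ?w0.
have cmF : measurable_fun (dom circ) (fun u => (modulus (F (a v, x * expi u)) ^+ 2)%:E).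
  apply/measurable_EFinP; apply: measurable_funTS; apply: continuous_measurable_fun.
  exact: (poly_lim_circle (hs _ Dv) x1).
rewrite (eq_mean (S := circ) (g := fun u => ((w v)%:E * (modulus (F (a v, x * expi u)) ^+ 2)%:E)%E)); last first.
  by move=> u _; rewrite -EFinM mulrC.
rewrite meanZ ?w0 //; last by move=> u _; rewrite lee_fin sqr_ge0.
apply: le_trans (lee_wpmul2l _ (hK (FG _ (a1 Dv)) x1)) _; first by rewrite lee_fin w0.
rewrite muleCA lee_wpmul2l ?lee_fin ?(ltW K0) // ge0_muleDr ?lee_fin ?sqr_ge0 //; last first.
  exact: msq_ge0 (poisson_w_ge0 nu) _.
apply: leeD; first by rewrite -EFinM mulrC.
rewrite /msq -meanZ ?w0 //.
- by rewrite le_eqVlt; apply/orP; left; apply/eqP; apply: eq_mean => v' _; rewrite -EFinM mulrCA.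
- by move=> v' Dv'; rewrite lee_fin mulr_ge0 ?sqr_ge0 // poisson_w_ge0.
- apply/measurable_EFinP; apply: measurable_funM; last exact: measurable_poisson_w.
  apply: measurable_modulus_sqr; apply: (cmeas_poly_lim (poly_lim2_slice2 hG (a1 Dv))); first exact: cmeas_toC.
  by move=> v' /discE.
Qed.

End outer.

End two_variable_bounds.

(** * The energy and its comparison with the norm *)

Section energy.
Variable R : realType.
Local Notation C := (R[i]^o)%type.
Local Notation fmeas := {finite_measure set (measurableTypeR R) -> \bar R}.
Implicit Types (f g h F G : C * C -> C) (x : C) (r s t : R).
Local Notation circ := (circ_space R).
Local Notation area := (area_space R).

Lemma msq_flip (S T : mspace R) (W : pt S * pt T -> R) (F : pt S * pt T -> C) :
  (forall v v', dom S v -> dom T v' -> 0 <= W (v, v')) ->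
  measurable_fun (dom (mprod S T)) W -> cmeas (dom (mprod S T)) F ->
  msq (S := mprod S T) W F = msq (S := mprod T S) (fun q => W (q.2, q.1)) (fun q => F (q.2, q.1)).
Proof.
move=> W0 mW mF.
have N0 v v' : dom S v -> dom T v' -> (0 <= (modulus (F (v, v')) ^+ 2 * W (v, v'))%:E)%E.
  by move=> Dv Dv'; rewrite lee_fin mulr_ge0 ?sqr_ge0 ?W0.
have M : measurable_fun (dom (mprod S T)) (fun q => (modulus (F q) ^+ 2 * W q)%:E).
  by apply/measurable_EFinP; apply: measurable_funM => //; exact: measurable_modulus_sqr.
have sw : measurable_fun (dom (mprod T S)) (fun q => (q.2, q.1) : pt (mprod S T)).
  by apply: measurable_funTS; apply: measurable_fun_pair; [exact: measurable_snd|exact: measurable_fst].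
have M' : measurable_fun (dom (mprod T S)) (fun q => (modulus (F (q.2, q.1)) ^+ 2 * W (q.2, q.1))%:E).
  apply: (measurable_comp (mdom (mprod S T)) _ M sw).
  by move=> _ [q [q1 q2] <-]; split.
rewrite /msq (mean_iterated M N0) (mean_iterated M' (fun v' v Dv' Dv => N0 v v' Dv Dv')).
by rewrite (mean_swap M N0).
Qed.

Variables mu1 mu2 : fmeas.
Hypothesis n1 : mu1 (@arc R) != 0%E.
Hypothesis n2 : mu2 (@arc R) != 0%E.
Local Notation w1 := (poisson_w mu1).
Local Notation w2 := (poisson_w mu2).

Definition bidisc_w (q : pt (mprod area area)) : R := w1 q.1 * w2 q.2.

Lemma bidisc_w_ge0 q : dom (mprod area area) q -> 0 <= bidisc_w q.
Proof. by move=> [q1 q2]; rewrite mulr_ge0 // poisson_w_ge0. Qed.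

Lemma measurable_bidisc_w : measurable_fun (dom (mprod area area)) bidisc_w.
Proof.
apply: measurable_funM.
  by apply: (@measurable_dom_fst R area area w1); exact: measurable_poisson_w.
by apply: (@measurable_dom_snd R area area w2); exact: measurable_poisson_w.
Qed.

Definition toC2 (q : pt (mprod area area)) : C * C := (toC q.1, toC q.2).

Lemma cmeas_toC2 F : poly_lim2 F -> cmeas (dom (mprod area area)) (fun q => F (toC2 q)).
Proof.
move=> hF; apply: (cmeas_poly_lim2 hF).
- by apply: (@cmeas_fst R area area (@toC R)); exact: cmeas_toC.
- by apply: (@cmeas_snd R area area (@toC R)); exact: cmeas_toC.
- by move=> q [/discE].
- by move=> q [_ /discE].
Qed.

Definition mixed_sq F : \bar R := msq bidisc_w (fun q => F (toC2 q)).

Definition energy f : \bar R :=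
  ((modulus (f (0, 0)%R) ^+ 2)%:E + msq w1 (fun v => partial1 f (toC v, 0%R)) +
   msq w2 (fun v => partial2 f (0%R, toC v)) + mixed_sq (partial1 (partial2 f)))%E.

Let e1 f : (0 <= (modulus (f (0, 0)%R) ^+ 2)%:E)%E. Proof. by rewrite lee_fin sqr_ge0. Qed.
Let e2 f : (0 <= msq w1 (fun v => partial1 f (toC v, 0%R)))%E.
Proof. exact: msq_ge0 (@poisson_w_ge0 R mu1) _. Qed.
Let e3 f : (0 <= msq w2 (fun v => partial2 f (0%R, toC v)))%E.
Proof. exact: msq_ge0 (@poisson_w_ge0 R mu2) _. Qed.
Let e4 f : (0 <= mixed_sq (partial1 (partial2 f)))%E.
Proof. exact: msq_ge0 bidisc_w_ge0 _. Qed.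

Lemma energy_ge0 f : (0 <= energy f)%E.
Proof. by rewrite /energy !adde_ge0. Qed.

Let en12 f : ((modulus (f (0, 0)%R) ^+ 2)%:E + msq w1 (fun v => partial1 f (toC v, 0%R)) <= energy f)%E.
Proof. by rewrite /energy -addeA leeDl // adde_ge0. Qed.

Let en34 f : (msq w2 (fun v => partial2 f (0%R, toC v)) + mixed_sq (partial1 (partial2 f)) <= energy f)%E.
Proof. by rewrite /energy -[leRHS]addeA leeDr // adde_ge0. Qed.

Let en24 f : (msq w1 (fun v => partial1 f (toC v, 0%R)) + mixed_sq (partial1 (partial2 f)) <= energy f)%E.
Proof. by rewrite /energy leeD2r // -addeA addeCA leeDl // adde_ge0. Qed.

Definition slice_mean1 f r : \bar R := area_int (fun z1 => circle_int (fun z2 =>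
  (modulus (partial1 f (z1, z2)) ^+ 2 * poisson mu1 z1)%:E) r).

Definition slice_mean2 f r : \bar R := area_int (fun z2 => circle_int (fun z1 =>
  (modulus (partial2 f (z1, z2)) ^+ 2 * poisson mu2 z2)%:E) r).

Definition torus_mean f r : \bar R := circle_int (fun z1 => circle_int (fun z2 =>
  (modulus (f (z1, z2)) ^+ 2)%:E) r) r.

Let rC r : 0 <= r < 1 -> modulus (r%:C : C) < 1.
Proof. by move=> /andP[r0 r1]; rewrite modulusC ger0_norm. Qed.

Let disc1 v : dom area v -> modulus (toC v) < 1. Proof. by move/discE. Qed.

(** The slice bound for the first derivative in [z1] produces the mixed derivative in the opposite
    order to that of the energy, hence [poly_lim2_mixed]. *)
Lemma slice_mean1_bound : exists2 K : R, 0 < K &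
  forall f r, poly_lim2 f -> 0 <= r < 1 -> (slice_mean1 f r <= K%:E * energy f)%E.
Proof.
have [K K0 hK] := hardy_bound n2; exists K => // f r hf /rC hr.
apply: le_trans (slice_hardy_bound K0 hK (@poisson_w_ge0 R mu1) (@measurable_poisson_w R mu1)
   (@cmeas_toC R _) disc1 (poly_lim2_partial1 hf) (poly_lim2_partial2 (poly_lim2_partial1 hf)) _ hr) _.
  by move=> z z1; apply: poly_lim2_lim1_slice2 => //; exact: poly_lim2_partial1.
apply: lee_wpmul2l; first by rewrite lee_fin ltW.
rewrite (_ : msq (S := mprod area area) (fun q => w1 q.1 * w2 q.2) _ = mixed_sq (partial1 (partial2 f))); first exact: en24.
by apply: eq_msq => q [/discE q1 /discE q2]; exact: poly_lim2_mixed.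
Qed.

(** The bound on the other slice mean, read in flipped coordinates. It is stated for any admissible
    constant because the torus means reuse it with their own. *)
Let mean2_bound K : 0 < K -> (forall (g g' : C -> C) x, poly_lim1 g g' -> modulus x < 1 ->
  (mean (S := circ) (fun u => (modulus (g (x * expi u)) ^+ 2)%:E) <=
   K%:E * ((modulus (g 0) ^+ 2)%:E + msq w1 (fun v => g' (toC v))))%E) ->
  forall f r, poly_lim2 f -> 0 <= r < 1 ->
  (slice_mean2 f r <= K%:E * (msq w2 (fun v => partial2 f (0%R, toC v)) + mixed_sq (partial1 (partial2 f))))%E.
Proof.
move=> K0 hK f r hf /rC hr.
apply: le_trans (slice_hardy_bound K0 hK (@poisson_w_ge0 R mu2) (@measurable_poisson_w R mu2)
   (@cmeas_toC R _) disc1 (F := flip (partial2 f)) (G := flip (partial1 (partial2 f))) (poly_lim2_flip (poly_lim2_partial2 hf))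
   (poly_lim2_flip (poly_lim2_partial1 (poly_lim2_partial2 hf))) _ hr) _.
  by move=> z z1; apply: (poly_lim2_lim1_slice1 (f := partial2 f)) => //; exact: poly_lim2_partial2.
apply: lee_wpmul2l; first by rewrite lee_fin ltW.
rewrite /mixed_sq (msq_flip (S := area) (T := area) _ measurable_bidisc_w (cmeas_toC2 (poly_lim2_partial1 (poly_lim2_partial2 hf)))); last first.
  by move=> v v' Dv Dv'; exact: bidisc_w_ge0.
rewrite le_eqVlt; apply/orP; left; apply/eqP; congr (_ + _)%E.
by apply: eq_mean => q _; rewrite /bidisc_w /= [w2 _ * _]mulrC.
Qed.

Lemma slice_mean2_bound : exists2 K : R, 0 < K &
  forall f r, poly_lim2 f -> 0 <= r < 1 -> (slice_mean2 f r <= K%:E * energy f)%E.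
Proof.
have [K K0 hK] := hardy_bound n1; exists K => // f r hf hr.
apply: le_trans (mean2_bound K0 hK hf hr) _; apply: lee_wpmul2l; first by rewrite lee_fin ltW.
exact: en34.
Qed.

(** Bounding in [z2] first leaves a circle mean of |f(., 0)|^2 and a mean of |d2 f|^2 over circle
    times disc. The first is bounded in [z1] by the same one-variable estimate; the second is the
    slice mean [slice_mean2] with the integrations exchanged. *)
Lemma torus_mean_bound : exists2 K : R, 0 < K &
  forall f r, poly_lim2 f -> 0 <= r < 1 -> (torus_mean f r <= K%:E * energy f)%E.
Proof.
have [K1 K10 hK1] := hardy_bound n1; have [K2 K20 hK2] := hardy_bound n2.
exists (K2 * (K1 + K1)) => [|f r hf hr]; first by rewrite mulr_gt0 // addr_gt0.
have hr' := rC hr.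
have ma : cmeas (dom circ) (fun u => r%:C * expi u).
  by apply: cmeasM; [exact: cmeas_cst|apply: cmeas_expi; apply: measurable_funTS; exact: measurable_id].
have a1 u : dom circ u -> modulus (r%:C * expi u) < 1 by move=> _; rewrite modulusM modulus_expi mulr1.
have hz : modulus (0 : C) < 1 by rewrite Normc.normc0.
rewrite (_ : torus_mean f r = mean (S := circ) (fun v => mean (S := circ) (fun u =>
   (modulus (f (r%:C * expi v, r%:C * expi u)) ^+ 2 * 1)%:E))); last first.
  rewrite /torus_mean circle_intE; apply: eq_mean => v _; rewrite circle_intE.
  by apply: eq_mean => u _; rewrite mulr1.
have m1 : measurable_fun (dom circ) (fun _ : pt circ => 1 : R) by exact: measurable_cst.
have hs z : modulus z < 1 -> poly_lim1 (fun w => f (z, w)) (fun w => partial2 f (z, w)) := poly_lim2_lim1_slice2 hf.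
have H := slice_hardy_bound K20 hK2 (S := circ) (w := fun=> 1) (fun _ _ => ler01) m1 ma a1 hf (poly_lim2_partial2 hf) hs hr'.
apply: (le_trans H); clear H.
rewrite EFinM -muleA; apply: lee_wpmul2l; first by rewrite lee_fin ltW.
rewrite EFinD ge0_muleDl ?lee_fin ?(ltW K10) //; apply: leeD.
  apply: (@le_trans _ _ (mean (S := circ) (fun u => (modulus (f (r%:C * expi u, 0)) ^+ 2)%:E))).
    by rewrite le_eqVlt; apply/orP; left; apply/eqP; apply: eq_mean => u _; rewrite mulr1.
  apply: le_trans (hK1 _ _ _ (poly_lim2_lim1_slice1 hf hz) hr') _.
  by apply: lee_wpmul2l; [rewrite lee_fin ltW|exact: en12].
rewrite (msq_flip (S := circ) (T := area) (W := fun q => 1 * w2 q.2) (F := fun q => partial2 f (r%:C * expi q.1, toC q.2))); last 3 first.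
- by move=> v v' _ Dv'; rewrite mul1r; exact: poisson_w_ge0.
- apply: measurable_funM; first exact: measurable_cst.
  by apply: (@measurable_dom_snd R circ area w2); exact: measurable_poisson_w.
- apply: (cmeas_poly_lim2 (poly_lim2_partial2 hf)).
  + exact: (@cmeas_fst R circ area (fun u => r%:C * expi u)).
  + by apply: (@cmeas_snd R circ area (@toC R)); exact: cmeas_toC.
  + by move=> q [q1 _]; exact: a1.
  + by move=> q [_ /discE].
apply: (@le_trans _ _ (slice_mean2 f r)); last first.
  apply: le_trans (mean2_bound K10 hK1 hf hr) _; apply: lee_wpmul2l; first by rewrite lee_fin ltW.
  exact: en34.
rewrite /msq mean_iterated.
- rewrite le_eqVlt; apply/orP; left; apply/eqP; apply: eq_mean => v _; apply: eq_mean => u _.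
  by rewrite /= mul1r.
- apply/measurable_EFinP; apply: measurable_funM.
    apply: measurable_modulus_sqr; apply: (cmeas_poly_lim2 (poly_lim2_partial2 hf)).
    + exact: (@cmeas_snd R area circ (fun u => r%:C * expi u)).
    + by apply: (@cmeas_fst R area circ (@toC R)); exact: cmeas_toC.
    + by move=> q [_ q1]; exact: a1.
    + by move=> q [/discE].
  apply: measurable_funM; first exact: measurable_cst.
  by apply: (@measurable_dom_fst R area circ w2); exact: measurable_poisson_w.
- by move=> v u Dv _; rewrite lee_fin mulr_ge0 ?sqr_ge0 // mul1r; exact: poisson_w_ge0.
Qed.

Lemma circle_int_monotone (g : C -> C) (k : R) s t : poly_lim g -> 0 <= k -> 0 <= s -> s <= t -> t < 1 ->
  (circle_int (fun z => (modulus (g z) ^+ 2 * k)%:E) s <= circle_int (fun z => (modulus (g z) ^+ 2 * k)%:E) t)%E.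
Proof.
move=> hg k0 s0 st t1; have t0 := le_trans s0 st.
(* The case t = 0 is separate because the dilation factor is s / t. *)
have [t00|tn0] := eqVneq t 0; first by have -> : s = t by apply/eqP; rewrite eq_le st t00 s0.
have ht : modulus (t%:C : C) < 1 by apply: rC; rewrite t0.
have hs : modulus (s%:C : C) < 1 by apply: rC; rewrite s0 (le_lt_trans st).
have cm x : modulus x < 1 -> measurable_fun (dom circ) (fun u => (modulus (g (x * expi u)) ^+ 2)%:E).
  move=> x1; apply/measurable_EFinP; apply: measurable_funTS; apply: continuous_measurable_fun.
  exact: (poly_lim_circle hg x1).
have E x : modulus x < 1 -> mean (S := circ) (fun u => (modulus (g (x * expi u)) ^+ 2 * k)%:E) =
    (k%:E * mean (S := circ) (fun u => (modulus (g (x * expi u)) ^+ 2)%:E))%E.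
  move=> x1; rewrite -meanZ //; last 2 first.
  - by move=> u _; rewrite lee_fin sqr_ge0.
  - exact: cm.
  by apply: eq_mean => u _; rewrite -EFinM mulrC.
rewrite !circle_intE (E _ hs) (E _ ht); apply: lee_wpmul2l; first by rewrite lee_fin.
have hst : 0 <= s / t <= 1 by rewrite divr_ge0 //= ler_pdivrMr ?mul1r // lt_neqAle eq_sym tn0.
have := circ_monotone hg ht hst.
rewrite (eq_mean (S := circ) (g := fun u => (modulus (g (s%:C * expi u)) ^+ 2)%:E)) // => u _.
by rewrite mulrA -rmorphM /= divfK.
Qed.

Lemma slice_mean1_monotone f s t : poly_lim2 f -> 0 <= s -> s <= t -> t < 1 -> (slice_mean1 f s <= slice_mean1 f t)%E.
Proof.
move=> hf s0 st t1; apply: area_le => z z1.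
  by rewrite circle_intE; apply: mean_ge0 => u _; rewrite lee_fin mulr_ge0 ?sqr_ge0 // poisson_ge0.
apply: (circle_int_monotone (g := fun w => partial1 f (z, w))) => //; last exact: poisson_ge0.
by apply: poly_lim2_slice2 => //; exact: poly_lim2_partial1.
Qed.

Lemma slice_mean2_monotone f s t : poly_lim2 f -> 0 <= s -> s <= t -> t < 1 -> (slice_mean2 f s <= slice_mean2 f t)%E.
Proof.
move=> hf s0 st t1; apply: area_le => z z1.
  by rewrite circle_intE; apply: mean_ge0 => u _; rewrite lee_fin mulr_ge0 ?sqr_ge0 // poisson_ge0.
apply: (circle_int_monotone (g := fun w => partial2 f (w, z))) => //; last exact: poisson_ge0.
by apply: poly_lim2_slice1 => //; exact: poly_lim2_partial2.
Qed.

Lemma dirichlet1E f : poly_lim2 f ->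
  dirichlet1 mu1 f = ereal_sup [set slice_mean1 f r | r in [set r | 0 <= r < 1]].
Proof. by move=> hf; apply: lim_at_left_sup => s t; exact: slice_mean1_monotone. Qed.

Lemma dirichlet2E f : poly_lim2 f ->
  dirichlet2 mu2 f = ereal_sup [set slice_mean2 f r | r in [set r | 0 <= r < 1]].
Proof. by move=> hf; apply: lim_at_left_sup => s t; exact: slice_mean2_monotone. Qed.

Lemma dirichlet3E f : poly_lim2 f -> dirichlet3 mu1 mu2 f = mixed_sq (partial1 (partial2 f)).
Proof.
move=> hf; rewrite /mixed_sq /msq mean_iterated.
- rewrite /dirichlet3 area_intE; apply: eq_mean => v _; rewrite area_intE; apply: eq_mean => v' _.
  by rewrite /bidisc_w /toC2 /poisson_w /= -mulrA.
- apply/measurable_EFinP; apply: measurable_funM; last exact: measurable_bidisc_w.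
  by apply: measurable_modulus_sqr; exact: (cmeas_toC2 (poly_lim2_partial1 (poly_lim2_partial2 hf))).
- by move=> v v' Dv Dv'; rewrite lee_fin mulr_ge0 ?sqr_ge0 // bidisc_w_ge0.
Qed.

Theorem norm_energy : exists2 K : R, 0 < K & forall f, poly_lim2 f ->
  (hardy_normsq f + (dirichlet1 mu1 f + dirichlet2 mu2 f + dirichlet3 mu1 mu2 f) <= K%:E * energy f)%E.
Proof.
have [K0 K00 h0] := torus_mean_bound; have [K1 K10 h1] := slice_mean1_bound.
have [K2 K20 h2] := slice_mean2_bound.
exists (K0 + (K1 + K2 + 1)) => [|f hf]; first by rewrite !addr_gt0.
have E0 := energy_ge0 f.
rewrite EFinD (EFinD _ 1) EFinD !ge0_muleDl ?lee_fin ?addr_ge0 ?(ltW K00) ?(ltW K10) ?(ltW K20) //.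
rewrite mul1e; repeat apply: leeD.
- by apply: ge_ereal_sup => _ [r hr <-]; exact: h0.
- by rewrite dirichlet1E //; apply: ge_ereal_sup => _ [r hr <-]; exact: h1.
- by rewrite dirichlet2E //; apply: ge_ereal_sup => _ [r hr <-]; exact: h2.
- by rewrite dirichlet3E // /energy leeDr // !adde_ge0.
Qed.

Let sum_lty (a b c : \bar R) (x : R) : (0 <= a -> 0 <= b -> 0 <= c -> a + b + c < +oo -> x%:E + a + b + c < +oo)%E.
Proof. by case: a => [a| |] //; case: b => [b| |] //; case: c => [c| |] // *; rewrite -!EFinD ltry. Qed.

(** A circle mean of radius 0 is the value at the centre, so the first-order terms of the energy are
    slice means at r = 0, below the suprema that give the Dirichlet integrals. *)
Theorem energy_lty f : poly_lim2 f ->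
  (dirichlet1 mu1 f + dirichlet2 mu2 f + dirichlet3 mu1 mu2 f < +oo)%E -> (energy f < +oo)%E.
Proof.
move=> hf h.
have c0 : [set r : R | 0 <= r < 1] 0 by rewrite /= lexx ltr01.
have d1 : (msq w1 (fun v => partial1 f (toC v, 0%R)) <= dirichlet1 mu1 f)%E.
  rewrite dirichlet1E //; apply: ereal_sup_ubound; exists 0 => //.
  rewrite /slice_mean1 area_intE; apply: eq_mean => v _; rewrite circle_intE -[RHS]mean_circ_cst.
  by apply: eq_mean => u _; rewrite mul0r.
have d2 : (msq w2 (fun v => partial2 f (0%R, toC v)) <= dirichlet2 mu2 f)%E.
  rewrite dirichlet2E //; apply: ereal_sup_ubound; exists 0 => //.
  rewrite /slice_mean2 area_intE; apply: eq_mean => v _; rewrite circle_intE -[RHS]mean_circ_cst.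
  by apply: eq_mean => u _; rewrite mul0r.
have d3 : (mixed_sq (partial1 (partial2 f)) <= dirichlet3 mu1 mu2 f)%E by rewrite dirichlet3E.
have := le_lt_trans (leeD (leeD d1 d2) d3) h.
by rewrite /energy; exact: (sum_lty _ (e2 f) (e3 f) (e4 f)).
Qed.

End energy.

(** * Density *)

Section energy_approximation.
Variable R : realType.
Local Notation C := (R[i]^o)%type.
Local Notation fmeas := {finite_measure set (measurableTypeR R) -> \bar R}.
Implicit Types (f g h F G : C * C -> C) (x z : C) (r s t a : R) (p : {poly {poly C}}).
Local Notation circ := (circ_space R).
Local Notation area := (area_space R).

(** [area_dilation] for each fixed first variable, integrated against [w]. The map [b] allows that
    variable to have been dilated already. *)
Lemma slice_dilation (nu : fmeas) (S : mspace R) (w : pt S -> R) (b : pt S -> C) F a : poly_lim2 F -> 0 < a < 1 ->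
  (forall v, dom S v -> 0 <= w v) -> measurable_fun (dom S) w -> cmeas (dom S) b ->
  (forall v, dom S v -> modulus (b v) < 1) ->
  (a%:E * msq (S := mprod S area) (fun q => w q.1 * poisson_w nu q.2)%R (fun q => F (b q.1, a%:C * toC q.2)%R) <=
   msq (S := mprod S area) (fun q => w q.1 * poisson_w nu q.2)%R (fun q => F (b q.1, toC q.2)))%E.
Proof.
move=> hF ha w0 mw mb b1; have /andP[a0 a1] := ha.
have sc s (q : pt area) : 0 < s <= 1 -> dom area q -> modulus (s%:C * toC q) < 1.
  move=> /andP[s0 s1] /discE q1; rewrite modulusM modulusC gtr0_norm //.
  by apply: le_lt_trans q1; rewrite ler_piMl ?modulus_ge0.
have ha' : 0 < a <= 1 by rewrite a0 ltW.
have h1 : 0 < (1 : R) <= 1 by rewrite ltr01 lexx.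
have mG s : 0 < s <= 1 -> measurable_fun (dom (mprod S area)) (fun q =>
    (modulus (F (b q.1, s%:C * toC q.2)) ^+ 2 * (w q.1 * poisson_w nu q.2))%:E).
  move=> hs; apply/measurable_EFinP; apply: measurable_funM; last first.
    apply: measurable_funM; first exact: measurable_dom_fst.
    by apply: (@measurable_dom_snd R S area (poisson_w nu)); exact: measurable_poisson_w.
  apply: measurable_modulus_sqr; apply: (cmeas_poly_lim2 hF).
  - exact: cmeas_fst.
  - apply: (@cmeas_snd R S area (fun v => s%:C * toC v)).
    by apply: cmeasM; [exact: cmeas_cst|exact: cmeas_toC].
  - by move=> q [q1 _]; exact: b1.
  - by move=> q [_ q2]; exact: sc.
have G0 s v v' : dom S v -> dom area v' ->
    (0 <= (modulus (F (b v, s%:C * toC v')) ^+ 2 * (w v * poisson_w nu v'))%:E)%E.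
  by move=> Dv Dv'; rewrite lee_fin mulr_ge0 ?sqr_ge0 // mulr_ge0 ?w0 // poisson_w_ge0.
have -> : msq (S := mprod S area) (fun q => w q.1 * poisson_w nu q.2) (fun q => F (b q.1, toC q.2)) =
    msq (S := mprod S area) (fun q => w q.1 * poisson_w nu q.2) (fun q => F (b q.1, 1%:C * toC q.2)).
  by apply: eq_msq => q _; rewrite mul1r.
rewrite /msq (mean_iterated (mG _ ha') (G0 a)) (mean_iterated (mG _ h1) (G0 1)) -meanZ ?(ltW a0) //; last 2 first.
- by move=> v Dv; apply: mean_ge0 => v' Dv'; exact: G0.
- exact: (measurable_mean (mG _ ha') (G0 a)).
apply: mean_le => v Dv.
  by apply: mule_ge0; [rewrite lee_fin ltW|apply: mean_ge0 => v' Dv'; exact: G0].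
have hg : poly_lim (fun z => F (b v, z)) := poly_lim2_slice2 hF (b1 v Dv).
have E s : 0 < s <= 1 ->
    mean (S := area) (fun v' => (modulus (F (b v, s%:C * toC v')) ^+ 2 * (w v * poisson_w nu v'))%:E) =
    ((w v)%:E * area_int (fun z => (modulus (F (b v, s%:C * z)) ^+ 2 * poisson nu z)%:E))%E.
  move=> hs; rewrite area_intE -meanZ ?w0 //.
  - by apply: eq_mean => v' _; rewrite -EFinM mulrCA.
  - by move=> v' /discE v1; rewrite lee_fin mulr_ge0 ?sqr_ge0 // poisson_ge0.
  - apply/measurable_EFinP; apply: measurable_funM; last exact: measurable_poisson_w.
    apply: measurable_modulus_sqr; apply: (cmeas_poly_lim hg).
      by apply: cmeasM; [exact: cmeas_cst|exact: cmeas_toC].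
    by move=> v' Dv'; exact: sc.
rewrite /= (E _ ha') (E _ h1) muleCA; apply: lee_wpmul2l; first by rewrite lee_fin w0.
apply: le_trans (area_dilation nu hg ha) _; rewrite le_eqVlt; apply/orP; left; apply/eqP.
by congr area_int; apply/funext => z; rewrite mul1r.
Qed.

Section sequences.
Variables (T : Type) (Fl : set_system T) (FF : Filter Fl).

Lemma clim_horner (p : {poly C}) (b : T -> C) y : clim Fl b y -> clim Fl (fun n => p.[b n]) p.[y].
Proof.
move=> hb; elim/poly_ind: p => [|p c IH].
  by under eq_fun do rewrite horner0; rewrite horner0; exact: clim_cst.
under eq_fun do rewrite hornerMXaddC; rewrite hornerMXaddC.
by apply: climD; [exact: climM|exact: clim_cst].
Qed.

Lemma clim_ev p (a b : T -> C) x y : clim Fl a x -> clim Fl b y ->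
  clim Fl (fun n => ev p (a n, b n)) (ev p (x, y)).
Proof.
move=> ha hb; rewrite /ev /=; elim/poly_ind: p => [|p c IH].
  under eq_fun do rewrite !horner0; rewrite !horner0; exact: clim_cst.
under eq_fun do rewrite hornerMXaddC hornerD hornerM hornerC.
rewrite hornerMXaddC hornerD hornerM hornerC.
by apply: climD; [exact: climM|exact: clim_horner].
Qed.

Lemma poly_lim2_clim F (a b : T -> C) x y : poly_lim2 F -> modulus x < 1 -> modulus y < 1 -> clim Fl a x -> clim Fl b y ->
  clim Fl (fun n => F (a n, b n)) (F (x, y)).
Proof.
move=> hF x1 y1 ha hb e e0.
pose m := Num.max (modulus x) (modulus y).
have m1 : m < 1 by rewrite gt_max x1.
pose r := (1 + m) / 2; have r1 : r < 1 by rewrite /r; lra.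
have mr : m < r by rewrite /r; lra.
have e4 : 0 < e / 4 by rewrite divr_gt0.
have [p hp] := hF r _ r1 e4.
have rm : 0 < r - m by rewrite subr_gt0.
have hev := @clim_ev p a b x y ha hb _ e4.
near=> n.
have near_in (c : T -> C) z : modulus z <= m -> modulus (c n - z) < r - m -> modulus (c n) <= r.
  by move=> zm h; have := modulusD (c n - z) z; rewrite subrK; lra.
have xm : modulus x <= m by rewrite le_max lexx.
have ym : modulus y <= m by rewrite le_max lexx orbT.
have an : modulus (a n) <= r by apply: (near_in a x xm); near: n; exact: ha.
have bn : modulus (b n) <= r by apply: (near_in b y ym); near: n; exact: hb.
have h1 := hp _ _ an bn; have h2 := hp x y (le_trans xm (ltW mr)) (le_trans ym (ltW mr)).
have h3 : modulus (ev p (a n, b n) - ev p (x, y)) < e / 4 by near: n.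
have -> : F (a n, b n) - F (x, y) = (F (a n, b n) - ev p (a n, b n)) + (ev p (a n, b n) - ev p (x, y))
   - (F (x, y) - ev p (x, y)) by ring.
apply: le_lt_trans (modulusD _ _) _; rewrite modulusN.
have := modulusD (F (a n, b n) - ev p (a n, b n)) (ev p (a n, b n) - ev p (x, y)).
lra.
Unshelve. all: by end_near. Qed.

End sequences.

(** The shift by 2 keeps the first radius positive, as dilations require 0 < a < 1. *)
Definition radius (n : nat) : R := 1 - n.+2%:R^-1.

Lemma radius_itv n : 0 < radius n < 1.
Proof.
rewrite /radius subr_gt0 invf_lt1 ?ltr0n // ltr1n /= ltrBlDr ltrDl invr_gt0 ltr0n //.
Qed.

Lemma radius_clim z : clim \oo (fun n => (radius n)%:C * z) z.
Proof.
have h : clim \oo (fun n => (radius n)%:C : C) 1.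
  move=> e e0; have [N _ hN] := near_infty_natSinv_lt (PosNum e0); exists N => // n Nn.
  have -> : (radius n)%:C - 1 = (- n.+2%:R^-1)%:C :> C.
    by rewrite /radius rmorphB rmorph1 rmorphN /=; ring.
  rewrite modulusC normrN ger0_norm ?invr_ge0 //; apply: le_lt_trans (hN n Nn).
  by rewrite lef_pV2 ?posrE ?ltr0n // ler_nat.
by have := climM h (clim_cst (F := \oo) z); rewrite mul1r; apply.
Qed.

Definition dilate a p : {poly {poly C}} :=
  map_poly (comp_poly (a%:C *: 'X)) p \Po ((a%:C)%:P *: 'X).

Lemma ev_dilate a p (z : C * C) : ev (dilate a p) z = ev p (a%:C * z.1, a%:C * z.2).
Proof.
rewrite /ev /dilate horner_comp hornerZ hornerX -rmorphM /=.
have {1}-> : (a%:C * z.1)%:P = comp_poly (a%:C *: 'X) (a%:C * z.1)%:P by rewrite /= comp_polyC.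
by rewrite horner_map /= horner_comp hornerZ hornerX.
Qed.

Lemma poly_lim2_ev p : poly_lim2 (ev p).
Proof. by move=> r e _ e0; exists p => z1 z2 _ _; rewrite subrr Normc.normc0 ltW. Qed.

Lemma poly_lim2B f g : poly_lim2 f -> poly_lim2 g -> poly_lim2 (f \- g).
Proof.
move=> hf hg r e r1 e0; have e2 : 0 < e / 2 by rewrite divr_gt0.
have [p hp] := hf r _ r1 e2; have [q hq] := hg r _ r1 e2.
exists (p - q) => z1 z2 h1 h2.
have -> : (f \- g) (z1, z2) - ev (p - q) (z1, z2) =
    (f (z1, z2) - ev p (z1, z2)) - (g (z1, z2) - ev q (z1, z2)).
  by rewrite /ev !hornerD !hornerN /=; ring.
apply: le_trans (modulusD _ _) _; rewrite modulusN [e]splitr.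
by apply: lerD; [exact: hp|exact: hq].
Qed.

Lemma partial1B f g z1 z2 : poly_lim2 f -> poly_lim2 g -> modulus z1 < 1 -> modulus z2 < 1 ->
  partial1 (f \- g) (z1, z2) = partial1 f (z1, z2) - partial1 g (z1, z2).
Proof. by move=> hf hg h1 h2; apply: partial1_cderiv; apply: has_cderivB; exact: poly_lim2_cderiv1. Qed.

Lemma partial2B f g z1 z2 : poly_lim2 f -> poly_lim2 g -> modulus z1 < 1 -> modulus z2 < 1 ->
  partial2 (f \- g) (z1, z2) = partial2 f (z1, z2) - partial2 g (z1, z2).
Proof. by move=> hf hg h1 h2; apply: partial2_cderiv; apply: has_cderivB; exact: poly_lim2_cderiv2. Qed.

(** Differentiation is local. This is what allows a second derivative of f - g, whose first
    derivative is known only inside the bidisc. *)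
Lemma eq_partial1 f g z1 z2 : (forall w, modulus w < 1 -> f (w, z2) = g (w, z2)) -> poly_lim2 g ->
  modulus z1 < 1 -> modulus z2 < 1 -> partial1 f (z1, z2) = partial1 g (z1, z2).
Proof.
move=> fg hg h1 h2; apply: partial1_cderiv.
apply: has_cderiv_near (poly_lim2_cderiv1 hg h1 h2); last by rewrite fg.
apply/at_P; exists (1 - modulus z1); first by rewrite subr_gt0.
by move=> w wz; symmetry; apply: fg; have := modulusD (w - z1) z1; rewrite subrK; lra.
Qed.

Lemma mixedB f g z1 z2 : poly_lim2 f -> poly_lim2 g -> modulus z1 < 1 -> modulus z2 < 1 ->
  partial1 (partial2 (f \- g)) (z1, z2) = partial1 (partial2 f) (z1, z2) - partial1 (partial2 g) (z1, z2).
Proof.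
move=> hf hg h1 h2; have h := poly_lim2B (poly_lim2_partial2 hf) (poly_lim2_partial2 hg).
rewrite -(partial1B (poly_lim2_partial2 hf) (poly_lim2_partial2 hg) h1 h2).
by apply: (eq_partial1 _ h h1 h2) => w hw; exact: partial2B.
Qed.

Lemma partial1_ev p z1 z2 : partial1 (ev p) (z1, z2) = ev p^`() (z1, z2).
Proof. by apply: partial1_cderiv; exact: has_cderiv_ev1. Qed.

Lemma partial2_ev p z1 z2 : partial2 (ev p) (z1, z2) = ev (deriv2 p) (z1, z2).
Proof. by apply: partial2_cderiv; exact: has_cderiv_ev2. Qed.

Lemma partial1_dilate a p z1 z2 : partial1 (ev (dilate a p)) (z1, z2) = a%:C * ev p^`() (a%:C * z1, a%:C * z2).
Proof.
apply: partial1_cderiv.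
have -> : (fun w => ev (dilate a p) (w, z2)) = fun w => ev p (a%:C * w, a%:C * z2).
  by apply/funext => w; rewrite ev_dilate.
exact: (has_cderiv_scale (G := fun w => ev p (w, a%:C * z2)) (has_cderiv_ev1 p _ _)).
Qed.

Lemma partial2_dilate a p z1 z2 : partial2 (ev (dilate a p)) (z1, z2) = a%:C * ev (deriv2 p) (a%:C * z1, a%:C * z2).
Proof.
apply: partial2_cderiv.
have -> : (fun w => ev (dilate a p) (z1, w)) = fun w => ev p (a%:C * z1, a%:C * w).
  by apply/funext => w; rewrite ev_dilate.
exact: (has_cderiv_scale (G := fun w => ev p (a%:C * z1, w)) (has_cderiv_ev2 p _ _)).
Qed.

Lemma mixed_dilate a p z1 z2 :
  partial1 (partial2 (ev (dilate a p))) (z1, z2) = a%:C ^+ 2 * ev (deriv2 p)^`() (a%:C * z1, a%:C * z2).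
Proof.
apply: partial1_cderiv.
have -> : (fun w => partial2 (ev (dilate a p)) (w, z2)) = fun w => a%:C * ev (deriv2 p) (a%:C * w, a%:C * z2).
  by apply/funext => w; rewrite partial2_dilate.
have h := has_cderivM (has_cderiv_cst (a%:C : C) z1)
  (has_cderiv_scale (G := fun w => ev (deriv2 p) (w, a%:C * z2)) (has_cderiv_ev1 (deriv2 p) (a%:C * z1) (a%:C * z2))).
by move: h; rewrite mul0r add0r mulrA -expr2.
Qed.

(** Replacing the dilation of [f] by that of [p] changes the mixed derivative by the approximation
    error at the dilated point, which is uniformly small. *)
Lemma mixed_error f a p z1 z2 : poly_lim2 f -> modulus z1 < 1 -> modulus z2 < 1 ->
  partial1 (partial2 (f \- ev (dilate a p))) (z1, z2) -
    (partial1 (partial2 f) (z1, z2) - a%:C ^+ 2 * partial1 (partial2 f) (a%:C * z1, a%:C * z2)) =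
  a%:C ^+ 2 * partial1 (partial2 f) (a%:C * z1, a%:C * z2) - a%:C ^+ 2 * ev (deriv2 p)^`() (a%:C * z1, a%:C * z2).
Proof.
have sub_sub (X A B x y : C) : X = A - B -> B = y -> X - (A - x) = x - y by move=> -> ->; ring.
by move=> hf h1 h2; exact: sub_sub (mixedB hf (@poly_lim2_ev (dilate a p)) h1 h2) (mixed_dilate a p z1 z2).
Qed.

Section weights.
Variables mu1 mu2 : fmeas.
Local Notation w1 := (poisson_w mu1).
Local Notation w2 := (poisson_w mu2).
Local Notation W := (bidisc_w mu1 mu2).

Lemma mean_weight (nu : fmeas) : exists2 om : R, 0 <= om & mean (S := area) (fun v => (poisson_w nu v)%:E) = om%:E.
Proof.
have o0 : (0 <= mean (S := area) (fun v => (poisson_w nu v)%:E))%E.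
  by apply: mean_ge0 => v Dv; rewrite lee_fin poisson_w_ge0.
exists (fine (mean (S := area) (fun v => (poisson_w nu v)%:E))); rewrite ?fine_ge0 // fineK //.
by rewrite ge0_fin_numE //; exact: area_poisson_lty.
Qed.

Lemma mean_bidisc_w : exists2 om : R, 0 <= om & mean (S := mprod area area) (fun q => (W q)%:E) = om%:E.
Proof.
have [k1 k10 k1E] := mean_weight mu1; have [k2 k20 k2E] := mean_weight mu2.
have mw nu := @measurable_poisson_w R nu.
exists (k2 * k1); rewrite ?mulr_ge0 // mean_iterated.
- rewrite EFinM -k1E -meanZ //; last 2 first.
  + by move=> v Dv; rewrite lee_fin poisson_w_ge0.
  + by apply/measurable_EFinP; exact: mw.
  apply: eq_mean => v Dv; rewrite -k2E muleC -meanZ //.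
  + exact: poisson_w_ge0.
  + by move=> v' Dv'; rewrite lee_fin poisson_w_ge0.
  + by apply/measurable_EFinP; exact: mw.
- by apply/measurable_EFinP; exact: measurable_bidisc_w.
- by move=> v v' Dv Dv'; rewrite lee_fin bidisc_w_ge0.
Qed.

Let scal a z : 0 <= a <= 1 -> modulus z < 1 -> modulus (a%:C * z) < 1.
Proof.
move=> /andP[a0 a1] z1; rewrite modulusM modulusC ger0_norm //.
by apply: le_lt_trans z1; rewrite ler_piMl ?modulus_ge0.
Qed.

Let ctoC a : cmeas (dom area) (fun v => a%:C * toC v).
Proof. by apply: cmeasM; [exact: cmeas_cst|exact: cmeas_toC]. Qed.

(** The factor a^2 from squaring is at most [a], which is exactly what [area_dilation] can
    absorb. *)
Lemma msq_dilation (nu : fmeas) (g : C -> C) a : poly_lim g -> 0 < a < 1 ->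
  (msq (poisson_w nu) (fun v => a%:C * g (a%:C * toC v))%R <= msq (poisson_w nu) (fun v => g (toC v)))%E.
Proof.
move=> hg ha; have /andP[a0 a1] := ha.
have cg : cmeas (dom area) (fun v => g (a%:C * toC v)).
  by apply: (cmeas_poly_lim hg) => [|v /discE v1]; [exact: ctoC|apply: scal => //; rewrite !ltW].
rewrite (msqZ (@poisson_w_ge0 R nu) (@measurable_poisson_w R nu) a%:C cg).
apply: le_trans (area_dilation nu hg ha).
rewrite modulusC gtr0_norm //; apply: lee_wpmul2r; first by apply: msq_ge0; exact: poisson_w_ge0.
by rewrite lee_fin expr2 ler_piMl // ltW.
Qed.

Lemma cmeas_dilated F a b : poly_lim2 F -> 0 <= a <= 1 -> 0 <= b <= 1 ->
  cmeas (dom (mprod area area)) (fun q => F (a%:C * toC q.1, b%:C * toC q.2)).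
Proof.
move=> hF ha hb; apply: (cmeas_poly_lim2 hF).
- exact: (@cmeas_fst R area area (fun v => a%:C * toC v)).
- exact: (@cmeas_snd R area area (fun v => b%:C * toC v)).
- by move=> q [/discE q1 _]; exact: scal.
- by move=> q [_ /discE q2]; exact: scal.
Qed.

(** The variables are dilated one at a time through the intermediate [X], each step costing 1 / a;
    the squared factor a^4 is at most a^2. *)
Lemma mixed_dilation F a : poly_lim2 F -> 0 < a < 1 ->
  (msq W (fun q => a%:C ^+ 2 * F (a%:C * toC q.1, a%:C * toC q.2))%R <= mixed_sq mu1 mu2 F)%E.
Proof.
move=> hF ha; have /andP[a0 a1] := ha.
have ha' : 0 <= a <= 1 by rewrite !ltW.
have h1 : 0 <= (1 : R) <= 1 by rewrite ler01 lexx.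
have d1 v : dom area v -> modulus (toC v) < 1 by move/discE.
have W0 v v' : dom area v -> dom area v' -> 0 <= W (v, v').
  by move=> Dv Dv'; exact: bidisc_w_ge0.
have mW := @measurable_bidisc_w R mu1 mu2.
rewrite (msqZ (@bidisc_w_ge0 R mu1 mu2) mW _ (cmeas_dilated hF ha' ha')).
pose X := msq W (fun q => F (toC q.1, a%:C * toC q.2)).
have s1 : (a%:E * msq W (fun q => F (a%:C * toC q.1, a%:C * toC q.2)%R) <= X)%E.
  have mF1 : cmeas (dom (mprod area area)) (fun q => F (1%:C * toC q.1, a%:C * toC q.2)) by exact: cmeas_dilated.
  have XE : X = msq W (fun q => F (1%:C * toC q.1, a%:C * toC q.2)).
    by apply: eq_msq => q _; rewrite mul1r.
  rewrite XE (msq_flip W0 mW mF1) (msq_flip W0 mW (cmeas_dilated hF ha' ha')).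
  have comm : (fun q : pt (mprod area area) => W (q.2, q.1)) = fun q => w2 q.1 * w1 q.2.
    by apply/funext => q; rewrite /bidisc_w /= mulrC.
  have := @slice_dilation mu1 area w2 (fun v => a%:C * toC v) (flip F) a (poly_lim2_flip hF) ha
    (@poisson_w_ge0 R mu2) (@measurable_poisson_w R mu2) (ctoC a) (fun v Dv => scal ha' (d1 v Dv)).
  rewrite comm /flip /= => h; apply: le_trans h _.
  by rewrite le_eqVlt; apply/orP; left; apply/eqP; apply: eq_msq => q _; rewrite mul1r.
have s2 : (a%:E * X <= mixed_sq mu1 mu2 F)%E.
  exact: (@slice_dilation mu2 area w1 (@toC R) F a hF ha (@poisson_w_ge0 R mu1) (@measurable_poisson_w R mu1)
    (@cmeas_toC R _) d1).
apply: le_trans s2; apply: le_trans (lee_wpmul2l _ s1); last by rewrite lee_fin ltW.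
rewrite [leRHS]muleA -EFinM; apply: lee_wpmul2r; first by apply: msq_ge0; exact: bidisc_w_ge0.
rewrite lee_fin modulusX modulusC gtr0_norm // -expr2 -exprM -[leRHS]mulr1 (exprD a 2 2) ler_wpM2l ?sqr_ge0 //.
by rewrite expr_le1 // ltW.
Qed.

(** [radon_riesz] handles the three integrals separately and one index serves all of them. The
    dilated polynomial then approximates the dilated function with its derivatives on the whole
    bidisc; at the origin dilation changes nothing. *)
Theorem energy_approx f : poly_lim2 f -> (energy mu1 mu2 f < +oo)%E -> forall d : R, 0 < d ->
  exists p, (energy mu1 mu2 (f \- ev p)%R <= d%:E)%E.
Proof.
move=> hf ef d d0.
have hf1 := poly_lim2_partial1 hf; have hf2 := poly_lim2_partial2 hf; have hf12 := poly_lim2_partial1 hf2.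
have z0 : modulus (0 : C) < 1 by rewrite Normc.normc0.
have d1 v : dom area v -> modulus (toC v) < 1 by move/discE.
have W0 := @bidisc_w_ge0 R mu1 mu2; have mW := @measurable_bidisc_w R mu1 mu2.
have wn0 (nu : fmeas) := @poisson_w_ge0 R nu; have mwn (nu : fmeas) := @measurable_poisson_w R nu.
have A0 := msq_ge0 (wn0 mu1) (fun v => partial1 f (toC v, 0)).
have B0 := msq_ge0 (wn0 mu2) (fun v => partial2 f (0, toC v)).
have M0 := msq_ge0 W0 (fun q => partial1 (partial2 f) (toC2 q)).
have [Af Bf Mf] : [/\ msq w1 (fun v => partial1 f (toC v, 0%R)) < +oo,
    msq w2 (fun v => partial2 f (0%R, toC v)) < +oo &
    msq W (fun q => partial1 (partial2 f) (toC2 q)) < +oo]%E.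
  move: ef A0 B0 M0; rewrite /energy /mixed_sq.
  move: (msq w1 _) (msq w2 _) (msq W _) => A B M ef A0 B0 M0.
  by move: A B M A0 B0 M0 ef => [A| |] [B| |] [M| |] //= *; split; rewrite ?ltry.
pose g1 z := partial1 f (z, 0); pose g2 z := partial2 f (0, z).
have hg1 : poly_lim g1 := poly_lim2_slice1 hf1 z0.
have hg2 : poly_lim g2 := poly_lim2_slice2 hf2 z0.
have cm1 a (g : C -> C) : poly_lim g -> 0 <= a <= 1 -> cmeas (dom area) (fun v => g (a%:C * toC v)).
  by move=> hg ha; apply: (cmeas_poly_lim hg (ctoC a)) => v /d1; exact: scal.
have rad n : 0 <= radius n <= 1 by have /andP[? ?] := radius_itv n; rewrite !ltW.
have radC : clim \oo (fun n => (radius n)%:C : C) 1.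
  by have := @radius_clim 1; under eq_fun do rewrite mulr1.
have lim_g (g : C -> C) z : poly_lim g -> modulus z < 1 ->
    clim \oo (fun n => (radius n)%:C * g ((radius n)%:C * z)) (g z).
  move=> hg z1; rewrite -[g z]mul1r; apply: climM => //.
  have := poly_lim2_clim (Fl := \oo) _ (poly_lim_poly_lim2 hg) z1 z1 (@radius_clim z) (@radius_clim z).
  by apply.
have le_clim (u : nat -> C) (l : C) : clim \oo u l -> forall e : R, 0 < e -> \forall n \near \oo, modulus (l - u n) <= e.
  move=> h e e0; have := h e e0; apply: filterS => n; rewrite modulusB; exact: ltW.
(* Three terms, each doubled by [msq_approx], use up d / 2. *)
have d12 : 0 < d / 12 by rewrite divr_gt0.
have cst1 : cmeas (dom area) (fun v => partial1 f (toC v, 0)).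
  by apply: (cmeas_poly_lim2 hf1); [exact: cmeas_toC|exact: cmeas_cst|exact: d1|].
have cst2 : cmeas (dom area) (fun v => partial2 f (0, toC v)).
  by apply: (cmeas_poly_lim2 hf2); [exact: cmeas_cst|exact: cmeas_toC| |exact: d1].
have N1 := radon_riesz (wn0 mu1) (mwn mu1) (G_ := fun n v => (radius n)%:C * g1 ((radius n)%:C * toC v)) cst1
  (fun n => cmeasM (cmeas_cst _ _) (cm1 _ _ hg1 (rad n))) (fun v Dv => le_clim _ _ (lim_g _ _ hg1 (d1 v Dv)))
  (fun n => msq_dilation mu1 hg1 (radius_itv n)) Af d12.
have N2 := radon_riesz (wn0 mu2) (mwn mu2) (G_ := fun n v => (radius n)%:C * g2 ((radius n)%:C * toC v)) cst2
  (fun n => cmeasM (cmeas_cst _ _) (cm1 _ _ hg2 (rad n))) (fun v Dv => le_clim _ _ (lim_g _ _ hg2 (d1 v Dv)))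
  (fun n => msq_dilation mu2 hg2 (radius_itv n)) Bf d12.
have lim12 q : dom (mprod area area) q -> forall e : R, 0 < e -> \forall n \near \oo,
    modulus (partial1 (partial2 f) (toC2 q) - (radius n)%:C ^+ 2 *
      partial1 (partial2 f) ((radius n)%:C * toC q.1, (radius n)%:C * toC q.2)) <= e.
  move=> [/d1 q1 /d1 q2]; apply: le_clim.
  rewrite -[partial1 _ _]mul1r -[1 in X in clim _ _ X](expr1n _ 2); apply: climM.
    by rewrite expr2; under eq_fun do rewrite expr2; exact: climM.
  have := poly_lim2_clim (Fl := \oo) _ hf12 q1 q2 (@radius_clim (toC q.1)) (@radius_clim (toC q.2)).
  by apply.
have N3 := radon_riesz W0 mW
  (G_ := fun n q => (radius n)%:C ^+ 2 * partial1 (partial2 f) ((radius n)%:C * toC q.1, (radius n)%:C * toC q.2))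
  (cmeas_toC2 hf12) (fun n => cmeasM (cmeas_cst _ _) (cmeas_dilated hf12 (rad n) (rad n))) lim12
  (fun n => mixed_dilation hf12 (radius_itv n)) Mf d12.
have [n [[n1 n2] n3]] := filter_ex (filterI (filterI N1 N2) N3).
set a := radius n in n1 n2 n3; have ha := rad n; rewrite -/a in ha.
have /andP[a0 a1] : 0 < a < 1 := radius_itv n.
have [k1 k10 k1E] := mean_weight mu1; have [k2 k20 k2E] := mean_weight mu2; have [k3 k30 k3E] := mean_bidisc_w.
(* Coefficient of e^2 in the polynomial errors: 1 for the value at the origin and twice the total
   weight for each integral. These errors use the other d / 2. *)
pose L := 1 + 2 * k1 + 2 * k2 + 2 * k3; have L0 : 0 < L by rewrite /L; lra.
pose e := Num.sqrt (d / 2 / L); have e0 : 0 < e by rewrite sqrtr_gt0 !divr_gt0.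
have e2 : L * e ^+ 2 = d / 2.
  by rewrite sqr_sqrtr ?divr_ge0 ?(ltW d0) ?(ltW L0) // mulrC divfK // gt_eqF.
have [p hp] := poly_lim2_approx hf a1 e0; exists (dilate a p).
have az z : modulus z < 1 -> modulus (a%:C * z) <= a.
  by move=> z1; rewrite modulusM modulusC gtr0_norm // ler_piMr // ltW.
have az0 : modulus (a%:C * 0 : C) <= a by rewrite mulr0 Normc.normc0 ltW.
have ma : modulus (a%:C : C) <= 1 by rewrite modulusC gtr0_norm // ltW.
have hq := @poly_lim2_ev (dilate a p).
have sml (k x y : C) : modulus k <= 1 -> modulus (x - y) <= e -> modulus (k * x - k * y) <= e.
  by move=> hk h; rewrite -mulrBr modulusM -[leRHS]mul1r ler_pM ?modulus_ge0.
have fin (X : \bar R) (k : R) : (X <= (d / 12)%:E)%E ->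
    (2%:E * X + (2 * e ^+ 2)%:E * k%:E <= (2 * (d / 12) + 2 * e ^+ 2 * k)%:E)%E.
  move=> h; rewrite (EFinD (2 * (d / 12))) (EFinM 2 (d / 12)) (EFinM (2 * e ^+ 2) k).
  by apply: leeD; [apply: lee_wpmul2l h; rewrite lee_fin|exact: lexx].
have subBB (A x y : C) : (A - x) - (A - y) = y - x by ring.
have t0 : modulus ((f \- ev (dilate a p)) (0, 0)) ^+ 2 <= e ^+ 2.
  rewrite /= ev_dilate /= !mulr0 lerXn2r ?nnegrE ?modulus_ge0 ?(ltW e0) //.
  by move: az0; rewrite mulr0 => a00; have [] := hp 0 0 a00 a00.
have t1 : (msq w1 (fun v => partial1 (f \- ev (dilate a p))%R (toC v, 0%R)) <= (2 * (d / 12) + 2 * e ^+ 2 * k1)%:E)%E.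
  apply: le_trans (msq_approx (wn0 mu1) (mwn mu1) (e := e)
     (G := fun v => partial1 f (toC v, 0) - a%:C * g1 (a%:C * toC v)) _ (ltW e0) _) _.
  - by apply: cmeasB => //; apply: cmeasM; [exact: cmeas_cst|exact: cm1].
  - move=> v /d1 v1; rewrite (partial1B hf hq v1 z0) partial1_dilate subBB mulr0.
    apply: sml => //; rewrite /g1; have [] := hp _ _ (az _ v1) az0.
    by rewrite mulr0.
  - by rewrite k1E; exact: (fin _ _ n1).
have t2 : (msq w2 (fun v => partial2 (f \- ev (dilate a p))%R (0%R, toC v)) <= (2 * (d / 12) + 2 * e ^+ 2 * k2)%:E)%E.
  apply: le_trans (msq_approx (wn0 mu2) (mwn mu2) (e := e)
     (G := fun v => partial2 f (0, toC v) - a%:C * g2 (a%:C * toC v)) _ (ltW e0) _) _.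
  - by apply: cmeasB => //; apply: cmeasM; [exact: cmeas_cst|exact: cm1].
  - move=> v /d1 v1; rewrite (partial2B hf hq z0 v1) partial2_dilate subBB mulr0.
    apply: sml => //; rewrite /g2; have [] := hp _ _ az0 (az _ v1).
    by rewrite mulr0.
  - by rewrite k2E; exact: (fin _ _ n2).
have t3 : (mixed_sq mu1 mu2 (partial1 (partial2 (f \- ev (dilate a p))%R)) <= (2 * (d / 12) + 2 * e ^+ 2 * k3)%:E)%E.
  apply: le_trans (msq_approx W0 mW (e := e)
     (G := fun q => partial1 (partial2 f) (toC2 q) - a%:C ^+ 2 * partial1 (partial2 f) (a%:C * toC q.1, a%:C * toC q.2)) _ (ltW e0) _) _.
  - apply: cmeasB; first exact: cmeas_toC2.
    by apply: cmeasM; [exact: cmeas_cst|exact: cmeas_dilated].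
  - move=> q [/d1 q1 /d1 q2]; rewrite /toC2 (mixed_error a p hf q1 q2).
    apply: sml; first by rewrite modulusX expr_le1 // modulus_ge0.
    by have [_ _ _ h _] := hp _ _ (az _ q1) (az _ q2); exact: h.
  - by rewrite k3E; exact: (fin _ _ n3).
have t0' : ((modulus ((f \- ev (dilate a p))%R (0, 0)%R) ^+ 2)%:E <= (e ^+ 2)%:E)%E by rewrite lee_fin.
apply: le_trans (leeD (leeD (leeD t0' t1) t2) t3) _.
rewrite -!EFinD lee_fin; move: e2; rewrite /L !mulrDl mul1r; lra.
Qed.

End weights.

End energy_approximation.

(** * Torus means and the Hardy space, the case of the zero measure; energy of polynomials *)

Section hardy_space.
Variable R : realType.
Local Notation C := (R[i]^o)%type.
Implicit Types (f g h F G : C * C -> C) (x z : C) (r s t a : R) (p : {poly {poly C}}).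
Local Notation circ := (circ_space R).

Definition torus (r : R) f : pt (mprod circ circ) -> C := fun q => f (r%:C * expi q.1, r%:C * expi q.2).

Let one (q : pt (mprod circ circ)) : R := 1.
Let one_ge0 q : dom (mprod circ circ) q -> 0 <= one q. Proof. by move=> _; exact: ler01. Qed.
Let measurable_one : measurable_fun (dom (mprod circ circ)) one. Proof. exact: measurable_cst. Qed.

Let mean_one : mean (S := mprod circ circ) (fun q => (one q)%:E) = 1%E.
Proof.
rewrite mean_iterated => [||u u' _ _]; last by rewrite lee_fin ler01.
  rewrite -[RHS](mean_circ_cst 1%E); apply: eq_mean => u _; exact: (mean_circ_cst 1%E).
by apply/measurable_EFinP.
Qed.

Lemma cmeas_circ r : cmeas (dom circ) (fun u => r%:C * expi u).
Proof.
by apply: cmeasM; [exact: cmeas_cst|apply: cmeas_expi; apply: measurable_funTS; exact: measurable_id].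
Qed.

Lemma modulus_circ r (u : R) : 0 <= r < 1 -> modulus (r%:C * expi u) < 1.
Proof. by move=> /andP[r0 r1]; rewrite modulus_rexpi ger0_norm. Qed.

Lemma cmeas_torus r f : poly_lim2 f -> 0 <= r < 1 -> cmeas (dom (mprod circ circ)) (torus r f).
Proof.
move=> hf hr; apply: (cmeas_poly_lim2 hf).
- exact: (@cmeas_fst R circ circ (fun u => r%:C * expi u) (cmeas_circ r)).
- exact: (@cmeas_snd R circ circ (fun u => r%:C * expi u) (cmeas_circ r)).
- by move=> q _; exact: modulus_circ.
- by move=> q _; exact: modulus_circ.
Qed.

Lemma torus_meanE r f : poly_lim2 f -> 0 <= r < 1 -> torus_mean f r = msq one (torus r f).
Proof.
move=> hf hr; rewrite /msq mean_iterated => [||u u' _ _]; last by rewrite lee_fin mulr_ge0 ?sqr_ge0.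
  rewrite /torus_mean circle_intE; apply: eq_mean => u _; rewrite circle_intE.
  by apply: eq_mean => u' _; rewrite /one mulr1.
by apply/measurable_EFinP; apply: measurable_funM => //; apply: measurable_modulus_sqr; exact: cmeas_torus.
Qed.

(** The radii are enlarged one at a time, the second by growth of circle means and the first by the
    same step after flipping. *)
Lemma torus_mean_monotone f s t : poly_lim2 f -> 0 <= s -> s <= t -> t < 1 -> (torus_mean f s <= torus_mean f t)%E.
Proof.
move=> hf s0 st t1; have t0 := le_trans s0 st; have s1 := le_lt_trans st t1.
have hs : 0 <= s < 1 by rewrite s0. have ht : 0 <= t < 1 by rewrite t0.
have st1 : 0 <= 1 :> R by exact: ler01.
pose M f s t := mean (S := circ) (fun u => mean (S := circ) (fun u' =>
  (modulus (f (s%:C * expi u, t%:C * expi u')) ^+ 2 * 1)%:E)).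
have step g r : poly_lim2 g -> 0 <= r < 1 -> (M g r s <= M g r t)%E.
  move=> hg hr; apply: mean_le => u _.
    by apply: mean_ge0 => u' _; rewrite lee_fin mulr_ge0 ?sqr_ge0.
  exact: (circle_int_monotone (poly_lim2_slice2 hg (modulus_circ u hr)) st1 s0 st t1).
have ME g r r' : poly_lim2 g -> 0 <= r < 1 -> 0 <= r' < 1 -> M g r r' = M (flip g) r' r.
  move=> hg hr hr'; rewrite /M.
  rewrite (mean_swap (S := circ) (T := circ) (F := fun q => (modulus (g (r%:C * expi q.1, r'%:C * expi q.2)) ^+ 2 * 1)%:E)) //.
  - apply/measurable_EFinP; apply: measurable_funM => //; apply: measurable_modulus_sqr; apply: (cmeas_poly_lim2 hg).
    + exact: (@cmeas_fst R circ circ (fun u => r%:C * expi u) (cmeas_circ r)).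
    + exact: (@cmeas_snd R circ circ (fun u => r'%:C * expi u) (cmeas_circ r')).
    + by move=> q _; exact: modulus_circ.
    + by move=> q _; exact: modulus_circ.
  - by move=> u u' _ _; rewrite lee_fin mulr_ge0 ?sqr_ge0.
have TE r : torus_mean f r = M f r r.
  rewrite /torus_mean circle_intE; apply: eq_mean => u _; rewrite circle_intE.
  by apply: eq_mean => u' _; rewrite mulr1.
rewrite !TE; apply: (le_trans (step f s hf hs)).
rewrite (ME _ _ _ hf hs ht) (ME _ _ _ hf ht ht); apply: step => //; exact: poly_lim2_flip.
Qed.

Lemma poly_lim2_dilated f a : poly_lim2 f -> 0 <= a <= 1 -> poly_lim2 (fun z : C * C => f (a%:C * z.1, a%:C * z.2)).
Proof.
move=> hf /andP[a0 a1] r e r1 e0; have [p hp] := hf r e r1 e0; exists (dilate a p) => z1 z2 h1 h2.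
have sc z : modulus z <= r -> modulus (a%:C * z) <= r.
  by move=> zr; rewrite modulusM modulusC ger0_norm //; apply: le_trans zr; rewrite ler_piMl ?modulus_ge0.
by rewrite ev_dilate /=; apply: hp; exact: sc.
Qed.

Lemma poly_lim2D f g : poly_lim2 f -> poly_lim2 g -> poly_lim2 (f \+ g).
Proof.
move=> hf hg; have -> : f \+ g = f \- (ev 0 \- g).
  by apply/funext => -[z1 z2]; rewrite /= /ev !horner0 sub0r opprK.
exact: (poly_lim2B hf (poly_lim2B (@poly_lim2_ev R 0) hg)).
Qed.

(* With [H] the Hardy norm of [f] and [f_n] its dilations, the parallelogram law
   gives [M(f - f_n, r) <= 4 H - M(f + f_n, r0)] for all [r >= r0]. *)
Theorem hardy_approx f : poly_lim2 f -> (hardy_normsq f < +oo)%E -> forall d : R, 0 < d ->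
  exists p, (hardy_normsq (f \- ev p)%R <= d%:E)%E.
Proof.
move=> hf fH d d0.
have Mle r : 0 <= r < 1 -> (torus_mean f r <= hardy_normsq f)%E.
  by move=> hr; apply: ereal_sup_ubound; exists r.
have tm0 g r : poly_lim2 g -> 0 <= r < 1 -> (0 <= torus_mean g r)%E.
  by move=> hg hr; rewrite torus_meanE //; exact: msq_ge0.
have c0 : 0 <= (0 : R) < 1 by rewrite lexx ltr01.
have H0 : (0 <= hardy_normsq f)%E := le_trans (tm0 _ _ hf c0) (Mle _ c0).
have Hf : hardy_normsq f \is a fin_num by rewrite ge0_fin_numE.
pose H := fine (hardy_normsq f); have HE : hardy_normsq f = H%:E by rewrite /H fineK.
(* The distance to the dilation will be at most 4 d'; doubled by [msq_approx] it uses d / 2, and 2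
   e^2 with e^2 = d / 4 uses the rest. *)
pose d' := d / 16; have d'0 : 0 < d' by rewrite divr_gt0.
have [_ [r0 hr0 <-] hH] : exists2 y : \bar R, [set torus_mean f r | r in [set r : R | 0 <= r < 1]] y & ((H - d')%:E < y)%E.
  by apply: ereal_sup_gt; rewrite -/(hardy_normsq f) HE lte_fin gtrBl.
pose fn n (z : C * C) := f ((radius R n)%:C * z.1, (radius R n)%:C * z.2).
have rad n : 0 <= radius R n <= 1 by have /andP[? ?] := radius_itv R n; rewrite !ltW.
have hfn n : poly_lim2 (fn n) by exact: poly_lim2_dilated.
have radr n r : 0 <= r < 1 -> 0 <= radius R n * r < 1.
  move=> /andP[q0 q1]; have /andP[? ?] := rad n; rewrite mulr_ge0 //=.
  by apply: le_lt_trans q1; rewrite ler_piMl.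
have fnM n r : 0 <= r < 1 -> (torus_mean (fn n) r <= H%:E)%E.
  move=> hr; rewrite -HE; apply: le_trans (Mle _ (radr n r hr)).
  rewrite (torus_meanE hf (radr n r hr)) (torus_meanE (hfn n) hr) le_eqVlt; apply/orP; left; apply/eqP.
  by apply: eq_msq => q _; rewrite /torus /fn /= !mulrA -!rmorphM.
have par n r : 0 <= r < 1 ->
    (torus_mean (f \- fn n)%R r + torus_mean (f \+ fn n)%R r <= (4 * H)%:E)%E.
  move=> hr; rewrite (torus_meanE (poly_lim2B hf (hfn n)) hr) (torus_meanE (poly_lim2D hf (hfn n)) hr).
  have := msq_parallelogram one_ge0 measurable_one (cmeas_torus hf hr) (cmeas_torus (hfn n) hr).
  rewrite -(torus_meanE hf hr) -(torus_meanE (hfn n) hr) => E.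
  rewrite [leLHS]E; apply: (@le_trans _ _ (2%:E * H%:E + 2%:E * H%:E)%E).
    have n2 : (0 <= 2%:E :> \bar R)%E by rewrite lee_fin.
    have fM : (torus_mean f r <= H%:E)%E by rewrite -HE; exact: Mle.
    exact: (leeD (lee_wpmul2l n2 fM) (lee_wpmul2l n2 (fnM n r hr))).
  by rewrite -!EFinM -EFinD lee_fin; lra.
have fat : (msq one (torus r0 (f \+ f)%R) <= limn_einf (fun n => msq one (torus r0 (f \+ fn n)%R)))%E.
  apply: (mean_fatou (f := fun n q => (modulus (torus r0 (f \+ fn n) q) ^+ 2 * one q)%:E)) => [n q Dq|n|q Dq].
  - by rewrite lee_fin mulr_ge0 ?sqr_ge0.
  - apply/measurable_EFinP; apply: measurable_funM => //; apply: measurable_modulus_sqr.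
    by apply: cmeas_torus => //; exact: poly_lim2D.
  apply: cvg_EFin; first by near=> n.
  apply: cvgM; last exact: cvg_cst.
  apply: modulus_sqr_cvg => e e0.
  have q1 := modulus_circ q.1 hr0; have q2 := modulus_circ q.2 hr0.
  have := poly_lim2_clim (Fl := \oo) eventually_filter hf q1 q2 (@radius_clim R _) (@radius_clim R _) e0.
  by apply: filterS => n h; rewrite /torus /fn /= opprD addrACA subrr add0r modulusB; exact: ltW.
have E4 : msq one (torus r0 (f \+ f)%R) = (4%:E * torus_mean f r0)%E.
  rewrite (torus_meanE hf hr0) (_ : (4%:E : \bar R) = (modulus (2 : C) ^+ 2)%:E); last first.
    by rewrite modulus_natr; congr (_%:E); ring.
  rewrite -(msqZ one_ge0 measurable_one _ (cmeas_torus hf hr0)).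
  by apply: eq_msq => q _; rewrite /torus /= mulr_natl mulr2n.
have {}fat : ((4 * H - 4 * d')%:E < limn_einf (fun n => msq one (torus r0 (f \+ fn n)%R)))%E.
  apply: lt_le_trans fat; rewrite E4 -mulrBr EFinM.
  by rewrite lte_pmul2l.
have [N _ hN] := lt_limn_einf fat; have {}hN := hN N (leqnn N); rewrite /= in hN.
set a := radius R N; have /andP[a0 a1] : 0 < a < 1 := radius_itv R N.
have small r : 0 <= r < 1 -> (torus_mean (f \- fn N)%R r <= (4 * d')%:E)%E.
  move=> /andP[rr0 rr1]; have /andP[r00 r01] := hr0.
  (* A common radius at which both means dominate: that of the difference at [r] and that of the sum
     at [r0]. *)
  pose r' := Num.max r r0; have hr' : 0 <= r' < 1 by rewrite le_max rr0 gt_max rr1.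
  have hr'1 : r' < 1 by case/andP: hr'.
  have m1 : (torus_mean (f \- fn N)%R r <= torus_mean (f \- fn N)%R r')%E.
    by apply: torus_mean_monotone => //; [exact: poly_lim2B|rewrite le_max lexx].
  have m2 : (torus_mean (f \+ fn N)%R r0 <= torus_mean (f \+ fn N)%R r')%E.
    by apply: torus_mean_monotone => //; [exact: poly_lim2D|rewrite le_max lexx orbT].
  apply: (le_trans m1); have := par N r' hr'; move: hN; rewrite -(torus_meanE (poly_lim2D hf (hfn N)) hr0) => hN.
  have := lt_le_trans hN m2; have := tm0 _ _ (poly_lim2B hf (hfn N)) hr'.
  case: (torus_mean _ r') => [A| |] //; case: (torus_mean _ r') => [B| |] //.
  by rewrite -EFinD !lee_fin lte_fin; lra.
pose e := Num.sqrt (d / 4); have e0 : 0 < e by rewrite sqrtr_gt0 divr_gt0.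
have e2 : e ^+ 2 = d / 4 by rewrite sqr_sqrtr // ltW // divr_gt0.
have [p hp] := hf a e a1 e0; exists (dilate a p).
apply: ge_ereal_sup => _ [r hr <-]; rewrite -/(torus_mean _ r).
have hq := @poly_lim2_ev R (dilate a p).
rewrite (torus_meanE (poly_lim2B hf hq) hr).
apply: le_trans (msq_approx one_ge0 measurable_one (e := e) (G := torus r (f \- fn N))
  (cmeas_torus (poly_lim2B hf (hfn N)) hr) (ltW e0) _) _.
  move=> q _; rewrite /torus /= ev_dilate /fn /= -/a.
  have az u : modulus (a%:C * (r%:C * expi u)) <= a.
    by rewrite modulusM modulusC gtr0_norm // ler_piMr ?(ltW a0) // ltW // modulus_circ.
  have subBB (A x y : C) : (A - x) - (A - y) = y - x by ring.
  by rewrite subBB; apply: hp; exact: az.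
rewrite mean_one mule1 -(torus_meanE (poly_lim2B hf (hfn N)) hr).
apply: (@le_trans _ _ (2%:E * (4 * d')%:E + (2 * e ^+ 2)%:E)%E).
  by apply: leeD => //; apply: lee_wpmul2l; rewrite ?lee_fin // small.
by rewrite -EFinM -EFinD lee_fin e2 /d'; lra.
Unshelve. all: by end_near. Qed.

Lemma ev_bounded p : exists2 M : R, 0 <= M & forall z1 z2, modulus z1 <= 1 -> modulus z2 <= 1 ->
  modulus (ev p (z1, z2)) <= M.
Proof.
have h1 (q : {poly C}) : exists2 M : R, 0 <= M & forall z, modulus z <= 1 -> modulus q.[z] <= M.
  elim/poly_ind: q => [|q c [M M0 hM]]; first by exists 0 => // z _; rewrite horner0 Normc.normc0.
  exists (M + modulus c) => [|z z1]; first by rewrite addr_ge0 ?modulus_ge0.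
  rewrite hornerMXaddC; apply: le_trans (modulusD _ _) _; rewrite lerD2r modulusM.
  by rewrite -[leRHS]mulr1; apply: ler_pM; rewrite ?modulus_ge0 // hM.
rewrite /ev /=; elim/poly_ind: p => [|p c [M M0 hM]].
  by exists 0 => // z1 z2 _ _; rewrite !horner0 Normc.normc0.
have [N N0 hN] := h1 c; exists (M + N) => [|z1 z2 z11 z21]; first exact: addr_ge0.
rewrite hornerMXaddC hornerD hornerM hornerC; apply: le_trans (modulusD _ _) _.
apply: lerD; last exact: hN.
by rewrite modulusM -[leRHS]mulr1; apply: ler_pM; rewrite ?modulus_ge0 // hM.
Qed.

Lemma hardy_ev p : (hardy_normsq (ev p) < +oo)%E.
Proof.
have [M M0 hM] := ev_bounded p; apply: (@le_lt_trans _ _ (M ^+ 2)%:E); last exact: ltry.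
apply: ge_ereal_sup => _ [r hr <-].
have h1 : (fun=> (M ^+ 2)%:E) = fun _ : R => mean (S := circ) (fun=> (M ^+ 2)%:E).
  by apply/funext => _; rewrite mean_circ_cst.
rewrite -[leRHS](mean_circ_cst) circle_intE; apply: mean_le => u _.
  by rewrite circle_intE; apply: mean_ge0 => u' _; rewrite lee_fin sqr_ge0.
rewrite -[leRHS](mean_circ_cst) circle_intE; apply: mean_le => u' _; rewrite lee_fin ?sqr_ge0 //.
rewrite lerXn2r ?nnegrE ?modulus_ge0 //.
by apply: hM; apply: ltW; exact: modulus_circ.
Qed.

Lemma differentiable_ev p (z : C * C) : differentiable (ev p) z.
Proof.
have d1 (w : C * C) : differentiable (fun w : C * C => w.1) w 
  by apply: (@linear_differentiable _ _ _ (fst : {linear (C * C)%type -> C})) => x; exact: cvg_fst.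
have d2 (w : C * C) : differentiable (fun w : C * C => w.2) w 
  by apply: (@linear_differentiable _ _ _ (snd : {linear (C * C)%type -> C})) => x; exact: cvg_snd.
have h1 (q : {poly C}) : differentiable (fun w : C * C => q.[w.2] : C) z.
  elim/poly_ind: q => [|q c IH].
    by under eq_fun do rewrite horner0; exact: differentiable_cst.
  under eq_fun do rewrite hornerMXaddC.
  by apply: differentiableD; [exact: (differentiableM IH (d2 z))|exact: differentiable_cst].
rewrite /ev; elim/poly_ind: p => [|p c IH].
  by under eq_fun do rewrite !horner0; exact: differentiable_cst.
under eq_fun do rewrite hornerMXaddC hornerD hornerM hornerC.
by apply: differentiableD; [exact: (differentiableM IH (d1 z))|exact: h1].
Qed.

Lemma energy_ev (mu1 mu2 : {finite_measure set (measurableTypeR R) -> \bar R}) p :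
  (energy mu1 mu2 (ev p) < +oo)%E.
Proof.
have bnd (S : mspace R) (w : pt S -> R) (F : pt S -> C) (M k : R) :
    (forall v, dom S v -> 0 <= w v) -> measurable_fun (dom S) w -> mean (fun v => (w v)%:E) = k%:E ->
    0 <= M -> (forall v, dom S v -> modulus (F v) <= M) -> (msq w F < +oo)%E.
  move=> w0 mw wE M0 FM.
  apply: le_lt_trans (msq_approx w0 mw (e := M) (G := fun=> 0) (cmeas_cst _ _) M0 _) _.
    by move=> v Dv; rewrite subr0 FM.
  rewrite (_ : msq w (fun=> 0) = 0%E) ?mule0 ?add0e ?wE -?EFinM ?ltry //.
  rewrite /msq (eq_mean (g := fun=> 0%E)).
    by rewrite /mean integral0 mule0.
  by move=> v _; rewrite Normc.normc0 expr0n mul0r.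
have [M1 M10 h1] := ev_bounded p^`(); have [M2 M20 h2] := ev_bounded (deriv2 p).
have [M3 M30 h3] := ev_bounded (deriv2 p)^`().
have [k1 k10 k1E] := mean_weight mu1; have [k2 k20 k2E] := mean_weight mu2.
have [k3 k30 k3E] := mean_bidisc_w mu1 mu2.
have z0 : modulus (0 : C) <= 1 by rewrite Normc.normc0.
have d1 v : dom (area_space R) v -> modulus (toC v) <= 1 by move/discE/ltW.
have e1 := bnd (area_space R) _ (fun v => partial1 (ev p) (toC v, 0)) M1 k1 (@poisson_w_ge0 R mu1) (@measurable_poisson_w R mu1) k1E M10.
have e2 := bnd (area_space R) _ (fun v => partial2 (ev p) (0, toC v)) M2 k2 (@poisson_w_ge0 R mu2) (@measurable_poisson_w R mu2) k2E M20.
have e3 := bnd (mprod (area_space R) (area_space R)) _ (fun q => partial1 (partial2 (ev p)) (toC2 q)) M3 k3 (@bidisc_w_ge0 R mu1 mu2) (@measurable_bidisc_w R mu1 mu2) k3E M30.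
have {}e1 : (msq (poisson_w mu1) (fun v => partial1 (ev p) (toC v, 0%R)) < +oo)%E.
  by apply: e1 => v /d1 v1; rewrite partial1_ev; exact: h1.
have {}e2 : (msq (poisson_w mu2) (fun v => partial2 (ev p) (0%R, toC v)) < +oo)%E.
  by apply: e2 => v /d1 v1; rewrite partial2_ev; exact: h2.
have {}e3 : (mixed_sq mu1 mu2 (partial1 (partial2 (ev p))) < +oo)%E.
  apply: e3 => q [/d1 q1 /d1 q2]; rewrite /toC2.
  have -> : partial2 (ev p) = ev (deriv2 p) by apply/funext => -[z1 z2]; exact: partial2_ev.
  by rewrite partial1_ev; exact: h3.
have add_lty (x : R) (A B D : \bar R) : (A < +oo -> B < +oo -> D < +oo -> x%:E + A + B + D < +oo)%E.
  by case: A => [A| |] //; case: B => [B| |] //; case: D => [D| |] // *; rewrite -!EFinD ltry.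
by rewrite /energy; exact: (add_lty _ _ _ _ e1 e2 e3).
Qed.

(** The lower bound on Poisson integrals needs mass on the arc. As the measures vanish off the arc,
    a factor without such mass is zero and so is the product. *)
Lemma nonzero_product (mu1 mu2 : {finite_measure set (measurableTypeR R) -> \bar R}) :
  on_circle mu1 -> on_circle mu2 -> ~ zero_product mu1 mu2 -> mu1 (@arc R) != 0%E /\ mu2 (@arc R) != 0%E.
Proof.
move=> hm1 hm2 nz.
have full (mu : {finite_measure set (measurableTypeR R) -> \bar R}) : on_circle mu -> mu (@arc R) = 0%E -> mu setT = 0%E.
  move=> h1 h2; apply/eqP; rewrite -measure_le0 -(setvU (@arc R)).
  apply: le_trans (measureU2 _ _ _) _; [by apply: measurableC; exact: measurable_arc|exact: measurable_arc|].
  rewrite le_eqVlt; apply/orP; left; apply/eqP; transitivity (0 + 0 : \bar R)%E; last exact: adde0.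
  by congr (_ + _)%E; [exact: h1|exact: h2].
have zero : (mu1 setT * mu2 setT = 0)%E -> zero_product mu1 mu2.
  move=> h A mA; apply/eqP; rewrite -measure_le0; apply: le_trans (_ : _ <= (mu1 \x mu2)%E (setT `*` setT))%E _.
    by apply: le_measure; rewrite ?inE //; exact: measurableX.
  by rewrite product_measure1E // h.
by split; apply/eqP => /full h; apply: nz; apply: zero; rewrite h // ?mul0e ?mule0.
Qed.

End hardy_space.

(** * Conclusion: density in the norm *)

Section density.
Variable R : realType.
Local Notation C := (R[i]^o)%type.

Lemma sqrte_lt (X : \bar R) (e : R) : 0 < e -> (X <= ((e / 2) ^+ 2)%:E)%E -> (sqrte X < e%:E)%E.
Proof.
move=> e0; case: X => [x| |] /=; [|by rewrite leye_eq|by rewrite ?lte_fin ?ltNye].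
rewrite lee_fin lte_fin => h; apply: (@le_lt_trans _ _ (e / 2)); last by lra.
have e20 : 0 <= e / 2 by lra.
by rewrite -(ger0_norm e20) -sqrtr_sqr ler_sqrt // sqr_ge0.
Qed.

End density.

Theorem theorem3p16 (R : realType)
  (mu1 mu2 : {finite_measure set (measurableTypeR R) -> \bar R})
  (hmu1 : on_circle mu1) (hmu2 : on_circle mu2) :
  dense_subset (dirichlet_norm mu1 mu2)
    (@polynomial_functions R) (dirichlet_space mu1 mu2).
Proof.
have [z|nz] := pselect (zero_product mu1 mu2).
  rewrite /dense_subset /dirichlet_space /dirichlet_norm /dirichlet asboolT //; split.
    by move=> _ [p ->]; split; [move=> x _; exact: differentiable_ev|exact: hardy_ev].
  move=> f [/holomorphic2_poly_lim2 hf fH] e e0.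
  have d0 : 0 < (e / 2) ^+ 2 by rewrite exprn_gt0 // divr_gt0.
  have [p hp] := hardy_approx hf fH d0; exists (ev p); first by exists p.
  by rewrite adde0; exact: sqrte_lt.
have [n1 n2] := nonzero_product hmu1 hmu2 nz; have [K K0 hK] := norm_energy n1 n2.
rewrite /dense_subset /dirichlet_space /dirichlet_norm asboolF //; split.
  move=> _ [p ->]; split; first by move=> x _; exact: differentiable_ev.
  (* Polynomials belong to the space: their Dirichlet integral is at most the squared norm, hence at
     most [K] times their finite energy. *)
  rewrite /dirichlet asboolF //; have := hK _ (@poly_lim2_ev R p).
  have : (0 <= hardy_normsq (ev p))%E.
    apply: le_trans (_ : _ <= torus_mean (ev p) 0)%E _; last first.
      by apply: ereal_sup_ubound; exists 0 => //=; rewrite lexx ltr01.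
    rewrite /torus_mean circle_intE; apply: mean_ge0 => u _; rewrite circle_intE; apply: mean_ge0 => u' _.
    by rewrite lee_fin sqr_ge0.
  move=> h0 h; apply: le_lt_trans (le_trans (leeDr _ h0) h) _.
  by apply: lte_mul_pinfty; rewrite ?lee_fin ?(ltW K0) // energy_ev.
move=> f [/holomorphic2_poly_lim2 hf]; rewrite /dirichlet asboolF // => /(energy_lty hf) fE e e0.
(* Dividing by [K] prepares for the passage from energy to squared norm; using e / 2 leaves room for
   the strict inequality. *)
have d0 : 0 < (e / 2) ^+ 2 / K by rewrite divr_gt0 // exprn_gt0 // divr_gt0.
have [p hp] := energy_approx hf fE d0; exists (ev p); first by exists p.
apply: sqrte_lt => //.
apply: le_trans (hK _ (poly_lim2B hf (@poly_lim2_ev R p))) _.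
apply: le_trans (lee_wpmul2l _ hp) _; first by rewrite lee_fin ltW.
by rewrite -EFinM lee_fin mulrC divfK // gt_eqF.
Qed.
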